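(* Let $\mathbb{A}_n^m$, the basis $\{I_k\}_{k=1}^n$, the vectors $e_1=1,e_2,e_3$, the real space $E_3$ and the functionals $f_u$ be as described in the context, and let $f_u(E_3)=\mathbb{C}$ for all $u=1,2,\ldots,m$. Let $\Omega\subset\mathbb{R}^3$ be an arbitrary domain and $\Omega_\zeta=\{xe_1+ye_2+ze_3:(x,y,z)\in\Omega\}$. Then for every monogenic function $\Phi:\Omega_\zeta\to\mathbb{A}_n^m$, the $r$-th Gateaux derivatives $\Phi^{(r)}$ (exist and) are monogenic functions in $\Omega_\zeta$ for all $r\in\mathbb{N}$.
   Context: Algebra. Fix $m,n\in\mathbb{N}$, $m\le n$. $\mathbb{A}_n^m$ is an $n$-dimensional commutative associative algebra with unit over $\mathbb{C}$, with a basis $\{I_k\}_{k=1}^n$ satisfying: (1) for $r,s\in\{1,\ldots,m\}$: $I_rI_s=0$ if $r\ne s$ and $I_rI_r=I_r$; (2) for $r,s\in\{m+1,\ldots,n\}$: $I_rI_s=\sum_{k=\max\{r,s\}+1}^n\Upsilon_{r,k}^{s}I_k$ with structure constants $\Upsilon_{r,k}^s\in\mathbb{C}$; (3) for each $s\in\{m+1,\ldots,n\}$ there is a unique $u_s\in\{1,\ldots,m\}$ such that for all $r\in\{1,\ldots,m\}$: $I_rI_s=I_s$ if $r=u_s$ and $I_rI_s=0$ if $r\neq u_s$. The unit is $1=\sum_{u=1}^m I_u$. (By a theorem of E. Cartan every finite-dimensional commutative associative unital complex algebra has such a basis.) Functionals. For $u=1,\ldots,m$, $f_u:\mathbb{A}_n^m\to\mathbb{C}$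 is the $\mathbb{C}$-linear functional with $f_u(I_u)=1$ and $f_u(I_k)=0$ for $k\ne u$ (it is multiplicative). Variable. $e_1=1=\sum_{r=1}^mI_r$, $e_2=\sum_{r=1}^na_rI_r$, $e_3=\sum_{r=1}^nb_rI_r$ ($a_r,b_r\in\mathbb{C}$) are linearly independent over $\mathbb{R}$; $E_3=\{\zeta=xe_1+ye_2+ze_3:x,y,z\in\mathbb{R}\}$; $f_u(\zeta)=x+ya_u+zb_u$; $f_u(E_3)=\{f_u(\zeta):\zeta\in E_3\}$. Monogenic functions. A continuous function $\Phi:\Omega_\zeta\to\mathbb{A}_n^m$ is monogenic in $\Omega_\zeta$ if for every $\zeta\in\Omega_\zeta$ there is an element $\Phi'(\zeta)\in\mathbb{A}_n^m$ (the Gateaux derivative) such that $\lim_{\varepsilon\to0+0}(\Phi(\zeta+\varepsilon h)-\Phi(\zeta))\varepsilon^{-1}=h\Phi'(\zeta)$ for all $h\in E_3$. Higher Gateaux derivatives are defined inductively: $\Phi^{(1)}=\Phi'$, $\Phi^{(r+1)}=(\Phi^{(r)})'$. *)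

(* Defs.v *)
(* The field of complex numbers is R[i] for R : realType. *)
From HB Require Import structures.
From mathcomp Require Import all_boot all_order all_algebra all_field.
From mathcomp Require Import all_classical all_reals all_analysis.
From mathcomp Require Export complex.
Export numFieldNormedType.Exports.

Set Implicit Arguments.
Unset Strict Implicit.
Unset Printing Implicit Defensive.

Import Order.TTheory GRing.Theory Num.Theory.

Local Open Scope classical_set_scope.
Local Open Scope complex_scope.
Local Open Scope ring_scope.

(* The generic topology of a numFieldType is not found by inference on the
   concrete type R[i]; this makes it available there (balls for the modulus). *)
HB.instance Definition _ (R : realType) := NormedModule.copy R[i] R[i]^o.

Section Algebra.
Variables (R : realType) (n : nat) (A : falgType R[i]).
Implicit Types (I : n.-tuple A) (W : set A) (Phi Psi : A -> A).

(* Indices start at 0: k < m are the idempotents, m <= k < n the nilpotents. *)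
Record cartan_basis (m : nat) I : Prop := CartanBasis {
  cartan_mulC : commutative (fun x y : A => x * y) ;
  cartan_basisP : basis_of fullv I ;
  cartan_idem : forall r s : 'I_n, (r < m)%N -> (s < m)%N ->
    tnth I r * tnth I s = if r == s then tnth I r else 0 ;
  cartan_nilp : exists Upsilon : 'I_n -> 'I_n -> 'I_n -> R[i],
    forall r s : 'I_n, (m <= r)%N -> (m <= s)%N ->
      tnth I r * tnth I s =
        \sum_(k < n | (maxn r s < k)%N) Upsilon r k s *: tnth I k ;
  cartan_mixed : forall s : 'I_n, (m <= s)%N ->
    exists! u : 'I_n, (u < m)%N /\
      forall r : 'I_n, (r < m)%N ->
        tnth I r * tnth I s = if r == u then tnth I s else 0 ;
  cartan_unit : 1 = \sum_(u < n | (u < m)%N) tnth I u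
}.

(* The topology of the finite-dimensional space A: that of C^n, transported by
   the coordinates in the basis I. *)
Definition coordinates I (a : A) : 'rV[R[i]]_n := \row_(k < n) coord I k a.

Definition algtop I : topologicalType := initial_topology (coordinates I).

(* f_u: when I is a basis, coord I is its dual basis, so this is the linear
   functional with f_u(I_u) = 1 and f_u(I_k) = 0 for k != u. *)
Definition functional I (u : 'I_n) : A -> R[i] := coord I u.

(* (x, y, z) |-> x e_1 + y e_2 + z e_3 with e_1 = 1 *)
Definition zeta (e2 e3 : A) (p : 'rV[R]_3) : A :=
  (p 0 0)%:C *: 1 + (p 0 1)%:C *: e2 + (p 0 2)%:C *: e3.

Definition E3 (e2 e3 : A) : set A := range (zeta e2 e3).

Definition real_independent (e2 e3 : A) : Prop :=
  forall p : 'rV[R]_3, zeta e2 e3 p = 0 -> p = 0.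

(* Functions W -> A are represented by total functions A -> A of which only the
   values on W matter; W is always open in E3, so zeta + eps h lies in W for
   small eps. *)
Definition is_gateaux I (e2 e3 : A) Phi (z D : A) : Prop :=
  forall h : A, E3 e2 e3 h ->
    (fun eps : R =>
       (eps^-1)%:C *: (Phi (z + eps%:C *: h) - Phi z) : algtop I) @ 0^'+
    --> (h * D : algtop I).

Definition monogenic I (e2 e3 : A) W Phi : Prop :=
  {within (W : set (algtop I)), continuous (Phi : algtop I -> algtop I)} /\
  forall z, W z -> exists D : A, is_gateaux I e2 e3 Phi z D.

(* Psi is the r-th Gateaux derivative of Phi on W. The direction h = 1 shows
   that Psi is determined on W by Phi. *)
Fixpoint is_gateaux_iter I (e2 e3 : A) W (r : nat) Phi Psi : Prop :=
  match r with
  | 0 => forall z, W z -> Psi z = Phi z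
  | r'.+1 => exists2 Theta : A -> A,
      is_gateaux_iter I e2 e3 W r' Phi Theta &
      forall z, W z -> is_gateaux I e2 e3 Theta z (Psi z)
  end.

End Algebra.

Definition domain (T : topologicalType) (Omega : set T) : Prop :=
  [/\ open Omega, connected Omega & Omega !=set0].

(* Main.v *)
(* On a local factor of the algebra, a coordinate of lowest order of a monogenic
   function is constant along the kernel of the corresponding functional f_u, so it
   is G(f_u(zeta)) for a continuous function G of one complex variable whose
   one-sided directional derivatives at t are h |-> h G'(t).

   Such a G is holomorphic, by an argument in the spirit of the Looman-Menchoff
   theorem. Let P be the set of points near which G is not Lipschitz. Off P the
   function is complex differentiable with locally bounded derivative, hence has
   the mean value property (differentiate the circle means in the radius and use
   the Cauchy-Riemann equations and periodicity) and obeys the maximum principle.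
   If P is not empty, Baire's theorem gives a square meeting P and a constant N
   such that |G(t + x h) - G(t)| <= N |x| for t in P and h = 1, i; two such crosses
   meet, so G is Lipschitz on P. The maximum principle, applied to
   (G(w) - G(t)) / (w - t +- d) on the two halves of the square cut by the vertical
   line through t in P, with d -> 0, and then to (G(w) - G(s)) / (w - s) for s not
   in P, bounds all difference quotients of G near a point of P: contradiction.

   Subtracting from the monogenic function the principal extension
   sum_j G^(j)(f_u(zeta)) / j! (zeta - f_u(zeta))^j I_k of G, which is monogenic
   with derivative the principal extension of G', increases the order. Hence
   locally a monogenic function is a finite sum of such extensions, and its
   derivative is monogenic. *)
Require Import Defs.
From mathcomp Require Import all_boot all_order all_algebra all_field.
From mathcomp Require Import all_classical all_reals all_analysis.
From mathcomp Require Import ring lra.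

Set Implicit Arguments.
Unset Strict Implicit.
Unset Printing Implicit Defensive.

Import Order.TTheory GRing.Theory Num.Theory.

Local Open Scope classical_set_scope.
Local Open Scope complex_scope.
Local Open Scope ring_scope.

(** * Means over the unit interval *)

Section UnitIntervalMean.
Variable R : realType.
Implicit Types f g : R -> R.

(** The hypothesis gives only one-sided limits, one direction at a time, with no uniformity in the
    direction and no bound on the derivative. The circle-mean argument needs a locally bounded
    derivative, and this is what may fail on [P]; the work on [P] replaces any appeal to Cauchy's
    theorem. Surjectivity of [f_u] on [E3] supplies a real-linear section of [f_u], along which a
    coordinate becomes a function on an open part of the plane. The factorization through [f_u] is
    made on balls, because a level set of [f_u] in the domain need not be connected. Linear
    independence makes [zeta] a homeomorphism onto [E3], so that continuity can be tested on triples
    of reals. Two successive derivatives of the local representation suffice: the second one shows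
    that the first is monogenic, and higher orders follow by iteration. *)

Definition umean f : R := \int[lebesgue_measure]_(t in `[0, 1]) f t.

Let I01 : set (measurableTypeR R) := `[0%R, 1%R]%classic.

Lemma umean_integrable f : continuous f ->
  lebesgue_measure.-integrable I01 (EFin \o f).
Proof.
move=> cf; apply: continuous_compact_integrable; first exact: segment_compact.
exact: continuous_subspaceT.
Qed.

Let mI01 : measurable I01. Proof. exact: measurable_itv. Qed.

Lemma umean_cst (c : R) : umean (fun=> c) = c.
Proof.
rewrite /umean Rintegral_cst //= lebesgue_measure_itv /= lte_fin ltr01.
by rewrite sube0 /= mulr1.
Qed.

Lemma umeanD f g : continuous f -> continuous g ->
  umean (fun t => f t + g t) = umean f + umean g.
Proof. by move=> cf cg; apply: RintegralD => //; exact: umean_integrable. Qed.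

Lemma umeanZ (c : R) f : continuous f ->
  umean (fun t => c * f t) = c * umean f.
Proof. by move=> cf; apply: RintegralZl => //; exact: umean_integrable. Qed.

Lemma le_umean f g : continuous f -> continuous g -> (forall t, f t <= g t) ->
  umean f <= umean g.
Proof.
move=> cf cg fg; apply: le_Rintegral => //; exact: umean_integrable.
Qed.

Lemma is_derive_umean (F D : R -> R -> R) (u v a L : R) : u < a < v ->
  (forall x, u < x < v -> continuous (F x)) ->
  (forall x y, u < x < v -> is_derive x 1 (F^~ y) (D x y)) ->
  (forall x y, u < x < v -> `|D x y| <= L) ->
  is_derive a 1 (fun x => umean (F x)) (umean (D a)).
Proof.
move=> uav cF dF bD.
have uvE x : `]u, v[%classic x -> u < x < v by rewrite /= in_itv.
have pE x y : u < x < v -> partial1of2 F x y = D x y.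
  by move=> ux; rewrite partial1of2E; have := dF x y ux => dd; rewrite derive_val.
have h1 : `]u, v[%classic a by rewrite /= in_itv.
have h2 x : `]u, v[%classic x -> lebesgue_measure.-integrable I01 (EFin \o F x).
  by move=> /uvE ux; apply: umean_integrable; exact: cF.
have h3 x (y : measurableTypeR R) : `]u, v[%classic x -> I01 y ->
    derivable (F^~ y) x 1.
  by move=> /uvE ux _; have := dF x y ux.
have L0 : 0 <= L by apply: le_trans (bD a 0 uav); exact: normr_ge0.
have h4 : forall y : measurableTypeR R, 0 <= (fun=> L) y by [].
have h5 : lebesgue_measure.-integrable I01 (EFin \o (fun=> L)).
  by apply: umean_integrable; exact: cst_continuous.
have h6 x (y : measurableTypeR R) : `]u, v[%classic x -> I01 y ->
    `|partial1of2 F x y| <= (fun=> L) y.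
  by move=> /uvE ux _; rewrite pE //; exact: bD.
have dd := derivable_under_integral mI01 h1 h2 h3 h4 h5 h6.
apply: DeriveDef => //.
rewrite -derive1E (differentiation_under_integral mI01 h1 h2 h3 h4 h5 h6).
by apply: eq_Rintegral => y _; rewrite pE.
Qed.

Lemma umean_antiderivative (f F : R -> R) : continuous f ->
  (forall x : R, 0 <= x <= 1 -> is_derive x 1 F (f x)) ->
  umean f = F 1 - F 0.
Proof.
move=> cf dF.
have cF (x : R) : 0 <= x <= 1 -> {for x, continuous F}.
  move=> x0; apply: differentiable_continuous; apply/derivable1_diffP.
  by case: (dF x x0).
have oc (x : R) : x \in `]0, 1[ -> 0 <= x <= 1.
  by rewrite in_itv /= => /andP[/ltW -> /ltW ->].
rewrite /umean /Rintegral (@continuous_FTC2 _ f F) //.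
- exact: continuous_subspaceT.
- split => /=.
  + by move=> x /oc /dF [].
  + by apply: cvg_at_right_filter; apply: cF; rewrite lexx ler01.
  + by apply: cvg_at_left_filter; apply: cF; rewrite lexx ler01.
- by move=> x /oc /dF dd; rewrite derive1E derive_val.
Qed.

(** The window from -2 to 2 contains all the points [s + t] with [-1 < s < 1] and [0 <= t <= 1] that
    occur in [umean_derive_periodic]. *)
Lemma continuous_antiderivative f : continuous f ->
  exists F, forall x : R, 0 < x + 2 -> x < 2 -> is_derive x 1 F (f x).
Proof.
move=> cf; exists (fun x => \int[lebesgue_measure]_(t in `[-2, x]) f t)%R => x x0 x2.
have [||||dF eF] := @continuous_FTC1 _ f (BLeft (-2)) x 2 => //.
- apply: continuous_compact_integrable; first exact: segment_compact.
  exact: continuous_subspaceT.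
- by rewrite /= lte_fin; lra.
- exact: cf.
- by apply: DeriveDef => //; rewrite -derive1E.
Qed.

(** [v] is bounded but perhaps not continuous, so the fundamental theorem is applied to [V] instead.
    With [F' = V], the mean of [V (s + t)] over [t] is [F (s + 1) - F s], whose derivative at
    [s = 0] is [V 1 - V 0 = 0]; differentiation under the integral gives the mean of [v] for the
    same derivative. *)
Lemma umean_derive_periodic (V v : R -> R) (L : R) :
  (forall t : R, is_derive t 1 V (v t)) -> (forall t, `|v t| <= L) ->
  (forall t, V (t + 1) = V t) -> umean v = 0.
Proof.
move=> dV bv pV.
have cV : continuous V.
  by move=> x; apply: differentiable_continuous; apply/derivable1_diffP.
have dshift (F : R -> R) (s t d : R) : is_derive (s + t : R) 1 F d ->
    is_derive s 1 (fun s => F (s + t)) d.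
  move=> dF; have := @is_derive1_comp _ F (fun s => s + t) s d 1 dF.
  rewrite mulr1 => h; apply: h.
  rewrite -[X in is_derive _ _ _ X]addr0; exact: is_deriveD.
have dshift' (F : R -> R) (s t d : R) : is_derive (s + t : R) 1 F d ->
    is_derive t 1 (fun t => F (s + t)) d.
  by rewrite addrC => /dshift; under eq_fun do rewrite addrC.
have [F dF] := continuous_antiderivative cV.
pose K s := umean (fun t => V (s + t)).
have cVs s : continuous (fun t => V (s + t)).
  move=> t; apply: differentiable_continuous; apply/derivable1_diffP.
  by have := dshift' V s t _ (dV _).
have KE (s : R) : -1 < s < 1 -> K s = F (s + 1) - F s.
  move=> s1; rewrite -[in F s](addr0 s).
  apply: (@umean_antiderivative _ (fun t => F (s + t))) => // t t01.
  by apply: dshift'; apply: dF; lra.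
have dK : is_derive (0 : R) 1 K (umean v).
  have := @is_derive_umean (fun s t => V (s + t)) (fun s t => v (s + t)) (-1) 1 0 L.
  have -> : (fun t => v (0 + t)) = v by apply/funext => t; rewrite add0r.
  rewrite ltr01 ltrN10; apply => // s t _; exact: dshift.
have dK0 : is_derive (0 : R) 1 K 0.
  have d1 : is_derive (0 : R) 1 (fun s => F (s + 1) - F s) 0.
    have e : V (0 + 1) - V 0 = 0 by rewrite pV subrr.
    rewrite -[X in is_derive _ _ _ X]e.
    apply: is_deriveB; last by apply: dF; lra.
    by apply: dshift; apply: dF; lra.
  apply: near_eq_is_derive d1.
  near=> s; symmetry; apply: KE; apply/andP; split; near: s.
    by apply: lt_nbhsr; lra.
  by apply: lt_nbhsl; lra.
by rewrite -(@derive_val _ _ _ _ _ _ _ dK) derive_val.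
Unshelve. all: end_near. Qed.
End UnitIntervalMean.

(** * Complex derivatives *)

Section ComplexDerivative.
Variable R : realType.
Local Notation C := R[i].
Local Notation Re := (@complex.Re R).
Local Notation Im := (@complex.Im R).
Implicit Types (x y e d : R) (z w h : C) (F G : C -> C).

(** A modulus with values in [R], where the order is total; the norm of [R[i]] takes its values in
    [R[i]]. *)
Definition cnorm z : R := Normc.normc z.

Lemma cnormD z w : cnorm (z + w) <= cnorm z + cnorm w.
Proof. exact: le_normcD. Qed.

Lemma cnormM z w : cnorm (z * w) = cnorm z * cnorm w.
Proof. exact: Normc.normcM. Qed.

Lemma cnormN z : cnorm (- z) = cnorm z.
Proof. exact: normcN. Qed.

Lemma cnormV z : cnorm z^-1 = (cnorm z)^-1.
Proof. exact: Normc.normcV. Qed.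

Lemma cnorm0 : cnorm 0 = 0. Proof. exact: Normc.normc0. Qed.

Lemma cnorm1 : cnorm 1 = 1. Proof. exact: Normc.normc1. Qed.

Lemma cnorm_eq0 z : (cnorm z == 0) = (z == 0).
Proof.
by apply/eqP/eqP => [/Normc.eq0_normc //|->]; rewrite cnorm0.
Qed.

Lemma cnorm_ge0 z : 0 <= cnorm z.
Proof. by case: z => a b; exact: sqrtr_ge0. Qed.

Lemma cnorm_gt0 z : (0 < cnorm z) = (z != 0).
Proof. by rewrite lt_def cnorm_ge0 andbT cnorm_eq0. Qed.

Lemma cnormB z w : cnorm (z - w) <= cnorm z + cnorm w.
Proof. by rewrite (le_trans (cnormD _ _)) // cnormN. Qed.

Lemma cnormBC z w : cnorm (z - w) = cnorm (w - z).
Proof. by rewrite -cnormN opprB. Qed.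

Lemma cnorm_trans z w u : cnorm (z - u) <= cnorm (z - w) + cnorm (w - u).
Proof. by rewrite -[z - u](_ : (z - w) + (w - u) = _) ?cnormD //; ring. Qed.

Lemma cnorm_real x : cnorm x%:C = `|x|.
Proof. by rewrite /cnorm /= expr0n /= addr0 sqrtr_sqr. Qed.

Lemma cnorm_normr z : `|z| = (cnorm z)%:C.
Proof. by rewrite normc_def; case: z. Qed.

Lemma cnorm_sqr z : cnorm z ^+ 2 = Re z ^+ 2 + Im z ^+ 2.
Proof. by case: z => a b; rewrite /cnorm /= sqr_sqrtr ?addr_ge0 ?sqr_ge0. Qed.

Lemma normr_Re z : `|Re z| <= cnorm z.
Proof.
rewrite -(@ler_pXn2r _ 2) ?nnegrE ?cnorm_ge0 // cnorm_sqr real_normK ?num_real //.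
by rewrite lerDl sqr_ge0.
Qed.

Lemma normr_Im z : `|Im z| <= cnorm z.
Proof.
rewrite -(@ler_pXn2r _ 2) ?nnegrE ?cnorm_ge0 // cnorm_sqr real_normK ?num_real //.
by rewrite lerDr sqr_ge0.
Qed.

Lemma Re_le_cnorm z : Re z <= cnorm z.
Proof. exact: le_trans (ler_norm _) (normr_Re _). Qed.

Lemma cnorm_ReIm z : cnorm z <= `|Re z| + `|Im z|.
Proof.
rewrite -(@ler_pXn2r _ 2) ?nnegrE ?cnorm_ge0 ?addr_ge0 // cnorm_sqr.
rewrite -[Re z ^+ 2]real_normK ?num_real // -[Im z ^+ 2]real_normK ?num_real //.
rewrite sqrrD lerD2r lerDl mulrn_wge0 // mulr_ge0 //.
Qed.

Lemma cnorm_ge_sub z w : cnorm z - cnorm w <= cnorm (z + w).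
Proof.
by rewrite lerBlDr -{1}[z](addrK w) (le_trans (cnormB _ _)) // cnormN.
Qed.

Definition ccont F z := forall e, 0 < e ->
  exists2 d, 0 < d & forall h, cnorm h < d -> cnorm (F (z + h) - F z) <= e.

Definition cderiv F z (D : C) := forall e, 0 < e ->
  exists2 d, 0 < d &
    forall h, cnorm h < d -> cnorm (F (z + h) - F z - D * h) <= e * cnorm h.

Lemma cderiv_cont F z D : cderiv F z D -> ccont F z.
Proof.
move=> dF e e0; have [d d0 Hd] := dF 1 ltr01.
have K0 : 0 < 1 + cnorm D by rewrite ltr_pwDl // cnorm_ge0.
exists (Num.min d (e / (1 + cnorm D))) => [|h].
  by rewrite lt_min d0 divr_gt0.
rewrite lt_min => /andP[/Hd hd he].
rewrite -[F (z + h) - F z](subrK (D * h)) (le_trans (cnormD _ _)) //.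
rewrite (le_trans (lerD hd (lexx _))) // cnormM -mulrDl mulrC.
by rewrite -ler_pdivlMr // ltW.
Qed.

Lemma cderiv_ext F G z D r : 0 < r ->
  (forall w, cnorm (w - z) < r -> F w = G w) -> cderiv F z D -> cderiv G z D.
Proof.
move=> r0 FG dF e e0; have [d d0 Hd] := dF e e0.
exists (Num.min d r) => [|h]; first by rewrite lt_min d0.
rewrite lt_min => /andP[hd hr].
rewrite -!FG ?Hd //; last by rewrite addrC addKr.
by rewrite subrr cnorm0.
Qed.

Lemma cderivM F G z (D D' : C) : cderiv F z D -> cderiv G z D' ->
  cderiv (fun w => F w * G w) z (D * G z + F z * D').
Proof.
move=> dF dG e e0.
pose K := 2 * (1 + cnorm (G z) + cnorm (F z) + cnorm D * cnorm D').
have K0 : 0 < K.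
  have := cnorm_ge0 (G z); have := cnorm_ge0 (F z).
  have := mulr_ge0 (cnorm_ge0 D) (cnorm_ge0 D'); rewrite /K; lra.
have e1 : 0 < Num.min 1 (e / K) by rewrite lt_min ltr01 divr_gt0.
have [d1 d10 H1] := dF _ e1; have [d2 d20 H2] := dG _ e1.
have [d3 d30 H3] := cderiv_cont dG ltr01.
(* [d4] absorbs the quadratic term [D * D' * (h * h)], and [d5] keeps [cnorm (D * h)] at most 1. *)
pose d4 := Num.min 1 (e / K).
pose d5 := (1 + cnorm D)^-1.
have D1 : 0 < 1 + cnorm D by rewrite ltr_pwDl // cnorm_ge0.
exists (Num.min (Num.min d1 d2) (Num.min (Num.min d3 d4) d5)) => [|h].
  by rewrite !lt_min d10 d20 d30 ltr01 !divr_gt0 // invr_gt0 D1.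
rewrite !lt_min => /andP[/andP[/H1 h1 /H2 h2] /andP[/andP[/H3 h3 /andP[_ h4]] h5]].
set r := F (z + h) - F z - D * h in h1.
set s := G (z + h) - G z - D' * h in h2.
have -> : F (z + h) * G (z + h) - F z * G z - (D * G z + F z * D') * h =
   r * G (z + h) + (F z + D * h) * s + D * D' * (h * h).
  by rewrite /r /s; ring.
have n0 := cnorm_ge0 h.
have eK : Num.min 1 (e / K) <= e / K by rewrite ge_min lexx orbT.
have r1 : cnorm r <= e / K * cnorm h.
  by apply: le_trans h1 _; rewrite ler_wpM2r.
have s1 : cnorm s <= e / K * cnorm h.
  by apply: le_trans h2 _; rewrite ler_wpM2r.
have g1 : cnorm (G (z + h)) <= cnorm (G z) + 1.
  by have := cnormD (G (z + h) - G z) (G z); rewrite subrK; lra.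
have f1 : cnorm (F z + D * h) <= cnorm (F z) + 1.
  apply: le_trans (cnormD _ _) _; rewrite lerD2l cnormM.
  have : cnorm D * cnorm h <= (1 + cnorm D) * (1 + cnorm D)^-1.
    by apply: ler_pM => //; [exact: cnorm_ge0|rewrite lerDr|exact: ltW].
  by rewrite divff ?gt_eqF.
have q : e / K * K = e by rewrite divfK ?gt_eqF.
have ek0 : 0 < e / K by rewrite divr_gt0.
apply: le_trans (cnormD _ _) _; rewrite !cnormM.
apply: le_trans (lerD (cnormD _ _) (lexx _)) _; rewrite !cnormM.
have t1 : cnorm r * cnorm (G (z + h)) <= e / K * cnorm h * (cnorm (G z) + 1).
  by apply: ler_pM => //; exact: cnorm_ge0.
have t2 : cnorm (F z + D * h) * cnorm s <= (cnorm (F z) + 1) * (e / K * cnorm h).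
  by apply: ler_pM => //; exact: cnorm_ge0.
have t3 : cnorm D * cnorm D' * (cnorm h * cnorm h) <=
   cnorm D * cnorm D' * (e / K * cnorm h).
  rewrite ler_wpM2l ?mulr_ge0 ?cnorm_ge0 // ler_wpM2r //.
  by apply: ltW.
have -> : e * cnorm h = e / K * cnorm h * K by rewrite -[in LHS]q; ring.
have dd := mulr_ge0 (cnorm_ge0 D) (cnorm_ge0 D').
apply: le_trans (lerD (lerD t1 t2) t3) _.
have -> : e / K * cnorm h * (cnorm (G z) + 1) + (cnorm (F z) + 1) * (e / K * cnorm h) +
   cnorm D * cnorm D' * (e / K * cnorm h) = e / K * cnorm h *
   (cnorm (G z) + 1 + (cnorm (F z) + 1) + cnorm D * cnorm D') by ring.
rewrite ler_wpM2l ?(mulr_ge0 (ltW ek0) n0) //.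
have := cnorm_ge0 (G z); have := cnorm_ge0 (F z); rewrite /K; lra.
Qed.

Lemma cderiv_cst c z : cderiv (fun=> c) z 0.
Proof.
move=> e e0; exists 1 => // h _.
by rewrite subrr mul0r subrr cnorm0 mulr_ge0 ?cnorm_ge0 ?ltW.
Qed.

Lemma cderivZ c F z D : cderiv F z D -> cderiv (fun w => c * F w) z (c * D).
Proof.
by move=> dF; have := cderivM (cderiv_cst c z) dF; rewrite mul0r add0r.
Qed.

Lemma cderivB_cst c F z D : cderiv F z D -> cderiv (fun w => F w - c) z D.
Proof.
move=> dF e /dF[d d0 H]; exists d => // h /H.
by have -> : F (z + h) - c - (F z - c) = F (z + h) - F z by ring.
Qed.

Lemma cderiv_inv a z : z != a ->
  cderiv (fun w => (w - a)^-1) z (- (z - a)^-1 ^+ 2).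
Proof.
move=> za e e0; set w := z - a.
have w0 : w != 0 by rewrite subr_eq0.
have n0 : 0 < cnorm w by rewrite cnorm_gt0.
exists (Num.min (cnorm w / 2) (e * cnorm w ^+ 3 / 2)) => [|h].
  by rewrite lt_min !divr_gt0 ?mulr_gt0 ?exprn_gt0.
rewrite lt_min => /andP[h1 h2].
have wh : cnorm w / 2 <= cnorm (w + h).
  by have := cnorm_ge_sub w h; lra.
have wh0 : w + h != 0 by rewrite -cnorm_gt0; apply: lt_le_trans wh; rewrite divr_gt0.
have -> : z + h - a = w + h by rewrite /w; ring.
have -> : (w + h)^-1 - w^-1 - (- w^-1 ^+ 2) * h = h * h / (w ^+ 2 * (w + h)).
  by field; rewrite wh0.
rewrite !cnormM cnormV !cnormM mulrAC ler_wpM2r ?cnorm_ge0 //.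
rewrite ler_pdivrMr ?mulr_gt0 ?cnorm_gt0 //.
apply: le_trans (ltW h2) _.
have -> : e * cnorm w ^+ 3 / 2 = e * (cnorm w * cnorm w * (cnorm w / 2)) by ring.
by rewrite ler_pM2l // ler_wpM2l // ltW // mulr_gt0.
Qed.

Lemma cderiv_quotient F c a z D : z != a -> cderiv F z D ->
  cderiv (fun w => (F w - c) / (w - a)) z
    (D / (z - a) - (F z - c) / (z - a) ^+ 2).
Proof.
move=> za dF; have := cderivM (cderivB_cst c dF) (cderiv_inv za).
by rewrite mulrN exprVn.
Qed.

End ComplexDerivative.

(** * Derivatives along curves and the unit circle *)

Section CircleMean.
Variable R : realType.
Local Notation C := R[i].
Local Notation Re := (@complex.Re R).
Local Notation Im := (@complex.Im R).
Implicit Types (x y e d : R) (z w h : C) (F G : C -> C) (gam : R -> C).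

Lemma is_deriveP (f : R -> R) (t l : R) : is_derive t 1 f l <->
  forall e, 0 < e -> exists2 d, 0 < d &
    forall h : R, `|h| < d -> `|f (t + h) - f t - l * h| <= e * `|h|.
Proof.
have key (h : R) : h != 0 -> `|l - h^-1 *: (f (h *: (1 : R) + t) - f t)| * `|h| =
    `|f (t + h) - f t - l * h|.
  move=> h0; rewrite -normrM -normrN scaler1 [h + t]addrC; congr `| _ |.
  by rewrite /GRing.scale /=; field.
split=> [df e e0|H].
- have := @ex_derive _ _ _ _ _ _ _ df => /cvg_ex[/= l' Hl'].
  have El : l' = l.
    rewrite -(@derive_val _ _ _ _ _ _ _ df) /derive; apply/esym/cvg_lim => //.
  subst l'.
  move/cvgrPdist_le : Hl' => /(_ _ e0); rewrite near_withinE => -[d /= d0 Hd].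
  exists d => // h hd; have [->|h0] := eqVneq h 0.
    by rewrite addr0 subrr mulr0 subrr !normr0 mulr0.
  rewrite -key // ler_wpM2r //.
  by apply: Hd => //=; rewrite /ball_ /= sub0r normrN.
- have cv : h^-1 *: (f (h *: (1 : R) + t) - f t) @[h --> 0^'] --> l.
    apply/cvgrPdist_le => e e0; have [d d0 Hd] := H e e0.
    rewrite near_withinE; exists d => //= h; rewrite /ball_ /= sub0r normrN => hd h0.
    by rewrite -(@ler_pM2r _ `|h|) ?normr_gt0 // key // Hd.
  by apply: DeriveDef; [apply/cvg_ex; exists l|exact/cvg_lim].
Qed.

Definition curve_deriv gam (t : R) (v : C) := forall e, 0 < e ->
  exists2 d, 0 < d & forall h : R, `|h| < d ->
    cnorm (gam (t + h) - gam t - h%:C * v) <= e * `|h|.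

Lemma is_derive_Re_comp F gam (t : R) (D v : C) : cderiv F (gam t) D ->
  curve_deriv gam t v -> is_derive t 1 (fun t => Re (F (gam t))) (Re (D * v)).
Proof.
move=> dF dg; apply/is_deriveP => e e0.
have D1 : 0 < 1 + cnorm D by rewrite ltr_pwDl // cnorm_ge0.
have v1 : 0 < 1 + cnorm v by rewrite ltr_pwDl // cnorm_ge0.
have e1 : 0 < e / 2 / (1 + cnorm v) by rewrite !divr_gt0.
have [d1 d10 H1] := dF _ e1.
pose e2 := Num.min 1 (e / 2 / (1 + cnorm D)).
have e20 : 0 < e2 by rewrite lt_min ltr01 !divr_gt0.
have [d2 d20 H2] := dg _ e20.
exists (Num.min d2 (d1 / (1 + cnorm v))) => [|h].
  by rewrite lt_min d20 divr_gt0.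
rewrite lt_min => /andP[/H2 h2 h1].
pose k := gam (t + h) - gam t.
have kh : cnorm k <= (1 + cnorm v) * `|h|.
  have -> : k = (k - h%:C * v) + h%:C * v by ring.
  apply: le_trans (cnormD _ _) _; rewrite cnormM cnorm_real mulrDl [_ * cnorm v]mulrC.
  rewrite lerD2r (le_trans h2) // ler_wpM2r //.
  by rewrite ge_min lexx.
have kd : cnorm k < d1.
  by apply: le_lt_trans kh _; rewrite mulrC -ltr_pdivlMr.
have h1' := H1 _ kd.
have -> : gam (t + h) = gam t + k by rewrite /k; ring.
have E : Re (F (gam t + k)) - Re (F (gam t)) - Re (D * v) * h =
   Re (F (gam t + k) - F (gam t) - D * k + D * (k - h%:C * v)).
  have -> : F (gam t + k) - F (gam t) - D * k + D * (k - h%:C * v) =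
    F (gam t + k) - F (gam t) - (D * v) * h%:C by ring.
  by case: (D * v) (F _) (F _) => a b [a1 b1] [a2 b2] /=; ring.
rewrite E (le_trans (normr_Re _)) // (le_trans (cnormD _ _)) //.
have -> : e * `|h| = e / 2 / (1 + cnorm v) * ((1 + cnorm v) * `|h|) +
   (1 + cnorm D) * (e / 2 / (1 + cnorm D) * `|h|).
  by field; rewrite !gt_eqF.
apply: lerD.
  by apply: le_trans h1' _; rewrite ler_wpM2l // !divr_ge0 // ltW.
rewrite cnormM; apply: ler_pM => //; try exact: cnorm_ge0.
  by rewrite lerDr.
by apply: le_trans h2 _; rewrite ler_wpM2r // ge_min lexx orbT.
Qed.

Lemma is_derive_Im_comp F gam (t : R) (D v : C) : cderiv F (gam t) D ->
  curve_deriv gam t v -> is_derive t 1 (fun t => Im (F (gam t))) (Im (D * v)).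
Proof.
have E z : Re (- 'i%C * z) = Im z by case: z => a b /=; ring.
move=> /(cderivZ (- 'i%C)) dF /(is_derive_Re_comp dF).
by rewrite -mulrA E; under eq_fun do rewrite E.
Qed.

(** Parametrized with period 1, so that a mean over the circle is a [umean]. *)
Definition cis (t : R) : C := cos (2 * pi * t) +i* sin (2 * pi * t).

Lemma cnorm_cis t : cnorm (cis t) = 1.
Proof. by rewrite /cnorm /= cos2Dsin2 sqrtr1. Qed.

Lemma cisD1 t : cis (t + 1) = cis t.
Proof.
rewrite /cis mulrDr mulr1; have -> : 2 * pi = pi *+ 2 :> R by rewrite mulr2n; ring.
by rewrite cosD2pi sinD2pi.
Qed.

Lemma curve_derivD_ReIm (f g : R -> R) (t a b : R) : is_derive t 1 f a ->
  is_derive t 1 g b -> curve_deriv (fun t => f t +i* g t) t (a +i* b).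
Proof.
move=> /is_deriveP df /is_deriveP dg e e0.
have e2 : 0 < e / 2 by rewrite divr_gt0.
have [d1 d10 H1] := df _ e2; have [d2 d20 H2] := dg _ e2.
exists (Num.min d1 d2) => [|h]; first by rewrite lt_min d10.
rewrite lt_min => /andP[/H1 h1 /H2 h2].
apply: le_trans (cnorm_ReIm _) _ => /=.
have -> : f (t + h) - f t - (h * a - 0 * b) = f (t + h) - f t - a * h by ring.
have -> : g (t + h) - g t - (h * b + 0 * a) = g (t + h) - g t - b * h by ring.
lra.
Qed.

Lemma curve_deriv_cis (t : R) : curve_deriv cis t ((2 * pi)%:C * 'i%C * cis t).
Proof.
have dl (s : R) : is_derive s 1 (fun t : R => 2 * pi * t) (2 * pi).
  have h := @is_deriveZ _ _ _ (@id R) (2 * pi) s 1 1 (is_derive_id _ _).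
  by rewrite [X in is_derive _ _ _ X]mulr1 in h.
have dc := @is_derive1_comp _ (@cos R) (fun t => 2 * pi * t) t _ _
  (is_derive_cos _) (dl t).
have ds := @is_derive1_comp _ (@sin R) (fun t => 2 * pi * t) t _ _
  (is_derive_sin _) (dl t).
have := curve_derivD_ReIm dc ds.
suff -> : (2 * pi)%:C * 'i%C * cis t = - sin (2 * pi * t) * (2 * pi) +i*
   (cos (2 * pi * t) * (2 * pi)) by [].
by apply/eqP; rewrite eq_complex /=; apply/andP; split; apply/eqP; ring.
Qed.

Lemma curve_deriv_affine gam (c k : C) (t : R) (v : C) : curve_deriv gam t v ->
  curve_deriv (fun t => c + k * gam t) t (k * v).
Proof.
move=> dg e e0; have k1 : 0 < 1 + cnorm k by rewrite ltr_pwDl // cnorm_ge0.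
have [d d0 H] := dg _ (divr_gt0 e0 k1); exists d => // h /H hd.
have -> : c + k * gam (t + h) - (c + k * gam t) - h%:C * (k * v) =
   k * (gam (t + h) - gam t - h%:C * v) by ring.
have -> : e * `|h| = (1 + cnorm k) * (e / (1 + cnorm k) * `|h|).
  by field; rewrite gt_eqF.
by rewrite cnormM ler_pM ?cnorm_ge0 // lerDr.
Qed.

Lemma curve_deriv_ray (c k : C) (t : R) : curve_deriv (fun t => c + t%:C * k) t k.
Proof.
move=> e e0; exists 1 => // h _.
have -> : c + (t + h)%:C * k - (c + t%:C * k) - h%:C * k = 0.
  by rewrite rmorphD; ring.
by rewrite cnorm0 mulr_ge0 // ltW.
Qed.

Definition ccurve gam := forall t e, 0 < e ->
  exists2 d, 0 < d & forall h : R, `|h| < d -> cnorm (gam (t + h) - gam t) <= e.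

Lemma ccurve_cis : ccurve cis.
Proof.
move=> t e e0; set v := (2 * pi)%:C * 'i%C * cis t.
have v1 : 0 < 1 + cnorm v by rewrite ltr_pwDl // cnorm_ge0.
have [d d0 H] := curve_deriv_cis t ltr01.
exists (Num.min d (e / (1 + cnorm v))) => [|h]; first by rewrite lt_min d0 divr_gt0.
rewrite lt_min => /andP[/H h1 h2].
have := cnormD (cis (t + h) - cis t - h%:C * v) (h%:C * v); rewrite subrK => h3.
apply: le_trans h3 _; rewrite cnormM cnorm_real.
move: h2; rewrite ltr_pdivlMr // => h2; rewrite mul1r in h1.
by apply: le_trans (lerD h1 (lexx _)) _; lra.
Qed.

Lemma ccurve_comp F gam c k : ccurve gam ->
  (forall t, ccont F (c + k * gam t)) -> ccurve (fun t => F (c + k * gam t)).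
Proof.
move=> cg cF t e e0; have [d d0 H] := cF t e e0.
have k1 : 0 < 1 + cnorm k by rewrite ltr_pwDl // cnorm_ge0.
have k0 : 0 < d / 2 / (1 + cnorm k) by rewrite !divr_gt0.
have [d' d0' H'] := cg t _ k0.
exists d' => // h /H' hd.
have -> : c + k * gam (t + h) = c + k * gam t + k * (gam (t + h) - gam t) by ring.
apply: H; rewrite cnormM.
apply: (@le_lt_trans _ _ ((1 + cnorm k) * (d / 2 / (1 + cnorm k)))).
  by rewrite ler_pM ?cnorm_ge0 // lerDr.
have -> : (1 + cnorm k) * (d / 2 / (1 + cnorm k)) = d / 2 by field; rewrite gt_eqF.
lra.
Qed.

Lemma ccurve_Re gam : ccurve gam -> continuous (Re \o gam).
Proof.
move=> cg t; apply/cvgrPdist_le => e /(cg t)[d d0 H]; exists d => // s /=.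
rewrite /ball_ /= distrC => /H; rewrite [t + _]addrC subrK => h.
have -> : Re (gam t) - Re (gam s) = - Re (gam s - gam t) by case: (gam s) (gam t) => [a b] [a' b'] /=; ring.
by rewrite normrN (le_trans (normr_Re _)).
Qed.

Lemma ccurve_Im gam : ccurve gam -> continuous (Im \o gam).
Proof.
move=> cg t; apply/cvgrPdist_le => e /(cg t)[d d0 H]; exists d => // s /=.
rewrite /ball_ /= distrC => /H; rewrite [t + _]addrC subrK => h.
have -> : Im (gam t) - Im (gam s) = - Im (gam s - gam t) by case: (gam s) (gam t) => [a b] [a' b'] /=; ring.
by rewrite normrN (le_trans (normr_Im _)).
Qed.

End CircleMean.

(** * Mean value property and maximum principle *)

Section MeanValue.
Variable R : realType.
Local Notation C := R[i].
Local Notation Re := (@complex.Re R).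
Local Notation Im := (@complex.Im R).
Implicit Types (x y e d r s : R) (z w h c : C) (F G D : C -> C) (gam : R -> C).

Definition cmean gam : C := umean (Re \o gam) +i* umean (Im \o gam).

Lemma cmeanD gam gam' : ccurve gam -> ccurve gam' ->
  cmean (fun t => gam t + gam' t) = cmean gam + cmean gam'.
Proof.
move=> cg cg'; rewrite /cmean.
have -> : Re \o (fun t => gam t + gam' t) = (fun t => (Re \o gam) t + (Re \o gam') t).
  by apply/funext => t /=; case: (gam t) (gam' t) => [a b] [a' b'].
have -> : Im \o (fun t => gam t + gam' t) = (fun t => (Im \o gam) t + (Im \o gam') t).
  by apply/funext => t /=; case: (gam t) (gam' t) => [a b] [a' b'].
by rewrite !umeanD //; first [exact: ccurve_Re|exact: ccurve_Im].
Qed.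

Lemma cmeanZ k gam : ccurve gam -> cmean (fun t => k * gam t) = k * cmean gam.
Proof.
move=> cg; have cr := ccurve_Re cg; have ci := ccurve_Im cg.
have cZ (a : R) (f : R -> R) : continuous f -> continuous (fun t => a * f t).
  by move=> cf t; apply: continuousM; [exact: cst_continuous|exact: cf].
case: k => a b; rewrite /cmean.
have -> : Re \o (fun t => (a +i* b) * gam t) =
    (fun t => a * (Re \o gam) t + (- b) * (Im \o gam) t).
  by apply/funext => t /=; case: (gam t) => [a' b'] /=; ring.
have -> : Im \o (fun t => (a +i* b) * gam t) =
    (fun t => a * (Im \o gam) t + b * (Re \o gam) t).
  by apply/funext => t /=; case: (gam t) => [a' b'] /=; ring.
rewrite !umeanD ?umeanZ //; try exact: cZ.
by apply/eqP; rewrite eq_complex /=; apply/andP; split; apply/eqP; ring.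
Qed.

Lemma Re_cmean_le gam (M : R) : ccurve gam -> (forall t, Re (gam t) <= M) ->
  Re (cmean gam) <= M.
Proof.
move=> cg gM; rewrite -(umean_cst M); apply: le_umean => //.
  exact: ccurve_Re.
exact: cst_continuous.
Qed.

Lemma normr_umean_le (f : R -> R) (M : R) : continuous f ->
  (forall t, `|f t| <= M) -> `|umean f| <= M.
Proof.
move=> cf fM; have cK (k : R) : continuous (fun _ : R => k) by exact: cst_continuous.
rewrite ler_norml; apply/andP; split.
  rewrite -(umean_cst (- M)); apply: le_umean => // t.
  by have := fM t; rewrite ler_norml => /andP[].
rewrite -(umean_cst M); apply: le_umean => // t.
by have := fM t; rewrite ler_norml => /andP[].
Qed.

(** The factor 2 comes from estimating real and imaginary parts separately. *)
Lemma cnorm_cmean_le gam (M : R) : ccurve gam -> (forall t, cnorm (gam t) <= M) ->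
  cnorm (cmean gam) <= 2 * M.
Proof.
move=> cg gM; apply: le_trans (cnorm_ReIm _) _.
have -> : 2 * M = M + M by ring.
apply: lerD.
  apply: (normr_umean_le (ccurve_Re cg)) => t.
  by apply: le_trans (gM t); exact: normr_Re.
apply: (normr_umean_le (ccurve_Im cg)) => t.
by apply: le_trans (gM t); exact: normr_Im.
Qed.

Definition circle_mean F c s : C := cmean (fun t => F (c + s%:C * cis t)).

(* The center c may be a singularity; it is then removable. *)
Definition punctured_hol F D c r := [/\ ccont F c,
  forall z, 0 < cnorm (z - c) < r -> cderiv F z (D z) &
  forall p, 0 < p -> exists L : R, forall z, p < cnorm (z - c) < r -> cnorm (D z) <= L].

Lemma cnorm_circle c s t : 0 < s -> cnorm (c + s%:C * cis t - c) = s.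
Proof.
move=> s0; rewrite addrC addKr cnormM cnorm_real cnorm_cis mulr1 gtr0_norm //.
Qed.

Lemma punctured_hol_circle F D c r s : punctured_hol F D c r -> 0 < s < r ->
  ccurve (fun t => F (c + s%:C * cis t)).
Proof.
case=> _ dF _ /andP[s0 sr]; apply: ccurve_comp; first exact: ccurve_cis.
move=> t; apply: cderiv_cont; apply: dF.
by rewrite cnorm_circle // s0.
Qed.

Lemma punctured_holZ k F D c r : punctured_hol F D c r ->
  punctured_hol (fun z => k * F z) (fun z => k * D z) c r.
Proof.
have k1 : 0 < 1 + cnorm k by rewrite ltr_pwDl // cnorm_ge0.
case=> cF dF bD; split.
- move=> e e0; have [d d0 H] := cF _ (divr_gt0 e0 k1); exists d => // h /H hd.
  rewrite -mulrBr cnormM.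
  have -> : e = (1 + cnorm k) * (e / (1 + cnorm k)) by field; rewrite gt_eqF.
  by rewrite ler_pM ?cnorm_ge0 // lerDr.
- by move=> z /dF; exact: cderivZ.
- move=> p /bD[L HL]; exists (cnorm k * L) => z /HL.
  by rewrite cnormM; apply: ler_wpM2l; exact: cnorm_ge0.
Qed.

Lemma derive0_eq (f : R -> R) (a b : R) : a < b ->
  (forall x : R, a <= x <= b -> is_derive x 1 f 0) -> f b = f a.
Proof.
move=> ab df.
have dK (x : R) : x \in `[a, b] -> is_derive x 1 f 0.
  by move=> xab; apply: df; move: xab; rewrite in_itv.
have d1 (x : R) : x \in `]a, b[ -> is_derive x 1 f ((fun _ : R => 0 : R) x).
  by move=> xab; apply: dK; apply: subset_itv_oo_cc xab.
have cf : {within `[a, b], continuous f}.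
  by apply: derivable_within_continuous => x xab; have := dK x xab => -[].
have [z _] := MVT ab d1 cf.
by rewrite mul0r => /eqP; rewrite subr_eq0 => /eqP.
Qed.

Let radial F c s := umean (fun t => Re (F (c + s%:C * cis t))).

Let radial_derive F D c r s : punctured_hol F D c r -> 0 < s < r ->
  is_derive s 1 (radial F c) 0.
Proof.
move=> hF /andP[s0 sr]; have [cF dF bD] := hF.
have [L HL] : exists L : R, forall z, s / 4 < cnorm (z - c) < r -> cnorm (D z) <= L.
  by apply: bD; rewrite divr_gt0.
have bnd x t : s / 2 < x < (s + r) / 2 -> cnorm (D (c + x%:C * cis t)) <= L.
  move=> /andP[x1 x2]; have x0 : 0 < x by lra.
  by apply: HL; rewrite cnorm_circle //; apply/andP; split; lra.
(* The angular derivative of [F] is [2 * pi * 'i * s * cis t * D]. Divided by [2 * pi * s], it has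
   as imaginary part the radial derivative of [Re F]. *)
have E : umean (fun t => Re (D (c + s%:C * cis t) * cis t)) = 0.
  have k0 : 2 * pi * s != 0 by rewrite !mulf_neq0 ?gt_eqF ?pi_gt0.
  pose k : C := ((2 * pi * s)^-1)%:C.
  apply: (@umean_derive_periodic _ (fun t => Im (k * F (c + s%:C * cis t))) _ L).
  - move=> t.
    have dFk : cderiv (fun z => k * F z) (c + s%:C * cis t) (k * D (c + s%:C * cis t)).
      by apply: cderivZ; apply: dF; rewrite cnorm_circle // s0.
    have := is_derive_Im_comp dFk (curve_deriv_affine c s%:C (curve_deriv_cis t)).
    set X := Im _; set Y := Re _; suff -> : X = Y by [].
    rewrite /X /Y /k; move: (D (c + s%:C * cis t)) => [a b]; move: (@pi R) (pi_gt0 R) (cis t) => P P0 [a1 b1] /=.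
    by field; rewrite !gt_eqF.
  - move=> t; apply: le_trans (normr_Re _) _; rewrite cnormM cnorm_cis mulr1.
    by apply: bnd; apply/andP; split; lra.
  - by move=> t; rewrite cisD1.
rewrite -E; apply: (@is_derive_umean _ (fun s t => Re (F (c + s%:C * cis t)))
  (fun s t => Re (D (c + s%:C * cis t) * cis t)) (s / 2) ((s + r) / 2) s L).
- by apply/andP; split; lra.
- move=> x /andP[x1 x2]; apply: (@ccurve_Re _ (fun t => F (c + x%:C * cis t))).
  by apply: punctured_hol_circle hF _; apply/andP; split; lra.
- move=> x t /andP[x1 x2]; apply: (is_derive_Re_comp _ (curve_deriv_ray c (cis t) x)).
  by apply: dF; rewrite cnorm_circle; [apply/andP; split; lra|lra].
- move=> x t x12; apply: le_trans (normr_Re _) _; rewrite cnormM cnorm_cis mulr1.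
  exact: bnd.
Qed.

(** The mean is constant in the radius, and continuity at [c] identifies the constant as the radius
    shrinks. The center enters only through this continuity, whence the removability of a
    singularity there. *)
Let radial_mean F D c r s : punctured_hol F D c r -> 0 < s < r ->
  radial F c s = Re (F c).
Proof.
move=> hF /andP[s0 sr]; have [cF dF bD] := hF.
have cst s' : 0 < s' < s -> radial F c s = radial F c s'.
  move=> /andP[s'0 s's].
  apply: derive0_eq s's _ => x /andP[x1 x2]; apply: radial_derive hF _.
  by apply/andP; split; lra.
apply/eqP; rewrite -subr_eq0 -normr_le0; apply/ler_addgt0Pr => e e0; rewrite add0r.
have [d d0 Hd] := cF e e0.
pose s' := Num.min (s / 2) (d / 2).
have s'0 : 0 < s' by rewrite lt_min !divr_gt0.
have s's : s' < s by rewrite gt_min; apply/orP; left; lra.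
have s'd : s' < d by rewrite gt_min; apply/orP; right; lra.
rewrite (cst s') ?s'0 // /radial.
have cg : ccurve (fun t => F (c + s'%:C * cis t)).
  by apply: punctured_hol_circle hF _; rewrite s'0; lra.
have cr := ccurve_Re cg.
have -> : umean (fun t => Re (F (c + s'%:C * cis t))) - Re (F c) =
   umean (fun t => Re (F (c + s'%:C * cis t)) + - Re (F c)).
  by rewrite umeanD ?umean_cst //; exact: cst_continuous.
apply: normr_umean_le.
  by move=> t; apply: cvgD; [exact: cr|exact: cvg_cst].
move=> t; have -> : Re (F (c + s'%:C * cis t)) + - Re (F c) = Re (F (c + s'%:C * cis t) - F c).
  by case: (F _) (F _) => [a b] [a' b'].
apply: le_trans (normr_Re _) _; apply: Hd.
by rewrite cnormM cnorm_real cnorm_cis mulr1 gtr0_norm.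
Qed.

Lemma circle_mean_center F D c r s : punctured_hol F D c r -> 0 < s < r ->
  circle_mean F c s = F c.
Proof.
move=> hF sr; apply/eqP; rewrite eq_complex /=; apply/andP; split; apply/eqP.
  exact: radial_mean hF sr.
have E z : Re (- 'i%C * z) = Im z by case: z => a b /=; ring.
have := radial_mean (punctured_holZ (- 'i%C) hF) sr; rewrite E => <-.
by congr umean; apply/funext => t /=; rewrite E.
Qed.

End MeanValue.

(** * Maximum principle on rectangles *)

Section MaximumPrinciple.
Variable R : realType.
Local Notation C := R[i].
Local Notation Re := (@complex.Re R).
Local Notation Im := (@complex.Im R).
Implicit Types (x y e d r s : R) (z w h c : C) (F G D : C -> C).

Definition crect (a b a' b' : R) (z : C) : Prop :=
  a <= Re z <= b /\ a' <= Im z <= b'.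

Definition ccont_on (K : C -> Prop) F := forall z, K z -> forall e, 0 < e ->
  exists2 d, 0 < d & forall w, K w -> cnorm (w - z) < d -> cnorm (F w - F z) <= e.

Definition rcont_on (K : C -> Prop) (f : C -> R) := forall z, K z -> forall e, 0 < e ->
  exists2 d, 0 < d & forall w, K w -> cnorm (w - z) < d -> `|f w - f z| <= e.

Lemma crect_max a b a' b' (f : C -> R) z0 : crect a b a' b' z0 ->
  rcont_on (crect a b a' b') f ->
  exists2 c, crect a b a' b' c & forall z, crect a b a' b' z -> f z <= f c.
Proof.
move=> Kz0 cf; pose K : set (R * R) := `[a, b] `*` `[a', b'].
have KP p : K p <-> crect a b a' b' (p.1 +i* p.2).
  by rewrite /K /crect /= !in_itv.
have [||| [x y] /set_mem /KP Kc Hc] :=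
  @compact_EVT_max _ R (fun p : R * R => f (p.1 +i* p.2)) K.
- by exists (Re z0, Im z0); apply/KP; case: z0 Kz0.
- by apply: compact_setX; exact: segment_compact.
- apply/subspace_continuousP => p /KP Kp; apply/cvgrPdist_le => e e0.
  have [d d0 Hd] := cf _ Kp e e0.
  rewrite near_withinE; apply/nbhs_ballP; exists (d / 2); first by rewrite /= divr_gt0.
  move=> q [q1 q2] /KP Kq; rewrite distrC; apply: Hd => //.
  apply: le_lt_trans (cnorm_ReIm _) _ => /=.
  have a1 : `|q.1 - p.1| < d / 2 by rewrite distrC.
  have a2 : `|q.2 - p.2| < d / 2 by rewrite distrC.
  lra.
- exists (x +i* y) => // z Kz.
  have := Hc (Re z, Im z); have -> : Re z +i* Im z = z by case: z Kz.
  by apply; apply/mem_set/KP; case: z Kz.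
Qed.

Lemma punctured_holD_linear F D c r k : punctured_hol F D c r ->
  punctured_hol (fun z => F z + k * z) (fun z => D z + k) c r.
Proof.
have k1 : 0 < 1 + cnorm k by rewrite ltr_pwDl // cnorm_ge0.
case=> cF dF bD; split.
- move=> e e0; have [d d0 H] := cF (e / 2) (divr_gt0 e0 (ltr0Sn _ _)).
  exists (Num.min d (e / 2 / (1 + cnorm k))) => [|h].
    by rewrite lt_min d0 !divr_gt0.
  rewrite lt_min => /andP[/H h1]; rewrite ltr_pdivlMr // => h2.
  have -> : F (c + h) + k * (c + h) - (F c + k * c) = F (c + h) - F c + k * h by ring.
  by have := cnormD (F (c + h) - F c) (k * h); rewrite cnormM; have := cnorm_ge0 h; lra.
- move=> z /dF dz e /dz[d d0 H]; exists d => // h /H.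
  by have -> : F (z + h) + k * (z + h) - (F z + k * z) - (D z + k) * h =
    F (z + h) - F z - D z * h by ring.
- move=> p /bD[L HL]; exists (L + cnorm k) => z /HL hz.
  by apply: le_trans (cnormD _ _) _; rewrite lerD2r.
Qed.

(** Rotating by [u] replaces a modulus by a real part, to which the real mean value theorem and the
    monotonicity of means apply. *)
Lemma conj_unit z : exists2 u, cnorm u <= 1 & u * z = (cnorm z)%:C.
Proof.
have [->|z0] := eqVneq z 0; first by exists 0; rewrite ?mulr0 ?cnorm0 ?ler01.
have n0 : 0 < cnorm z by rewrite cnorm_gt0.
exists ((cnorm z)%:C / z); last by rewrite mulfVK.
by rewrite cnormM cnormV cnorm_real gtr0_norm // divff ?gt_eqF.
Qed.

Lemma crect_cnorm_sqr_bound (a b a' b' : R) :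
  exists B : R, forall z, crect a b a' b' z -> cnorm z ^+ 2 <= B.
Proof.
exists (a ^+ 2 + b ^+ 2 + (a' ^+ 2 + b' ^+ 2)) => z [/andP[h1 h2] /andP[h3 h4]].
have sq (p q t : R) : p <= t -> t <= q -> t ^+ 2 <= p ^+ 2 + q ^+ 2.
  move=> pt tq; have [t0|t0] := lerP 0 t.
    have : t ^+ 2 <= q ^+ 2 by rewrite ler_pXn2r // nnegrE; lra.
    have := sqr_ge0 p; lra.
  have : (- t) ^+ 2 <= (- p) ^+ 2 by rewrite ler_pXn2r // ?nnegrE; lra.
  rewrite !sqrrN; have := sqr_ge0 q; lra.
by rewrite cnorm_sqr lerD // sq.
Qed.

(* At an interior maximum of |F| + d|z|^2 the harmonic function
   Re (u F + 2 d (conj c) z), with |u| = 1 and u F(c) = |F(c)|, would have its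
   mean over a small circle strictly below its value at the center. *)
Lemma maximum_principle a b a' b' F (M : R) :
  ccont_on (crect a b a' b') F ->
  (forall z, crect a b a' b' z -> cnorm (F z) <= M \/
     exists r D, [/\ 0 < r, (forall w, cnorm (w - z) < r -> crect a b a' b' w) &
       punctured_hol F D z r]) ->
  forall z, crect a b a' b' z -> cnorm (F z) <= M.
Proof.
move=> cF HF z0 Kz0; rewrite leNgt; apply/negP => Mz0.
have [B HB] := crect_cnorm_sqr_bound a b a' b'.
have B0 : 0 <= B by apply: le_trans (HB _ Kz0); rewrite exprn_ge0 // cnorm_ge0.
(* So small that [dl * cnorm z ^+ 2] cannot bridge the gap between [M] and [cnorm (F z0)]: a maximum
   [c] of [phi] then satisfies [M < cnorm (F c)]. *)
pose dl := (cnorm (F z0) - M) / (B + 1) / 2.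
have dl0 : 0 < dl by rewrite !divr_gt0 // ?subr_gt0 // ltr_wpDl.
have dlB : dl * B < cnorm (F z0) - M.
  apply: (@le_lt_trans _ _ (dl * (B + 1))); first by rewrite ler_wpM2l ?ltW // ltrDl.
  have -> : dl * (B + 1) = (cnorm (F z0) - M) / 2.
    by rewrite /dl; field; rewrite gt_eqF // ltr_wpDl.
  by have := Mz0; lra.
pose phi z := cnorm (F z) + dl * cnorm z ^+ 2.
have cphi : rcont_on (crect a b a' b') phi.
  move=> z Kz e e0.
  have [d d0 Hd] := cF _ Kz (e / 2) (divr_gt0 e0 (ltr0Sn _ _)).
  pose N := dl * (2 * cnorm z + 1).
  have N0 : 0 < N by rewrite mulr_gt0 // ltr_wpDl // mulr_ge0 // cnorm_ge0.
  exists (Num.min (Num.min d 1) (e / 2 / N)) => [|w Kw].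
    by rewrite !lt_min d0 ltr01 !divr_gt0.
  rewrite !lt_min => /andP[/andP[/(Hd _ Kw) h1 h2]]; rewrite ltr_pdivlMr // => h3.
  have n1 : cnorm w <= cnorm z + cnorm (w - z).
    by have := cnormD z (w - z); rewrite addrC subrK.
  have n2 : cnorm z <= cnorm w + cnorm (w - z).
    by have := cnormD w (z - w); rewrite addrC subrK cnormBC.
  have n3 : cnorm (F w) <= cnorm (F z) + cnorm (F w - F z).
    by have := cnormD (F z) (F w - F z); rewrite addrC subrK.
  have n4 : cnorm (F z) <= cnorm (F w) + cnorm (F w - F z).
    by have := cnormD (F w) (F z - F w); rewrite addrC subrK cnormBC.
  have := cnorm_ge0 z; have := cnorm_ge0 w; have := cnorm_ge0 (w - z).
  set q := cnorm (w - z) in h1 h2 h3 n1 n2 n3 n4 *; set W := cnorm w in n1 n2 *.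
  set Z := cnorm z in n1 n2 N N0 h3 * => q0 W0 Z0.
  have sq : `|W ^+ 2 - Z ^+ 2| <= q * (2 * Z + 1).
    have -> : W ^+ 2 - Z ^+ 2 = (W - Z) * (W + Z) by ring.
    rewrite normrM ler_pM //; first by rewrite ler_norml; lra.
    by rewrite ger0_norm; lra.
  have -> : phi w - phi z = (cnorm (F w) - cnorm (F z)) + dl * (W ^+ 2 - Z ^+ 2).
    by rewrite /phi -/W -/Z; ring.
  apply: le_trans (ler_normD _ _) _; rewrite normrM (gtr0_norm dl0).
  have : dl * `|W ^+ 2 - Z ^+ 2| <= q * N.
    by rewrite /N mulrCA ler_pM2l.
  have : `|cnorm (F w) - cnorm (F z)| <= e / 2 by rewrite ler_norml; lra.
  lra.
have [c Kc Hc] := crect_max Kz0 cphi.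
have Fc : M < cnorm (F c).
  have := Hc _ Kz0; have : dl * cnorm c ^+ 2 <= dl * B by rewrite ler_pM2l // HB.
  have : 0 <= dl * cnorm z0 ^+ 2 by rewrite mulr_ge0 ?(ltW dl0) ?exprn_ge0 ?cnorm_ge0.
  rewrite /phi; lra.
have [/le_lt_trans/(_ Fc)|[r [D [r0 Hr hF]]]] := HF _ Kc; first by rewrite ltxx.
have [u u1 uF] := conj_unit (F c).
pose k : C := (2 * dl)%:C * c^*.
have hH := punctured_holD_linear k (punctured_holZ u hF).
have s0 : 0 < r / 2 < r by lra.
have := circle_mean_center hH s0; set s := r / 2 in s0 *.
rewrite /circle_mean => Hmean.
have cg := punctured_hol_circle hH s0.
have : Re (u * F c + k * c) <= Re (u * F c + k * c) - dl * s ^+ 2.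
  rewrite -[in leLHS]Hmean; apply: Re_cmean_le cg _ => t /=.
  set w := c + s%:C * cis t.
  have ws : cnorm (w - c) = s by rewrite cnorm_circle //; lra.
  have Kw : crect a b a' b' w by apply: Hr; rewrite ws; lra.
  have h1 := Hc _ Kw.
  have h2 : Re (u * F w) <= cnorm (F w).
    apply: le_trans (Re_le_cnorm _) _; rewrite cnormM -[leRHS]mul1r.
    by rewrite ler_wpM2r // cnorm_ge0.
  (* Polarization of [cnorm (w - c) ^+ 2]: the term [dl * cnorm w ^+ 2] cancels against the one in
     [phi], and [dl * s ^+ 2] is the strict loss. *)
  have h3 : Re (k * w) = dl * (cnorm w ^+ 2 + cnorm c ^+ 2 - s ^+ 2).
    rewrite -ws !cnorm_sqr /k; case: (w) (c) => [x y] [x' y'] /=; ring.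
  have h4 : Re (k * c) = 2 * dl * cnorm c ^+ 2.
    by rewrite cnorm_sqr /k; case: (c) => [x' y'] /=; ring.
  rewrite uF.
  have -> : Re (u * F w + k * w) = Re (u * F w) + Re (k * w) by case: (u * _) (k * _) => [? ?] [].
  have -> : Re ((cnorm (F c))%:C + k * c) = cnorm (F c) + Re (k * c) by case: (k * _).
  rewrite h3 h4; move: h1; rewrite /phi; lra.
have : 0 < dl * s ^+ 2 by rewrite mulr_gt0 // exprn_gt0 //; lra.
lra.
Qed.

End MaximumPrinciple.

(** * Regularity of the complex derivative *)

Section DerivativeRegularity.
Variable R : realType.
Local Notation C := R[i].
Local Notation Re := (@complex.Re R).
Local Notation Im := (@complex.Im R).
Implicit Types (x y e d r s : R) (z w h c a k : C) (F G D : C -> C).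

Definition bounded_hol F D c r (L : R) := forall z, cnorm (z - c) < r ->
  cderiv F z (D z) /\ cnorm (D z) <= L.

Lemma mean_value_bound F D z h (L : R) :
  (forall t : R, 0 <= t <= 1 -> cderiv F (z + t%:C * h) (D (z + t%:C * h))) ->
  (forall t : R, 0 <= t <= 1 -> cnorm (D (z + t%:C * h)) <= L) ->
  cnorm (F (z + h) - F z) <= L * cnorm h.
Proof.
move=> dF bD; have [u u1 uF] := conj_unit (F (z + h) - F z).
pose f (t : R) := Re (u * F (z + t%:C * h)).
have df (t : R) : 0 <= t <= 1 -> is_derive t 1 f (Re (u * D (z + t%:C * h) * h)).
  move=> t01; apply: (is_derive_Re_comp (cderivZ u (dF t t01))).
  exact: curve_deriv_ray.
have d1 (t : R) : t \in `]0, 1[ -> is_derive t 1 f (Re (u * D (z + t%:C * h) * h)).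
  by rewrite in_itv /= => /andP[/ltW t0 /ltW t1]; apply: df; rewrite t0.
have cf : {within `[0, 1], continuous f}.
  apply: derivable_within_continuous => t t01.
  by have [] : is_derive t 1 f (Re (u * D (z + t%:C * h) * h)) by apply: df; move: t01; rewrite in_itv.
have [t t01 E] := MVT ltr01 d1 cf.
have -> : cnorm (F (z + h) - F z) = f 1 - f 0.
  rewrite /f mul1r mul0r addr0.
  have -> : Re (u * F (z + h)) - Re (u * F z) = Re (u * (F (z + h) - F z)).
    by rewrite mulrBr; case: (u * _) (u * _) => [? ?] [].
  by rewrite uF.
rewrite E subr0 mulr1; apply: le_trans (Re_le_cnorm _) _.
rewrite !cnormM ler_wpM2r ?cnorm_ge0 // -[leRHS]mul1r.
apply: ler_pM => //; try exact: cnorm_ge0.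
by apply: bD; move: t01; rewrite in_itv /= => /andP[/ltW -> /ltW ->].
Qed.

Lemma ball_segment c r z h (t : R) : cnorm (z - c) < r -> cnorm (z + h - c) < r ->
  0 <= t <= 1 -> cnorm (z + t%:C * h - c) < r.
Proof.
move=> zr zhr /andP[t0 t1].
have -> : z + t%:C * h - c = (1 - t)%:C * (z - c) + t%:C * (z + h - c).
  by rewrite rmorphB rmorph1; ring.
apply: le_lt_trans (cnormD _ _) _; rewrite !cnormM !cnorm_real !ger0_norm ?subr_ge0 //.
have [->|t1'] := eqVneq t 1; first by rewrite subrr mul0r add0r mul1r.
have -> : r = (1 - t) * r + t * r by ring.
by rewrite ltr_leD // ?ler_wpM2l ?(ltW zhr) // ltr_pM2l // subr_gt0 lt_neqAle t1'.
Qed.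

Lemma bounded_hol_lip F D c r L z h : bounded_hol F D c r L ->
  cnorm (z - c) < r -> cnorm (z + h - c) < r ->
  cnorm (F (z + h) - F z) <= L * cnorm h.
Proof.
move=> hF zr zhr; apply: (@mean_value_bound _ D) => t t01;
  have [] := hF _ (ball_segment zr zhr t01) => //.
Qed.

Lemma bounded_holS F D c r L c' r' : bounded_hol F D c r L ->
  (forall z, cnorm (z - c') < r' -> cnorm (z - c) < r) -> bounded_hol F D c' r' L.
Proof. by move=> hF sub z /sub; exact: hF. Qed.

(* The value k is the one at a, where the quotient is undefined. *)
Definition dquot F a c k : C -> C := fun w => if w == a then k else (F w - c) / (w - a).

Definition dquot_deriv F D a c : C -> C := fun w =>
  D w / (w - a) - (F w - c) / (w - a) ^+ 2.

Lemma cderiv_dquot F D a c k z : z != a -> cderiv F z (D z) ->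
  cderiv (dquot F a c k) z (dquot_deriv F D a c z).
Proof.
move=> za dF; apply: (@cderiv_ext _ (fun w => (F w - c) / (w - a)) _ _ _ (cnorm (z - a))).
- by rewrite cnorm_gt0 subr_eq0.
- move=> w; rewrite /dquot; have [->|//] := eqVneq w a.
  by rewrite cnormBC ltxx.
- exact: cderiv_quotient.
Qed.

Lemma cnorm_dquot_deriv_le F D a c w (q L B : R) : 0 < q -> q <= cnorm (w - a) ->
  cnorm (D w) <= L -> cnorm (F w - c) <= B ->
  cnorm (dquot_deriv F D a c w) <= L / q + B / q ^+ 2.
Proof.
move=> q0 qw DL FB; have w0 : 0 < cnorm (w - a) by apply: lt_le_trans qw.
apply: le_trans (cnormB _ _) _; rewrite !cnormM !cnormV expr2 cnormM -expr2.
apply: lerD; apply: ler_pM => //; try exact: cnorm_ge0.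
- by rewrite invr_ge0 cnorm_ge0.
- by rewrite lef_pV2 ?posrE.
- by rewrite invr_ge0 exprn_ge0 // cnorm_ge0.
- by rewrite lef_pV2 ?posrE ?exprn_gt0 // ler_pXn2r // nnegrE ltW.
Qed.

Lemma ccontM F G z : ccont F z -> ccont G z -> ccont (fun w => F w * G w) z.
Proof.
move=> cF cG e e0; pose K := cnorm (F z) + cnorm (G z) + 1.
have f0 := cnorm_ge0 (F z); have g0 := cnorm_ge0 (G z).
have K0 : 0 < K by rewrite /K; lra.
have e1 : 0 < Num.min 1 (e / K) by rewrite lt_min ltr01 divr_gt0.
have [d1 d10 H1] := cF _ e1; have [d2 d20 H2] := cG _ e1.
exists (Num.min d1 d2) => [|h]; first by rewrite lt_min d10.
rewrite lt_min => /andP[/H1 h1 /H2 h2]; set m := Num.min 1 (e / K) in h1 h2 e1.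
have m1 : m <= 1 by rewrite ge_min lexx.
have mK : m * K <= e by rewrite -ler_pdivlMr // ge_min lexx orbT.
have -> : F (z + h) * G (z + h) - F z * G z = (F (z + h) - F z) * (G (z + h) - G z) +
  (F (z + h) - F z) * G z + F z * (G (z + h) - G z) by ring.
apply: le_trans (cnormD _ _) _; rewrite cnormM.
apply: le_trans (lerD (cnormD _ _) (lexx _)) _; rewrite !cnormM.
have := cnorm_ge0 (F (z + h) - F z); have := cnorm_ge0 (G (z + h) - G z).
set p := cnorm (F (z + h) - F z) in h1 *; set q := cnorm (G (z + h) - G z) in h2 *.
move=> q0 p0; apply: le_trans mK; rewrite /K.
have t1 : p * q <= m * 1 by apply: ler_pM => //; exact: le_trans h2 m1.
have t2 : p * cnorm (G z) <= m * cnorm (G z) by rewrite ler_wpM2r.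
have t3 : cnorm (F z) * q <= cnorm (F z) * m by rewrite ler_wpM2l.
lra.
Qed.

Lemma ccont_ext F G z r : 0 < r ->
  (forall w, cnorm (w - z) < r -> F w = G w) -> ccont F z -> ccont G z.
Proof.
move=> r0 FG cF e e0; have [d d0 Hd] := cF e e0.
exists (Num.min d r) => [|h]; first by rewrite lt_min d0.
rewrite lt_min => /andP[hd hr].
rewrite -!FG ?Hd //; last by rewrite addrC addKr.
by rewrite subrr cnorm0.
Qed.

Lemma ccontB_cst F c z : ccont F z -> ccont (fun w => F w - c) z.
Proof.
move=> cF e /cF[d d0 H]; exists d => // h /H.
by have -> : F (z + h) - c - (F z - c) = F (z + h) - F z by ring.
Qed.

Lemma ccont_dquot F a c k z : z != a -> ccont F z -> ccont (dquot F a c k) z.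
Proof.
move=> za cF; apply: (@ccont_ext (fun w => (F w - c) * (w - a)^-1) _ _ (cnorm (z - a))).
- by rewrite cnorm_gt0 subr_eq0.
- move=> w; rewrite /dquot; have [->|//] := eqVneq w a.
  by rewrite cnormBC ltxx.
- by apply: ccontM; [exact: ccontB_cst|exact: cderiv_cont (cderiv_inv za)].
Qed.

Lemma ccont_dquot_at F a (D0 : C) : cderiv F a D0 -> ccont (dquot F a (F a) D0) a.
Proof.
move=> dF e e0; have [d d0 H] := dF _ e0; exists d => // h /H hd.
rewrite /dquot eqxx; have [|ha] := eqVneq; first by rewrite subrr cnorm0 ltW.
have h0 : h != 0 by apply: contra_neq ha => ->; rewrite addr0.
have n0 : 0 < cnorm h by rewrite cnorm_gt0.
have -> : (F (a + h) - F a) / (a + h - a) - D0 = (F (a + h) - F a - D0 * h) / h.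
  by have -> : a + h - a = h by [ring]; field.
by rewrite cnormM cnormV ler_pdivrMr.
Qed.

(** Continuity at [a] is the differentiability of [F] there, but the derivative of the quotient has
    no a priori bound near [a]. This is why [punctured_hol] asks for bounds only off small discs
    around the center. *)
Lemma punctured_hol_dquot_at F D a r L : 0 < r -> bounded_hol F D a r L ->
  punctured_hol (dquot F a (F a) (D a)) (dquot_deriv F D a (F a)) a r.
Proof.
move=> r0 hF; have a0 : cnorm (a - a) < r by rewrite subrr cnorm0.
split.
- by apply: ccont_dquot_at; have [] := hF _ a0.
- move=> z /andP[za zr]; apply: cderiv_dquot; last by have [] := hF _ zr.
  by rewrite -subr_eq0 -cnorm_gt0.
- move=> p p0; exists (L / p + (L * r) / p ^+ 2) => z /andP[pz zr].
  have [_ Lz] := hF _ zr; apply: cnorm_dquot_deriv_le => //; first exact: ltW.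
  have := @bounded_hol_lip _ _ _ _ _ a (z - a) hF a0.
  rewrite [a + _]addrC subrK => /(_ zr) /le_trans; apply.
  by rewrite ler_wpM2l ?(ltW zr) // (le_trans (cnorm_ge0 _) Lz).
Qed.

Lemma punctured_hol_dquot_off F D a c k w r L : 0 < r -> w != a ->
  bounded_hol F D w r L ->
  exists2 r', 0 < r' <= r &
    punctured_hol (dquot F a c k) (dquot_deriv F D a c) w r'.
Proof.
move=> r0 wa hF; pose q := cnorm (w - a) / 2.
have q0 : 0 < q by rewrite divr_gt0 // cnorm_gt0 subr_eq0.
exists (Num.min r q); first by rewrite lt_min r0 q0 ge_min lexx.
have far z : cnorm (z - w) < q -> q <= cnorm (z - a).
  by move=> zq; have := cnorm_trans w z a; rewrite [cnorm (w - z)]cnormBC; rewrite /q in zq *; lra.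
have w0 : cnorm (w - w) < r by rewrite subrr cnorm0.
have nea z : q <= cnorm (z - a) -> z != a.
  by move=> qz; rewrite -subr_eq0 -cnorm_gt0; apply: lt_le_trans qz.
split.
- apply: cderiv_cont; apply: cderiv_dquot wa _; exact: (hF _ w0).1.
- move=> z /andP[_]; rewrite lt_min => /andP[zr /far zq].
  by apply: cderiv_dquot; [exact: nea|exact: (hF _ zr).1].
- move=> p p0; exists (L / q + (L * r + cnorm (F w - c)) / q ^+ 2) => z /andP[_].
  rewrite lt_min => /andP[zr /far zq].
  have [_ Lz] := hF _ zr; apply: cnorm_dquot_deriv_le => //.
  have := @bounded_hol_lip _ _ _ _ _ w (z - w) hF w0.
  rewrite [w + _]addrC subrK => /(_ zr) h1.
  apply: le_trans (cnorm_trans _ (F w) _) _; rewrite lerD2r (le_trans h1) //.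
  by rewrite ler_wpM2l ?(ltW zr) // (le_trans (cnorm_ge0 _) Lz).
Qed.

Lemma ccurve_lin (g g' : R -> C) k : ccurve g -> ccurve g' ->
  ccurve (fun t => g t + k * g' t).
Proof.
move=> cg cg' t e e0; have k1 : 0 < 1 + cnorm k by rewrite ltr_pwDl // cnorm_ge0.
have e2 : 0 < e / 2 by rewrite divr_gt0.
have [d d0 H] := cg t _ e2; have [d' d0' H'] := cg' t _ (divr_gt0 e2 k1).
exists (Num.min d d') => [|h]; first by rewrite lt_min d0.
rewrite lt_min => /andP[/H h1 /H' h2].
have -> : g (t + h) + k * g' (t + h) - (g t + k * g' t) =
  (g (t + h) - g t) + k * (g' (t + h) - g' t) by ring.
apply: le_trans (cnormD _ _) _; rewrite cnormM.
have : cnorm k * cnorm (g' (t + h) - g' t) <= (1 + cnorm k) * (e / 2 / (1 + cnorm k)).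
  by rewrite ler_pM ?cnorm_ge0 // lerDr.
have -> : (1 + cnorm k) * (e / 2 / (1 + cnorm k)) = e / 2 by field; rewrite gt_eqF.
lra.
Qed.

Lemma cmean_lin (g g' : R -> C) k : ccurve g -> ccurve g' ->
  cmean (fun t => g t + k * g' t) = cmean g + k * cmean g'.
Proof.
move=> cg cg'; rewrite cmeanD ?cmeanZ //.
move=> t e e0; have k1 : 0 < 1 + cnorm k by rewrite ltr_pwDl // cnorm_ge0.
have [d' d0' H'] := cg' t _ (divr_gt0 e0 k1); exists d' => // h /H' hd.
rewrite -mulrBr cnormM.
have -> : e = (1 + cnorm k) * (e / (1 + cnorm k)) by field; rewrite gt_eqF.
by rewrite ler_pM ?cnorm_ge0 // lerDr.
Qed.

Lemma circle_neq z s (t : R) : 0 < s -> z + s%:C * cis t != z.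
Proof. by move=> s0; rewrite -subr_eq0 -cnorm_gt0 cnorm_circle. Qed.

Let circle_quot F z s (t : R) : C := (F (z + s%:C * cis t) - F z) / (s%:C * cis t).

(** Cauchy's formula for the derivative, obtained as the mean value property of the difference
    quotient completed by [D z] at its pole. *)
Let deriv_circle_quot F D z s r L : bounded_hol F D z r L -> 0 < s < r ->
  ccurve (circle_quot F z s) /\ D z = cmean (circle_quot F z s).
Proof.
move=> hF sr; have /andP[s0 sr'] := sr; have r0 : 0 < r by lra.
have hq := punctured_hol_dquot_at r0 hF.
have E : (fun t => dquot F z (F z) (D z) (z + s%:C * cis t)) = circle_quot F z s.
  apply/funext => t; rewrite /dquot /circle_quot (negbTE (circle_neq _ _ s0)).
  by have -> : z + s%:C * cis t - z = s%:C * cis t by ring.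
split; first by rewrite -E; exact: punctured_hol_circle hq sr.
by rewrite -E -[RHS]/(circle_mean _ z s) (circle_mean_center hq sr) /dquot eqxx.
Qed.

(* F'(z) is the mean over a circle of center z of the difference quotients of F
   at z, an expression linear in F, so increments of F' are means of those of F. *)
Lemma bounded_hol_deriv F D c r L : 0 < r -> bounded_hol F D c r L ->
  exists D2 L2, bounded_hol D D2 c (r / 4) L2.
Proof.
move=> r0 hF.
have cquotE F' z s t : cnorm (circle_quot F' z s t) = cnorm (F' (z + s%:C * cis t) - F' z) / `|s|.
  by rewrite cnormM cnormV cnormM cnorm_cis mulr1 cnorm_real.
have sub s z : 0 < s -> cnorm (z - c) + s <= r -> bounded_hol F D z s L.
  move=> s0 zr; apply: (bounded_holS hF) => w ws.
  by apply: le_lt_trans (cnorm_trans _ z _) _; lra.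
have L0 : 0 <= L.
  have [_ /(le_trans (cnorm_ge0 _))] // : cderiv F c (D c) /\ cnorm (D c) <= L.
  by apply: hF; rewrite subrr cnorm0.
(* On circles of radius [r / 4], two increments of [F], each at most [L * cnorm h], give
   [8 * L / r * cnorm h]; [cnorm_cmean_le] doubles this. *)
pose K := 16 * L / r; have K0 : 0 <= K by rewrite divr_ge0 ?mulr_ge0 // ltW.
have Dlip z h : cnorm (z - c) < r / 2 -> cnorm (z + h - c) < r / 2 ->
    cnorm (D (z + h) - D z) <= K * cnorm h.
  move=> zr zhr; pose s := r / 4.
  have s0 : 0 < s < r / 2 by rewrite /s; lra.
  have [g1 e1] := deriv_circle_quot (sub (r / 2) z ltac:(lra) ltac:(lra)) s0.
  have [g2 e2] := deriv_circle_quot (sub (r / 2) (z + h) ltac:(lra) ltac:(lra)) s0.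
  have cn := ccurve_lin (-1) g2 g1.
  have -> : D (z + h) - D z =
      cmean (fun t => circle_quot F (z + h) s t + (- 1) * circle_quot F z s t).
    by rewrite cmean_lin // -e1 -e2 mulN1r.
  apply: le_trans (@cnorm_cmean_le _ _ (8 * L / r * cnorm h) cn _) _; last first.
    by rewrite /K le_eqVlt; apply/orP; left; apply/eqP; ring.
  move=> t; rewrite mulN1r /circle_quot -mulrBl cnormM cnormV.
  set u := s%:C * cis t.
  have us : cnorm u = s by rewrite /u cnormM cnorm_real cnorm_cis mulr1 gtr0_norm //; lra.
  have in1 w : cnorm (w - c) < r / 2 -> cnorm (w + u - c) < r.
    move=> wr; have -> : w + u - c = (w - c) + u by ring.
    by apply: le_lt_trans (cnormD _ _) _; rewrite us /s; lra.
  have b1 : cnorm (F (z + u + h) - F (z + u)) <= L * cnorm h.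
    apply: bounded_hol_lip hF (in1 _ zr) _.
    by have -> : z + u + h = z + h + u by [ring]; apply: in1.
  have b2 : cnorm (F (z + h) - F z) <= L * cnorm h.
    by apply: bounded_hol_lip hF _ _; lra.
  have -> : F (z + h + u) - F (z + h) - (F (z + u) - F z) =
    (F (z + u + h) - F (z + u)) - (F (z + h) - F z).
    by have -> : z + u + h = z + h + u by [ring]; ring.
  rewrite us ler_pdivrMr; last by rewrite /s; lra.
  have -> : 8 * L / r * cnorm h * s = L * cnorm h + L * cnorm h.
    by rewrite /s; field; rewrite gt_eqF.
  by apply: le_trans (cnormB _ _) _; apply: lerD.
(* Second-order Taylor bound: [F w - D z * w] has the derivative [D w - D z], which is at most
   [K * cnorm h] on the segment. *)
have quad z h : cnorm (z - c) < r / 2 -> cnorm (z + h - c) < r / 2 ->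
    cnorm (F (z + h) - F z - D z * h) <= K * cnorm h ^+ 2.
  move=> zr zhr.
  have -> : F (z + h) - F z - D z * h =
    (F (z + h) + (- D z) * (z + h)) - (F z + (- D z) * z) by ring.
  rewrite expr2 mulrA.
  apply: (@mean_value_bound (fun w => F w + (- D z) * w) (fun w => D w + (- D z))).
    move=> t t01 e e0; have wr := ball_segment zr zhr t01.
    have wr' : cnorm (z + t%:C * h - c) < r by lra.
    have [d d0 Hd] := (hF _ wr').1 e e0; exists d => // k /Hd.
    set w := z + _; have -> : F (w + k) + - D z * (w + k) - (F w + - D z * w) - (D w - D z) * k
      = F (w + k) - F w - D w * k by ring.
    by [].
  move=> t t01; apply: le_trans (Dlip _ _ zr (ball_segment zr zhr t01)) _.
  rewrite ler_wpM2l // cnormM cnorm_real; case/andP: t01 => t0 t1.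
  by rewrite ger0_norm // -[leRHS]mul1r ler_wpM2r // cnorm_ge0.
(* The candidate for the derivative of [D] puts [D] in the place of [F] in
   [D z = cmean (circle_quot F z s)]. With [s = r / 8] and [cnorm h < r / 8], the points [z + u] and
   [z + u + h] stay within [r / 2] of [c], where [Dlip] and [quad] hold. *)
exists (fun z => cmean (circle_quot D z (r / 8))), (2 * K) => z zr.
pose s := r / 8; rewrite -/s.
have s0 : 0 < s < r / 4 by rewrite /s; lra.
have us t : cnorm (s%:C * cis t) = s.
  by rewrite cnormM cnorm_real cnorm_cis mulr1 gtr0_norm //; lra.
have [g1 e1] := deriv_circle_quot (sub (r / 4) z ltac:(lra) ltac:(lra)) s0.
have g3 : ccurve (circle_quot D z s).
  (* The value 0 at the pole is a dummy: the circle avoids [z]. *)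
  have -> : circle_quot D z s = (fun t => dquot D z (D z) 0 (z + s%:C * cis t)).
    apply/funext => t; rewrite /dquot /circle_quot ifN ?circle_neq //; last lra.
    by have -> : z + s%:C * cis t - z = s%:C * cis t by ring.
  apply: ccurve_comp; first exact: ccurve_cis.
  move=> t; apply: ccont_dquot.
    by rewrite circle_neq //; lra.
  set w := z + _; have wr : cnorm (w - c) < 3 / 8 * r.
    have -> : w - c = (z - c) + s%:C * cis t by rewrite /w; ring.
    by apply: le_lt_trans (cnormD _ _) _; rewrite us /s; lra.
  move=> e e0; exists (Num.min (r / 8) (e / (K + 1))) => [|h].
    by rewrite lt_min !divr_gt0 // ltr_wpDl.
  rewrite lt_min => /andP[h1]; rewrite ltr_pdivlMr; last by rewrite ltr_wpDl.
  move=> h2; apply: le_trans (Dlip _ _ _ _) _; [lra| |].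
    have -> : w + h - c = (w - c) + h by ring.
    by apply: le_lt_trans (cnormD _ _) _; lra.
  by have := cnorm_ge0 h; lra.
split; last first.
  apply: cnorm_cmean_le => // t; rewrite cquotE gtr0_norm; last lra.
  rewrite ler_pdivrMr; last lra.
  rewrite -[X in K * X](us t); apply: Dlip; first lra.
  have -> : z + s%:C * cis t - c = (z - c) + s%:C * cis t by ring.
  by apply: le_lt_trans (cnormD _ _) _; rewrite us /s; lra.
(* Two remainders [K * cnorm h ^+ 2] divided by [s = r / 8], then doubled by [cnorm_cmean_le]. *)
move=> e e0; pose K2 := 32 * K / r.
have K20 : 0 <= K2 by apply: divr_ge0; [apply: mulr_ge0 => //; exact: K0|exact: ltW].
exists (Num.min (r / 8) (e / (K2 + 1))) => [|h].
  by rewrite lt_min !divr_gt0 // ltr_wpDl.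
rewrite lt_min => /andP[h1]; rewrite ltr_pdivlMr; last by rewrite ltr_wpDl.
move=> h2; have zhr : cnorm (z + h - c) < 3 / 8 * r.
  have -> : z + h - c = (z - c) + h by ring.
  by apply: le_lt_trans (cnormD _ _) _; lra.
have [g2 e2] := deriv_circle_quot (sub (r / 4) (z + h) ltac:(lra) ltac:(lra)) s0.
have cn1 := ccurve_lin (- 1) g2 g1.
have cn2 := ccurve_lin (- h) cn1 g3.
have -> : D (z + h) - D z - cmean (circle_quot D z s) * h =
    cmean (fun t => circle_quot F (z + h) s t + (- 1) * circle_quot F z s t +
      (- h) * circle_quot D z s t).
  by rewrite (cmean_lin (- h) cn1 g3) (cmean_lin _ g2 g1) -e1 -e2; ring.
apply: le_trans (@cnorm_cmean_le _ _ (16 * K / r * cnorm h ^+ 2) cn2 _) _; last first.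
  have -> : 2 * (16 * K / r * cnorm h ^+ 2) = K2 * cnorm h * cnorm h.
    by rewrite /K2; ring.
  by rewrite ler_wpM2r ?cnorm_ge0 //; have := cnorm_ge0 h; lra.
move=> t; rewrite /circle_quot; set u := s%:C * cis t.
have -> : (F (z + h + u) - F (z + h)) / u + -1 * ((F (z + u) - F z) / u) +
   - h * ((D (z + u) - D z) / u) =
   ((F (z + u + h) - F (z + u) - D (z + u) * h) - (F (z + h) - F z - D z * h)) / u.
  by have -> : z + u + h = z + h + u by [ring]; ring.
have b1 : cnorm (F (z + h) - F z - D z * h) <= K * cnorm h ^+ 2 by apply: quad; lra.
have b2 : cnorm (F (z + u + h) - F (z + u) - D (z + u) * h) <= K * cnorm h ^+ 2.
  apply: quad.
    have -> : z + u - c = (z - c) + u by ring.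
    by apply: le_lt_trans (cnormD _ _) _; rewrite us /s; lra.
  have -> : z + u + h - c = (z + h - c) + u by ring.
  by apply: le_lt_trans (cnormD _ _) _; rewrite us /s; lra.
rewrite cnormM cnormV us ler_pdivrMr; last lra.
have -> : 16 * K / r * cnorm h ^+ 2 * s = K * cnorm h ^+ 2 + K * cnorm h ^+ 2.
  by rewrite /s; field; rewrite gt_eqF.
by apply: le_trans (cnormB _ _) _; apply: lerD.
Qed.

(** Every derivative costs a factor 4 in the radius, so a common disc is obtained for a number [N]
    of orders fixed in advance. *)
Lemma holomorphic_tower (N : nat) F D c r L : 0 < r -> bounded_hol F D c r L ->
  exists (G : nat -> C -> C) (p : R), [/\ 0 < p, G 0 = F &
    forall j, (j < N)%N -> forall z, cnorm (z - c) < p -> cderiv (G j) z (G j.+1 z)].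
Proof.
elim: N F D r L => [|N IH] F D r L r0 hF; first by exists (fun=> F), 1.
have [D2 [L2 h2]] := bounded_hol_deriv r0 hF.
have r4 : 0 < r / 4 by rewrite divr_gt0.
have [G [p [p0 G0 HG]]] := IH _ _ _ _ r4 h2.
exists (fun j => if j is j'.+1 then G j' else F), (Num.min p r).
split => //; first by rewrite lt_min p0.
case=> [|j] jN z; rewrite lt_min => /andP[zp zr]; last exact: HG.
by rewrite G0; exact: (hF _ zr).1.
Qed.

End DerivativeRegularity.

(** * Continuous Gateaux-differentiable functions are holomorphic *)

Section GateauxHolomorphic.
Variable R : realType.
Local Notation C := R[i].
Local Notation Re := (@complex.Re R).
Local Notation Im := (@complex.Im R).
Implicit Types (x y e d r s : R) (z w h c a k t : C) (F G D : C -> C).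

Definition csquare c r z := `|Re z - Re c| < r /\ `|Im z - Im c| < r.

Lemma csquareP c r z : csquare c r z <->
  (Re c - r < Re z < Re c + r) /\ (Im c - r < Im z < Im c + r).
Proof.
by rewrite /csquare !ltr_distl.
Qed.

Lemma ball_csquare c r z : cnorm (z - c) < r -> csquare c r z.
Proof.
move=> h; split.
  have -> : Re z - Re c = Re (z - c) by case: z c {h} => ? ? [].
  exact: le_lt_trans (normr_Re _) h.
have -> : Im z - Im c = Im (z - c) by case: z c {h} => ? ? [].
exact: le_lt_trans (normr_Im _) h.
Qed.

Lemma csquare_ball c r z : csquare c (r / 2) z -> cnorm (z - c) < r.
Proof.
move=> [h1 h2]; apply: le_lt_trans (cnorm_ReIm _) _.
have -> : Re (z - c) = Re z - Re c by case: z c {h1 h2} => ? ? [].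
have -> : Im (z - c) = Im z - Im c by case: z c {h1 h2} => ? ? [].
lra.
Qed.

Lemma csquare_open c r z : csquare c r z -> exists2 d, 0 < d &
  forall w, csquare z d w -> csquare c r w.
Proof.
move=> [h1 h2]; exists (Num.min (r - `|Re z - Re c|) (r - `|Im z - Im c|)) => [|w].
  by rewrite lt_min !subr_gt0 h1.
move=> [] ; rewrite !lt_min => /andP[h3 _] /andP[_ h4]; split.
  have -> : Re w - Re c = (Re w - Re z) + (Re z - Re c) by ring.
  by apply: le_lt_trans (ler_normD _ _) _; lra.
have -> : Im w - Im c = (Im w - Im z) + (Im z - Im c) by ring.
by apply: le_lt_trans (ler_normD _ _) _; lra.
Qed.

Lemma csquareW c r r' z : r <= r' -> csquare c r z -> csquare c r' z.
Proof. by move=> rr [h1 h2]; split; lra. Qed.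

Lemma csquare_center c r : 0 < r -> csquare c r c.
Proof. by move=> r0; rewrite /csquare !subrr normr0. Qed.

Lemma nested_intervals (u v : nat -> R) : (forall i j, u i <= v j) ->
  exists t : R, forall i, u i <= t <= v i.
Proof.
move=> uv; exists (sup (range u)) => i.
have hs : has_sup (range u).
  by split; [exists (u 0), 0|exists (v 0) => _ [j _ <-]].
apply/andP; split; first by apply: sup_upper_bound => //; exists i.
by apply: ge_sup => [|_ [j _ <-]]; [exists (u 0), 0|].
Qed.

(** Otherwise every small square around a point of [P] contains a point of [P] outside [E N], and
    squares centered in [P] can be shrunk so as to avoid [E 0], [E 1] and so on in turn. Their
    common point lies in no [E N], against [cover], which concerns the whole square and not just
    [P]. *)
Lemma baire_csquare (E : nat -> C -> Prop) (P : C -> Prop) c r z0 :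
  (forall z, csquare c r z -> exists N, E N z) ->
  (forall N z, csquare c r z -> ~ E N z ->
     exists2 d, 0 < d & forall w, csquare z d w -> ~ E N w) ->
  P z0 -> csquare c r z0 ->
  exists z N p, [/\ P z, 0 < p, forall w, csquare z p w -> csquare c r w &
    forall w, P w -> csquare z p w -> E N w].
Proof.
move=> cover openE Pz0 Qz0; apply: contrapT => nex.
pose ok (q : C * R) := [/\ P q.1, 0 < q.2 & forall w, csquare q.1 q.2 w -> csquare c r w].
have step (Nq : nat * (C * R)) : exists q' : C * R, ok Nq.2 ->
   [/\ ok q', (forall w, csquare q'.1 (2 * q'.2) w -> csquare Nq.2.1 Nq.2.2 w) &
     forall w, csquare q'.1 (2 * q'.2) w -> ~ E Nq.1 w].
  case: Nq => N [z p] /=.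
  (* For pairs that are not [ok] the value [(0, 0)] only makes the choice function total. *)
  have [okq|] := pselect (ok (z, p)); last by exists (0, 0).
  have [Pz p0 sub] := okq; rewrite /= in Pz p0 sub.
  have [w [Pw zw nE]] : exists w, [/\ P w, csquare z p w & ~ E N w].
    apply: contrapT => H; apply: nex; exists z, N, p; split => // w Pw zw.
    by apply: contrapT => nE; apply: H; exists w.
  have [d1 d10 H1] := csquare_open zw.
  have [d2 d20 H2] := openE N w (sub _ zw) nE.
  (* Halving leaves room: the common point is only known to lie in the closed squares, which are
     contained in the open squares of double size. *)
  exists (w, Num.min d1 d2 / 2) => _ /=.
  have -> : 2 * (Num.min d1 d2 / 2) = Num.min d1 d2 by field.
  have m0 : 0 < Num.min d1 d2 by rewrite lt_min d10.
  have m1 : Num.min d1 d2 <= d1 by rewrite ge_min lexx.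
  split.
  - split => //=; first by rewrite divr_gt0.
    by move=> v /(@csquareW _ _ d1) h; apply: sub; apply: H1; apply: h; lra.
  - by move=> v /(@csquareW _ _ d1) h; apply: H1; apply: h; rewrite ge_min lexx.
  - by move=> v /(@csquareW _ _ d2) h; apply: H2; apply: h; rewrite ge_min lexx orbT.
have [next Hnext] := choice step.
have [p0 p00 Hp0] := csquare_open Qz0.
pose sq := fix sq (n : nat) : C * R := if n is n'.+1 then next (n', sq n') else (z0, p0).
have okn n : ok (sq n).
  by elim: n => [|n IH]; [split|have [] := Hnext (n, sq n) IH].
have subn n w : csquare (sq n.+1).1 (2 * (sq n.+1).2) w -> csquare (sq n).1 (sq n).2 w.
  by have [_ + _] := Hnext (n, sq n) (okn n); apply.
have nE n w : csquare (sq n.+1).1 (2 * (sq n.+1).2) w -> ~ E n w.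
  by have [_ _] := Hnext (n, sq n) (okn n); apply.
have pos n : 0 < (sq n).2 by have [] := okn n.
have mono n m w : csquare (sq (n + m)%N).1 (sq (n + m)%N).2 w -> csquare (sq n).1 (sq n).2 w.
  elim: m w => [|m IH] w; first by rewrite addn0.
  rewrite addnS => h; apply: IH; apply: subn; apply: csquareW h.
  by have := pos (n + m).+1; lra.
have meet n m : exists w, csquare (sq n).1 (sq n).2 w /\ csquare (sq m).1 (sq m).2 w.
  have [nm|/ltnW nm] := leqP n m.
    exists (sq m).1; have h := csquare_center (sq m).1 (pos m).
    by split => //; apply: (@mono _ (m - n)%N); rewrite subnKC.
  exists (sq n).1; have h := csquare_center (sq n).1 (pos n).
  by split => //; apply: (@mono _ (n - m)%N); rewrite subnKC.
have [x Hx] : exists x : R, forall i, Re (sq i).1 - (sq i).2 <= x <= Re (sq i).1 + (sq i).2.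
  apply: nested_intervals => i j; have [w [/csquareP[h1 _] /csquareP[h2 _]]] := meet i j.
  lra.
have [y Hy] : exists y : R, forall i, Im (sq i).1 - (sq i).2 <= y <= Im (sq i).1 + (sq i).2.
  apply: nested_intervals => i j; have [w [/csquareP[_ h1] /csquareP[_ h2]]] := meet i j.
  lra.
have inn n : csquare (sq n).1 (2 * (sq n).2) (x +i* y).
  by apply/csquareP => /=; have := pos n; have := Hx n; have := Hy n; split; lra.
have [N EN] : exists N, E N (x +i* y).
  by apply: cover; have [_ _] := okn 0; apply; apply: subn; exact: inn.
exact: nE N _ (inn N.+1) EN.
Qed.

End GateauxHolomorphic.

(** * From directional derivatives to complex derivatives under a Lipschitz bound *)

Section GateauxLipschitz.
Variable R : realType.
Local Notation C := R[i].
Local Notation Re := (@complex.Re R).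
Local Notation Im := (@complex.Im R).
Implicit Types (x y e d r s : R) (z w h c a k t : C) (F G D : C -> C).

(** One-sided in [x], with [d] depending on the direction [h]. *)
Definition cgateaux F z (v : C) := forall h e, 0 < e ->
  exists2 d, 0 < d & forall x, 0 < x < d ->
    cnorm (F (z + x%:C * h) - F z - x%:C * h * v) <= e * x.

Definition lip_at F z := exists r (L : R), 0 < r /\
  forall u v, cnorm (u - z) < r -> cnorm (v - z) < r ->
    cnorm (F u - F v) <= L * cnorm (u - v).

Lemma cnorm_le_ReIm z w : `|Re z| <= `|Re w| -> `|Im z| <= `|Im w| ->
  cnorm z <= cnorm w.
Proof.
move=> h1 h2; rewrite -(@ler_pXn2r _ 2) ?nnegrE ?cnorm_ge0 // !cnorm_sqr.
rewrite -[Re z ^+ 2]real_normK ?num_real // -[Im z ^+ 2]real_normK ?num_real //.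
rewrite -[Re w ^+ 2]real_normK ?num_real // -[Im w ^+ 2]real_normK ?num_real //.
by apply: lerD; rewrite ler_pXn2r // nnegrE.
Qed.

Lemma grid_approx (N : nat) (x : R) : (0 < N)%N -> `|x| <= 1 ->
  exists j : 'I_(2 * N).+1, `|x - (j%:R / N%:R - 1)| <= N%:R^-1.
Proof.
move=> N0 /ler_normlP[x1 x2]; have n0 : 0 < N%:R :> R by rewrite ltr0n.
have y0 : 0 <= (x + 1) * N%:R by apply: mulr_ge0; lra.
have /andP[t1 t2] := truncn_itv y0.
set j := Num.truncn _ in t1 t2.
have jN : (j < (2 * N).+1)%N.
  rewrite ltnS -(ler_nat R) natrM; apply: le_trans t1 _.
  by rewrite ler_wpM2r ?(ltW n0) //; lra.
exists (Ordinal jN) => /=; rewrite -(@ler_pM2r _ N%:R) // mulVf ?gt_eqF //.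
rewrite -[X in _ * X]gtr0_norm // -normrM.
have -> : (x - (j%:R / N%:R - 1)) * N%:R = (x + 1) * N%:R - j%:R.
  by field; rewrite gt_eqF.
by rewrite ger0_norm; rewrite -natr1 in t2; lra.
Qed.

Lemma fin_min_pos (T : finType) (P : T -> R -> Prop) :
  (forall i, exists2 d, 0 < d & P i d) ->
  (forall i d d', 0 < d' -> d' <= d -> P i d -> P i d') ->
  exists2 d, 0 < d & forall i, P i d.
Proof.
move=> H mono.
have H' i : exists d, 0 < d /\ P i d by have [d d0 Pd] := H i; exists d.
have [f Hf] := choice H'.
exists (\big[Num.min/1]_i f i); first by apply: lt_bigmin => // i _; case: (Hf i).
move=> i; apply: (mono i (f i)); last by case: (Hf i).
  by apply: lt_bigmin => // j _; case: (Hf j).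
exact: bigmin_le.
Qed.

(** The directional estimates are uniform over a finite grid of directions, and the Lipschitz bound
    carries them from the grid to every unit direction. *)
Lemma cgateaux_lip_cderiv F z (v : C) : lip_at F z -> cgateaux F z v ->
  cderiv F z v.
Proof.
move=> [r [L [r0 HL]]] gF e e0.
pose K := `|L| + cnorm v + 1.
have K0 : 0 < K by rewrite /K; have := cnorm_ge0 v; have := normr_ge0 L; lra.
(* A unit direction is within [2 / N] of the grid, and the resulting error [K * (2 / N)] must not
   exceed [e / 2]. *)
have [N N0 NK] : exists2 N : nat, (0 < N)%N & 4 * K / e < N%:R.
  have q0 : 0 <= 4 * K / e by apply: divr_ge0; lra.
  have h := archi_boundP q0.
  by exists (Num.bound (4 * K / e)).+1 => //; apply: lt_trans h _; rewrite ltr_nat.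
have n0 : 0 < N%:R :> R by rewrite ltr0n.
pose g (ij : 'I_(2 * N).+1 * 'I_(2 * N).+1) : C :=
  (ij.1%:R / N%:R - 1) +i* (ij.2%:R / N%:R - 1).
have [d d0 Hd] := @fin_min_pos _ (fun ij d => forall x, 0 < x < d ->
    cnorm (F (z + x%:C * g ij) - F z - x%:C * g ij * v) <= e / 2 * x)
  (fun ij => gF (g ij) (e / 2) (divr_gt0 e0 (ltr0Sn _ _)))
  (fun ij d d' _ dd' H x => ltac:(move=> /andP[x0 xd]; apply: H; lra)).
(* The grid direction [u] chosen below has modulus at most 3, so [r / 4] keeps [z + x%:C * u] within
   [r] of [z]. *)
exists (Num.min d (r / 4)) => [|k]; first by rewrite lt_min d0 divr_gt0.
rewrite lt_min => /andP[kd kr].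
have [->|k0] := eqVneq k 0.
  by rewrite addr0 subrr mulr0 subrr cnorm0 mulr0.
set x := cnorm k in kd kr *; have x0 : 0 < x by rewrite cnorm_gt0.
pose q := k / x%:C; have kE : k = x%:C * q.
  by rewrite /q mulrC divfK // -cnorm_eq0 cnorm_real normr_eq0 gt_eqF.
have q1 : cnorm q = 1.
  by rewrite cnormM cnormV cnorm_real gtr0_norm // divff // gt_eqF.
have qr : `|Re q| <= 1 by rewrite -q1 normr_Re.
have qi : `|Im q| <= 1 by rewrite -q1 normr_Im.
have [i Hi] := grid_approx N0 qr.
have [j Hj] := grid_approx N0 qi.
pose u := g (i, j).
have qu : cnorm (q - u) <= 2 / N%:R.
  apply: le_trans (cnorm_ReIm _) _.
  have -> : Re (q - u) = Re q - (i%:R / N%:R - 1) by rewrite /u; case: (q).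
  have -> : Im (q - u) = Im q - (j%:R / N%:R - 1) by rewrite /u; case: (q).
  by apply: le_trans (lerD Hi Hj) _; rewrite mulrC mulr2n mulrDr mulr1.
have N1 : N%:R^-1 <= 1 :> R by rewrite invf_le1 // ler1n.
have u3 : cnorm u <= 3.
  by have := cnormB q (q - u); rewrite opprB addrC subrK q1; lra.
have h1 : cnorm (F (z + k) - F (z + x%:C * u)) <= L * (x * cnorm (q - u)).
  apply: le_trans (HL _ _ _ _) _.
  - by rewrite addrC addKr -/x; lra.
  - rewrite addrC addKr cnormM cnorm_real gtr0_norm //.
    apply: (@le_lt_trans _ _ (x * 3)); first by rewrite ler_wpM2l // ltW.
    lra.
  - have -> : z + k - (z + x%:C * u) = x%:C * (q - u) by rewrite kE; ring.
    by rewrite cnormM cnorm_real gtr0_norm.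
have h2 := Hd (i, j) x ltac:(lra).
rewrite -/u in h2.
have -> : F (z + k) - F z - v * k = (F (z + k) - F (z + x%:C * u)) +
  (F (z + x%:C * u) - F z - x%:C * u * v) + x%:C * (u - q) * v.
  by rewrite [in v * k]kE; ring.
apply: le_trans (cnormD _ _) _; apply: le_trans (lerD (cnormD _ _) (lexx _)) _.
rewrite !cnormM cnorm_real gtr0_norm // [cnorm (u - q)]cnormBC.
have p0 := cnorm_ge0 (q - u); have v0 := cnorm_ge0 v.
have b1 : x * cnorm (q - u) * K <= x * (2 / N%:R) * K.
  by rewrite ler_wpM2r ?(ltW K0) // ler_wpM2l // ltW.
have b2 : x * (2 / N%:R) * K <= e / 2 * x.
  rewrite ltr_pdivrMr // in NK.
  have -> : x * (2 / N%:R) * K = 2 * K / N%:R * x by ring.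
  by rewrite ler_wpM2r ?(ltW x0) // ler_pdivrMr //; lra.
have b3 : L * (x * cnorm (q - u)) <= `|L| * (x * cnorm (q - u)).
  by rewrite ler_wpM2r ?ler_norm // mulr_ge0 // ltW.
have b4 : 0 <= x * cnorm (q - u) by rewrite mulr_ge0 // ltW.
have b5 : x * cnorm (q - u) * K = `|L| * (x * cnorm (q - u)) + x * cnorm (q - u) * cnorm v + x * cnorm (q - u).
  by rewrite /K; ring.
lra.
Qed.

Lemma lip_at_bounded_hol F D c r0 : 0 < r0 ->
  (forall z, csquare c r0 z -> cgateaux F z (D z)) -> lip_at F c ->
  exists r L, 0 < r /\ bounded_hol F D c r L.
Proof.
move=> r00 gF [r [L [r1 HL]]]; exists (Num.min r r0), L; split; first by rewrite lt_min r1.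
move=> z; rewrite lt_min => /andP[zr zr0].
pose q := r - cnorm (z - c).
have q0 : 0 < q by rewrite subr_gt0.
have near_z u : cnorm (u - z) < q -> cnorm (u - c) < r.
  by move=> h; apply: le_lt_trans (cnorm_trans _ z _) _; rewrite /q in h; lra.
have dF : cderiv F z (D z).
  apply: cgateaux_lip_cderiv; last by apply: gF; exact: ball_csquare.
  by exists q, L; split=> // u v /near_z hu /near_z; exact: HL.
split => //; apply/ler_addgt0Pr => e e0; have [d d0 Hd] := dF _ e0.
pose x := Num.min d q / 2; have m0 : 0 < Num.min d q by rewrite lt_min d0.
have [md mq] : Num.min d q <= d /\ Num.min d q <= q by rewrite !ge_min !lexx orbT.
have x0 : 0 < x by rewrite divr_gt0.
have xn : cnorm x%:C = x by rewrite cnorm_real gtr0_norm.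
have h1 : cnorm (F (z + x%:C) - F z) <= L * x.
  have e1 : z + x%:C - z = x%:C by ring.
  have := HL (z + x%:C) z; rewrite e1 xn; apply => //.
  by apply: near_z; rewrite e1 xn /x; lra.
have h2 : cnorm (F (z + x%:C) - F z - D z * x%:C) <= e * x.
  by have := Hd x%:C; rewrite xn; apply; rewrite /x; lra.
rewrite -(@ler_pM2r _ x) // -[in X in X <= _]xn -cnormM mulrDl.
have := cnormB (F (z + x%:C) - F z) (F (z + x%:C) - F z - D z * x%:C).
have -> : F (z + x%:C) - F z - (F (z + x%:C) - F z - D z * x%:C) = D z * x%:C by ring.
lra.
Qed.

Lemma punctured_hol_le F D c r r' : r' <= r -> punctured_hol F D c r ->
  punctured_hol F D c r'.
Proof.
move=> rr [cF dF bD]; split => //.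
- by move=> z /andP[z0 zr]; apply: dF; rewrite z0; lra.
- by move=> p /bD[L HL]; exists L => z /andP[z0 zr]; apply: HL; rewrite z0; lra.
Qed.

(** Maximum principle for the difference quotient: where the bound is not already known, the point
    is interior and [F] is holomorphic around it. The pole [s] lies either outside the rectangle,
    with [c] arbitrary, or inside with [c = F s], and is then removable. *)
Lemma dquot_rect_bound (a b a' b' : R) F D (s : C) c (M : R) :
  (forall w, crect a b a' b' w -> ccont F w) ->
  (crect a b a' b' s -> c = F s) ->
  (forall w, crect a b a' b' w ->
     (w != s /\ cnorm (F w - c) <= M * cnorm (w - s)) \/
     [/\ a < Re w < b, a' < Im w < b' &
       exists r L, 0 < r /\ bounded_hol F D w r L]) ->
  forall w, crect a b a' b' w -> cnorm (F w - c) <= M * cnorm (w - s).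
Proof.
move=> cF cs H w Kw.
pose g := dquot F s c (D s).
have gb u : u != s -> (cnorm (g u) <= M) = (cnorm (F u - c) <= M * cnorm (u - s)).
  move=> us; rewrite /g /dquot (negbTE us) cnormM cnormV ler_pdivrMr //.
  by rewrite cnorm_gt0 subr_eq0.
have [ws|ws] := eqVneq w s.
  by rewrite ws cs -?ws // !subrr cnorm0 mulr0.
rewrite -gb //; apply: (@maximum_principle _ a b a' b' g) => //.
- have cg u : crect a b a' b' u -> ccont g u.
    move=> Ku; have [us|us] := eqVneq u s; last by apply: ccont_dquot => //; exact: cF.
    have [[] |[_ _ [r [L [r0 hF]]]]] := H u Ku; first by rewrite us eqxx.
    rewrite us in Ku hF *; rewrite /g cs //; apply: ccont_dquot_at.
    by apply: (hF _ _).1; rewrite subrr cnorm0.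
  move=> u /cg cu e /cu[d d0 Hd]; exists d => // v _ /Hd.
  by rewrite [u + _]addrC subrK.
- move=> u Ku; have [[us]|[/andP[h1 h2] /andP[h3 h4] [r [L [r0 hF]]]]] := H u Ku.
    by rewrite -gb //; left.
  right; pose p := Num.min (Num.min (Re u - a) (b - Re u)) (Num.min (Im u - a') (b' - Im u)).
  have p0 : 0 < p by rewrite !lt_min !subr_gt0 h1 h2 h3 h4.
  have [r1 [D' [r10 hg]]] : exists r1 D', 0 < r1 /\ punctured_hol g D' u r1.
    have [us|us] := eqVneq u s.
      exists r, (dquot_deriv F D s (F s)); split => //; rewrite us in Ku hF *.
      by rewrite /g cs //; apply: punctured_hol_dquot_at hF.
    have [r1 /andP[r10 _] hg] := punctured_hol_dquot_off c (D s) r0 us hF.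
    by exists r1, (dquot_deriv F D s c).
  exists (Num.min r1 p), D'; split; first by rewrite lt_min r10.
    move=> v; rewrite lt_min => /andP[_] /ball_csquare[].
    rewrite !lt_min => /andP[/andP[v1 v2] _] /andP[_ /andP[v3 v4]].
    move: v1 v2 v3 v4; rewrite !ltr_norml /crect.
    move=> /andP[? ?] /andP[? ?] /andP[? ?] /andP[? ?].
    by split; apply/andP; split; lra.
  by apply: punctured_hol_le hg; rewrite ge_min lexx.
Qed.

End GateauxLipschitz.

(** * Continuous Gateaux-differentiable functions are locally Lipschitz *)

Section GateauxGoursat.
Variable R : realType.
Local Notation C := R[i].
Local Notation Re := (@complex.Re R).
Local Notation Im := (@complex.Im R).
Implicit Types (x y e d r s : R) (z w h c a k t : C) (F G D : C -> C).

(** [N] governs both the slope and the length of the cross, so that a single countable index feeds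
    Baire's theorem. *)
Let cross_bound F c r (N : nat) z := forall x : R, `|x| <= N.+1%:R^-1 ->
  (csquare c r (z + x%:C) -> cnorm (F (z + x%:C) - F z) <= N%:R * `|x|) /\
  (csquare c r (z + (0 +i* x)) -> cnorm (F (z + (0 +i* x)) - F z) <= N%:R * `|x|).

Let cross_bound_cover F c r z v : cgateaux F z v -> exists N, cross_bound F c r N z.
Proof.
move=> gF.
have side h : cnorm h = 1 -> exists2 d, 0 < d & forall x, 0 <= x < d ->
    cnorm (F (z + x%:C * h) - F z) <= (cnorm v + 1) * x.
  move=> h1; have [d d0 H] := gF h 1 ltr01; exists d => // x /andP[].
  rewrite le_eqVlt => /predU1P[<- _|x0 xd].
    by rewrite mul0r addr0 subrr cnorm0 mulr0.
  have hx := H x; rewrite x0 xd in hx; have {}hx := hx isT.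
  have := cnormD (F (z + x%:C * h) - F z - x%:C * h * v) (x%:C * h * v).
  rewrite subrK !cnormM h1 cnorm_real gtr0_norm //; lra.
have [d1 d10 H1] := side 1 (cnorm1 _).
have [d2 d20 H2] : exists2 d, 0 < d & forall x, 0 <= x < d ->
    cnorm (F (z + x%:C * -1) - F z) <= (cnorm v + 1) * x.
  by apply: side; rewrite cnormN cnorm1.
have i1 : cnorm ('i%C : C) = 1 by rewrite /cnorm /= expr0n /= expr1n add0r sqrtr1.
have [d3 d30 H3] := side _ i1.
have [d4 d40 H4] : exists2 d, 0 < d & forall x, 0 <= x < d ->
    cnorm (F (z + x%:C * - 'i%C) - F z) <= (cnorm v + 1) * x.
  by apply: side; rewrite cnormN i1.
pose d := Num.min (Num.min d1 d2) (Num.min d3 d4).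
have d0 : 0 < d by rewrite !lt_min d10 d20 d30 d40.
(* [N] exceeds the slope [cnorm v + 1], and its inverse falls below [d]. *)
pose N := Num.bound (cnorm v + 1 + d^-1); exists N => x xN.
have dN : 0 < d^-1 by rewrite invr_gt0.
have NB : cnorm v + 1 + d^-1 < N%:R by apply: archi_boundP; have := cnorm_ge0 v; lra.
have xd : `|x| < d.
  apply: le_lt_trans xN _; rewrite -[ltRHS]invrK ltf_pV2 ?posrE //.
  by rewrite -natr1; have := cnorm_ge0 v; lra.
have vN : (cnorm v + 1) * `|x| <= N%:R * `|x| by rewrite ler_wpM2r //; lra.
move: xd; rewrite !lt_min => /andP[/andP[x1 x2] /andP[x3 x4]].
have [x0|x0] := lerP 0 x.
  rewrite ger0_norm // in x1 x2 x3 x4 vN *; split=> _; apply: le_trans vN.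
    by have := H1 x; rewrite x0 x1 mulr1; apply.
  have -> : 0 +i* x = x%:C * 'i%C by apply/eqP; rewrite eq_complex /= !mul0r !mulr0 subr0 mulr1 addr0 !eqxx.
  by have := H3 x; rewrite x0 x3; apply.
rewrite ltr0_norm // in x1 x2 x3 x4 vN *; split=> _; apply: le_trans vN.
  have := H2 (- x); rewrite oppr_ge0 (ltW x0) x2 => /(_ isT).
  by rewrite rmorphN mulrNN mulr1.
have := H4 (- x); rewrite oppr_ge0 (ltW x0) x4 => /(_ isT).
have -> : 0 +i* x = (- x)%:C * - 'i%C.
  by apply/eqP; rewrite eq_complex /=; apply/andP; split; apply/eqP; ring.
by [].
Qed.

(** A failure is a strict inequality at one fixed [x], which survives small displacements of [z] by
    continuity of [F]. *)
Let cross_bound_closed F c r N z : (forall w, csquare c r w -> ccont F w) ->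
  csquare c r z -> ~ cross_bound F c r N z ->
  exists2 d, 0 < d & forall w, csquare z d w -> ~ cross_bound F c r N w.
Proof.
move=> cF Qz nE.
have key (k : C) (x : R) : csquare c r (z + k) -> N%:R * `|x| < cnorm (F (z + k) - F z) ->
    exists2 d, 0 < d & forall w, csquare z d w ->
      csquare c r (w + k) /\ N%:R * `|x| < cnorm (F (w + k) - F w).
  move=> Qk; rewrite -subr_gt0; set e := _ - _ => e0.
  have e4 : 0 < e / 4 by rewrite divr_gt0.
  have [d1 d10 H1] := cF _ Qk _ e4; have [d2 d20 H2] := cF _ Qz _ e4.
  have [d3 d30 H3] := csquare_open Qk.
  exists (Num.min (Num.min (d1 / 2) (d2 / 2)) d3) => [|w Qw].
    by rewrite !lt_min d30 !divr_gt0.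
  have [wa wb wc] : [/\ csquare z (d1 / 2) w, csquare z (d2 / 2) w & csquare z d3 w].
    by split; apply: csquareW Qw; rewrite !ge_min lexx ?orbT.
  have [s1 s2] := wc; split.
    have e1 : Re (w + k) - Re (z + k) = Re w - Re z.
      by case: (w) (z) (k) => [? ?] [? ?] [? ?] /=; ring.
    have e2 : Im (w + k) - Im (z + k) = Im w - Im z.
      by case: (w) (z) (k) => [? ?] [? ?] [? ?] /=; ring.
    by apply: H3; split; rewrite ?e1 ?e2.
  have := H1 (w - z) (csquare_ball wa); have := H2 (w - z) (csquare_ball wb).
  have -> : z + (w - z) = w by ring.
  have -> : z + k + (w - z) = w + k by ring.
  move=> h2 h1.
  have := cnormD (F (w + k) - F w) ((F (z + k) - F (w + k)) + (F w - F z)).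
  have -> : F (w + k) - F w + (F (z + k) - F (w + k) + (F w - F z)) = F (z + k) - F z by ring.
  have := cnormD (F (z + k) - F (w + k)) (F w - F z).
  rewrite [cnorm (F (z + k) - F (w + k))]cnormBC /e in h1 h2 e4 *; lra.
have [x [xN Hx]] : exists x : R, `|x| <= N.+1%:R^-1 /\
   ((csquare c r (z + x%:C) /\ N%:R * `|x| < cnorm (F (z + x%:C) - F z)) \/
   (csquare c r (z + (0 +i* x)) /\ N%:R * `|x| < cnorm (F (z + (0 +i* x)) - F z))).
  apply: contrapT => H; apply: nE => x xN; split=> Qx; rewrite leNgt; apply/negP => hx.
    by apply: H; exists x; split => //; left.
  by apply: H; exists x; split => //; right.
case: Hx => -[Qx hx]; have [d d0 Hd] := key _ _ Qx hx;
  exists d => // w /Hd[Qw hw] /(_ x xN)[E1 E2].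
- by have := E1 Qw; rewrite leNgt hw.
- by have := E2 Qw; rewrite leNgt hw.
Qed.

(* The set P of the points near which F is not Lipschitz is closed; by Baire's
   theorem, if it is nonempty, then on some square the difference quotients of F
   along the cross through any point of P are uniformly bounded. *)
Lemma gateaux_lip_at F D c r : (forall z, csquare c r z -> ccont F z) ->
  (forall z, csquare c r z -> cgateaux F z (D z)) ->
  forall z, csquare c r z -> lip_at F z.
Proof.
move=> cF gF z0 Qz0; apply: contrapT => nlip.
pose P z := csquare c r z /\ ~ lip_at F z.
have hol w : csquare c r w -> ~ P w -> exists s L, 0 < s /\ bounded_hol F D w s L.
  move=> Qw nP; have [d d0 Hd] := csquare_open Qw.
  apply: (@lip_at_bounded_hol _ F D w d d0); first by move=> z /Hd; exact: gF.
  by apply: contrapT => nl; apply: nP.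
have [z1 [N [p [[Qz1 nl1] p0 Hp EP]]]] :=
  @baire_csquare _ (cross_bound F c r) P c r z0
    (fun z Qz => cross_bound_cover c r (gF z Qz))
    (fun N z Qz => cross_bound_closed cF Qz) (conj Qz0 nlip) Qz0.
have [d d0 Hd] := cF _ Qz1 1 ltr01.
have [q [q0 EPq]] : exists q : R, 0 < q /\ forall t, P t -> csquare z1 p t ->
    forall x, `|x| <= q ->
    (csquare c r (t + x%:C) -> cnorm (F (t + x%:C) - F t) <= N%:R * `|x|) /\
    (csquare c r (t + (0 +i* x)) -> cnorm (F (t + (0 +i* x)) - F t) <= N%:R * `|x|).
  by exists N.+1%:R^-1; rewrite invr_gt0; split.
(* [rho <= p] gives access to the Baire bounds and [rho <= d / 2] makes the oscillation at most 2.
   The bound [rho <= q / 2] is there because two points of the square differ by less than [2 * rho]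
   in each coordinate. *)
have [rho [rho0 rhop rhod rhoq]] : exists rho : R,
    [/\ 0 < rho, rho <= p, rho <= d / 2 & rho <= q / 2].
  exists (Num.min p (Num.min (d / 2) (q / 2))).
  by rewrite !lt_min p0 !divr_gt0 // !ge_min !lexx !orbT.
have Qrho w : csquare z1 rho w -> csquare c r w by move=> /(csquareW rhop); exact: Hp.
have F2 u v : csquare z1 rho u -> csquare z1 rho v -> cnorm (F u - F v) <= 2.
  have F1 w : csquare z1 rho w -> cnorm (F w - F z1) <= 1.
    move=> /(csquareW rhod) /csquare_ball /Hd.
    by have -> : z1 + (w - z1) = w by ring.
  move=> /F1 h1 /F1 h2; have := cnorm_trans (F u) (F z1) (F v).
  by rewrite [cnorm (F z1 - _)]cnormBC; lra.
have n0 : 0 <= N%:R :> R by [].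
have cross t x : P t -> csquare z1 rho t ->
   (csquare z1 rho (t + x%:C) -> cnorm (F (t + x%:C) - F t) <= N%:R * `|x|) /\
   (csquare z1 rho (t + (0 +i* x)) -> cnorm (F (t + (0 +i* x)) - F t) <= N%:R * `|x|).
  move=> Pt Qt; have Et := EPq t Pt (csquareW rhop Qt).
  split=> Qx.
    have xs : `|x| <= q.
      case: Qt Qx => [/ltr_normlP[t1 t2] _] [/ltr_normlP[+ +] _].
      have -> : Re (t + x%:C) = Re t + x by case: (t).
      move=> y1 y2; rewrite ler_norml; clear -t1 t2 y1 y2 rhoq; apply/andP; split; lra.
    by have [h _] := Et x xs; apply: h; exact: Qrho.
  have xs : `|x| <= q.
    case: Qt Qx => [_ /ltr_normlP[t1 t2]] [_ /ltr_normlP[+ +]].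
    have -> : Im (t + (0 +i* x)) = Im t + x by case: (t).
    by move=> y1 y2; rewrite ler_norml; clear -t1 t2 y1 y2 rhoq; apply/andP; split; lra.
  by have [_ h] := Et x xs; apply: h; exact: Qrho.
have PP t u : P t -> P u -> csquare z1 rho t -> csquare z1 rho u ->
    cnorm (F u - F t) <= 2 * N%:R * cnorm (u - t).
  move=> Pt Pu Qt Qu; pose o : C := Re u +i* Im t.
  have Qq : csquare z1 rho o by split; [case: Qu|case: Qt].
  have q1 : o = t + (Re u - Re t)%:C.
    by rewrite /o; case: (t) (u) => [? ?] [? ?] /=; apply/eqP; rewrite eq_complex /=; apply/andP; split; apply/eqP; ring.
  have q2 : o = u + (0 +i* (Im t - Im u)).
    by rewrite /o; case: (t) (u) => [? ?] [? ?] /=; apply/eqP; rewrite eq_complex /=; apply/andP; split; apply/eqP; ring.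
  have [h1 _] := cross t (Re u - Re t) Pt Qt; have [_ h2] := cross u (Im t - Im u) Pu Qu.
  rewrite -q1 in h1; rewrite -q2 in h2; have {}h1 := h1 Qq; have {}h2 := h2 Qq.
  have e1 : `|Re u - Re t| <= cnorm (u - t).
    have -> : Re u - Re t = Re (u - t) by case: (t) (u) => [? ?] [? ?].
    exact: normr_Re.
  have e2 : `|Im t - Im u| <= cnorm (u - t).
    rewrite distrC; have -> : Im u - Im t = Im (u - t) by case: (t) (u) => [? ?] [? ?].
    exact: normr_Im.
  have h3 := cnorm_trans (F u) (F o) (F t); rewrite [cnorm (F u - F o)]cnormBC in h3.
  have := ler_wpM2l n0 e1; have := ler_wpM2l n0 e2; lra.
(* [2 * N] covers quotients between points of [P] and along crosses; [8 / rho] is the oscillation 2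
   over the distance [rho / 4] to the far edges. *)
pose M : R := 2 * N%:R + 8 / rho.
have e8 : 0 <= 8 / rho by apply: divr_ge0 => //; exact: ltW.
have e4 : 0 <= rho / 4 by apply: divr_ge0 => //; exact: ltW.
have M8 : 8 / rho <= M by rewrite /M lerDr mulr_ge0.
have M2 : 2 * N%:R <= M by rewrite /M lerDl.
have edge_far u t w : csquare z1 rho u -> csquare z1 rho t -> rho / 4 <= cnorm w ->
    cnorm (F u - F t) <= M * cnorm w.
  move=> Qu Qt hw; apply: le_trans (F2 _ _ Qu Qt) _.
  have -> : 2 = 8 / rho * (rho / 4) by field; rewrite gt_eqF.
  exact: ler_pM.
have NM2 w : 2 * N%:R * cnorm w <= M * cnorm w by rewrite ler_wpM2r ?cnorm_ge0.
have NM w : N%:R * cnorm w <= M * cnorm w.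
  by apply: le_trans (NM2 w); rewrite ler_wpM2r ?cnorm_ge0 // ler_peMl // ler1n.
have reB u v : Re (u - v) = Re u - Re v by case: (u) (v) => [? ?] [? ?].
have imB u v : Im (u - v) = Im u - Im v by case: (u) (v) => [? ?] [? ?].
(* Meant for a half-square with [t] on a vertical edge and the pole [s] just outside. The bound is
   known at points of [P] by [PP], on the edge through [t] by [cross] and on the other edges by
   [edge_far]; [F] is holomorphic around the remaining points. *)
have half t (s : C) (al be : R) : P t -> csquare z1 (rho / 4) t ->
    let K := crect al be (Im z1 - rho / 2) (Im z1 + rho / 2) in
    (forall w, K w -> w != s /\ cnorm (w - t) <= cnorm (w - s)) ->
    (forall w, K w -> csquare z1 rho w) ->
    (forall w, K w -> [\/ al < Re w < be, Re w = Re t | rho / 4 <= cnorm (w - t)]) ->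
    forall w, K w -> cnorm (F w - F t) <= M * cnorm (w - s).
  move=> Pt Qt4 K Ks KQ Kedge.
  have Qt : csquare z1 rho t by apply: csquareW Qt4; lra.
  have Mts w : K w -> M * cnorm (w - t) <= M * cnorm (w - s).
    by move=> /Ks[_ h]; rewrite ler_wpM2l // (le_trans e8).
  apply: (@dquot_rect_bound _ _ _ _ _ F D s (F t) M).
  - by move=> w /KQ /Qrho; exact: cF.
  - by move=> /Ks[]; rewrite eqxx.
  - move=> w Kw; have [ws _] := Ks w Kw; have Qw := KQ w Kw.
    have [Pw|nPw] := pselect (P w).
      left; split=> //; apply: le_trans (Mts w Kw); apply: le_trans (NM2 _).
      exact: PP.
    have [wr|wt|wf] := Kedge w Kw; last 2 first.
    + left; split=> //; apply: le_trans (Mts w Kw); apply: le_trans (NM _).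
      have wE : w = t + (0 +i* (Im w - Im t)).
        move: wt; case: (w) (t) => [? ?] [? ?] /= ->.
        by apply/eqP; rewrite eq_complex /=; apply/andP; split; apply/eqP; ring.
      have [_ h] := cross t (Im w - Im t) Pt Qt; rewrite -wE in h.
      apply: le_trans (h Qw) _; rewrite ler_wpM2l //.
      by rewrite -imB normr_Im.
    + left; split=> //; apply: le_trans (Mts w Kw); exact: edge_far.
    + case: Kw (Kw) => _ /andP[i1 i2] Kw.
      have [wi|wi] := boolP (Im z1 - rho / 2 < Im w < Im z1 + rho / 2).
        by right; split => //; exact: hol (Qrho _ Qw) nPw.
      left; split=> //; apply: le_trans (Mts w Kw); apply: edge_far => //.
      apply: le_trans (normr_Im _); rewrite imB.
      case: Qt4 => _ /ltr_normlP[j1 j2]; rewrite ler_normr.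
      apply/orP; move: wi; clear -j1 j2 rho0; rewrite negb_and -!leNgt => /orP[wi|wi];
        [right|left]; lra.
(* The quotient with pole [t] may be discontinuous at [t], so the pole is moved out of the
   half-square by [dl]. On the half-square this does not bring the pole closer, so bounds relative
   to [t] remain valid; [dl] is arbitrary. *)
have claimA t z : P t -> csquare z1 (rho / 4) t -> csquare z1 (rho / 2) z ->
    cnorm (F z - F t) <= M * cnorm (z - t).
  move=> Pt Qt Qz; have M0 : 0 <= M by apply: le_trans M8.
  suff H dl : 0 < dl -> cnorm (F z - F t) <= M * (cnorm (z - t) + dl).
    apply/ler_addgt0Pr => e e0; have M1 : 0 < M + 1 by lra.
    apply: le_trans (H (e / (M + 1)) (divr_gt0 e0 M1)) _.
    by rewrite mulrDr lerD2l mulrCA ger_pMr // ler_pdivrMr //; clear; lra.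
  move=> dl0; have dn : cnorm dl%:C = dl by rewrite cnorm_real gtr0_norm.
  have [[/ltr_normlP[a1 a2] /ltr_normlP[a3 a4]] [/ltr_normlP[b1 b2] /ltr_normlP[b3 b4]]] := (Qt, Qz).
  have far w : rho / 4 <= `|Re w - Re t| -> rho / 4 <= cnorm (w - t).
    by move=> /le_trans; apply; rewrite -reB normr_Re.
  have [tz|zt] := lerP (Re t) (Re z).
  - have h := @half t (t - dl%:C) (Re t) (Re z1 + rho / 2) Pt Qt.
    apply: le_trans (h _ _ _ z _) _.
    + move=> w [/andP[w1 w2] _].
      have ew : w - (t - dl%:C) = (w - t) + dl%:C by ring.
      have ed : Re (w - (t - dl%:C)) = Re w - Re t + dl.
        by rewrite ew; case: (w) (t) => [? ?] [? ?].
      split.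
        rewrite -subr_eq0; apply: contraTneq isT => w0; move: ed; rewrite w0 /= => ed.
        by exfalso; clear -ed w1 w2 dl0; lra.
      apply: cnorm_le_ReIm; first by rewrite ed reB !ger0_norm; clear -w1 dl0; lra.
      by rewrite ew; case: (w) (t) => [? ?] [? ?] /=; rewrite addr0.
    + move=> w [/andP[w1 w2] /andP[w3 w4]]; apply/csquareP.
      by clear -w1 w2 w3 w4 a1 a2 rho0; split; lra.
    + move=> w [/andP[w1 w2] _].
      move: w1; rewrite le_eqVlt => /predU1P[->|w1]; first by apply: Or32.
      move: w2; rewrite le_eqVlt => /predU1P[w2|w2]; last by apply: Or31; rewrite w1.
      by apply: Or33; apply: far; rewrite ler_normr; apply/orP; left; clear -a1 a2 w2; lra.
    + by clear -tz b1 b2 b3 b4 rho0; split; apply/andP; split; lra.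
    + rewrite ler_wpM2l //; have -> : z - (t - dl%:C) = (z - t) + dl%:C by ring.
      by apply: le_trans (cnormD _ _) _; rewrite dn.
  - have h := @half t (t + dl%:C) (Re z1 - rho / 2) (Re t) Pt Qt.
    apply: le_trans (h _ _ _ z _) _.
    + move=> w [/andP[w1 w2] _].
      have ew : w - (t + dl%:C) = (w - t) - dl%:C by ring.
      have ed : Re (w - (t + dl%:C)) = Re w - Re t - dl.
        by rewrite ew; case: (w) (t) => [? ?] [? ?].
      split.
        rewrite -subr_eq0; apply: contraTneq isT => w0; move: ed; rewrite w0 /= => ed.
        by exfalso; clear -ed w1 w2 dl0; lra.
      apply: cnorm_le_ReIm; first by rewrite ed reB !ler0_norm; clear -w2 dl0; lra.
      by rewrite ew; case: (w) (t) => [? ?] [? ?] /=; rewrite subr0.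
    + move=> w [/andP[w1 w2] /andP[w3 w4]]; apply/csquareP.
      by clear -w1 w2 w3 w4 a1 a2 rho0; split; lra.
    + move=> w [/andP[w1 w2] _].
      move: w2; rewrite le_eqVlt => /predU1P[->|w2]; first by apply: Or32.
      move: w1; rewrite le_eqVlt => /predU1P[w1|w1]; last by apply: Or31; rewrite w1.
      by apply: Or33; apply: far; rewrite ler_normr; apply/orP; right; clear -a1 a2 w1; lra.
    + by clear -zt b1 b2 b3 b4 rho0; split; apply/andP; split; lra.
    + rewrite ler_wpM2l //; have -> : z - (t + dl%:C) = (z - t) - dl%:C by ring.
      by apply: le_trans (cnormB _ _) _; rewrite dn.
(* For [u] outside [P] the pole [u] is interior and removable, and points of [P] in the rectangle
   are handled by [claimA] applied at those points. The boundary is at distance at least [rho / 16]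
   from [u], and [32 / rho] is the oscillation 2 over this distance. *)
have claimB u v : csquare z1 (rho / 16) u -> csquare z1 (rho / 8) v ->
    cnorm (F v - F u) <= (M + 32 / rho) * cnorm (v - u).
  move=> Qu Qv; have e32 : 0 <= 32 / rho by apply: divr_ge0 => //; exact: ltW.
  have MM w : M * cnorm w <= (M + 32 / rho) * cnorm w.
    by rewrite ler_wpM2r ?cnorm_ge0 // lerDl.
  have Qu2 : csquare z1 (rho / 2) u by apply: csquareW Qu; clear -rho0; lra.
  have [Pu|nPu] := pselect (P u).
    apply: le_trans (MM _); apply: claimA => //; first by apply: csquareW Qu; clear -rho0; lra.
    by apply: csquareW Qv; clear -rho0; lra.
  have Qur : csquare z1 rho u by apply: csquareW Qu; clear -rho0; lra.
  have [/ltr_normlP[u1 u2] /ltr_normlP[u3 u4]] := Qu.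
  have [/ltr_normlP[v1 v2] /ltr_normlP[v3 v4]] := Qv.
  pose K := crect (Re z1 - rho / 8) (Re z1 + rho / 8) (Im z1 - rho / 8) (Im z1 + rho / 8).
  have K4 w : K w -> csquare z1 (rho / 4) w.
    move=> [/andP[w1 w2] /andP[w3 w4]]; apply/csquareP.
    by clear -w1 w2 w3 w4 rho0; split; lra.
  have K1 w : K w -> csquare z1 rho w by move=> /K4; apply: csquareW; clear -rho0; lra.
  apply: (@dquot_rect_bound _ (Re z1 - rho / 8) (Re z1 + rho / 8)
    (Im z1 - rho / 8) (Im z1 + rho / 8) F D u (F u) (M + 32 / rho)).
  - by move=> w /K1 /Qrho; exact: cF.
  - by [].
  - move=> w Kw; have [wu|wu] := eqVneq w u.
      right; rewrite wu; split; last exact: hol (Qrho _ Qur) nPu.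
        by clear -u1 u2 rho0; lra.
      by clear -u3 u4 rho0; lra.
    have [Pw|nPw] := pselect (P w).
      left; split => //; apply: le_trans (MM _); rewrite cnormBC [cnorm (w - u)]cnormBC.
      by apply: claimA => //; exact: K4.
    have far : rho / 16 <= cnorm (w - u) ->
        cnorm (F w - F u) <= (M + 32 / rho) * cnorm (w - u).
      move=> hw; apply: le_trans (F2 _ _ (K1 _ Kw) Qur) _.
      have -> : 2 = 32 / rho * (rho / 16) by field; rewrite gt_eqF.
      apply: ler_pM => //; first by apply: divr_ge0 => //; exact: ltW.
      by rewrite lerDr (le_trans e8).
    have [/andP[w1 w2] /andP[w3 w4]] := Kw.
    have [wr|wr] := boolP (Re z1 - rho / 8 < Re w < Re z1 + rho / 8); last first.
      left; split=> //; apply: far; apply: le_trans (normr_Re _); rewrite reB ler_normr.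
      by apply/orP; move: wr; rewrite negb_and -!leNgt => /orP[wr|wr]; clear -wr u1 u2;
        [right|left]; lra.
    have [wi|wi] := boolP (Im z1 - rho / 8 < Im w < Im z1 + rho / 8); last first.
      left; split=> //; apply: far; apply: le_trans (normr_Im _); rewrite imB ler_normr.
      by apply/orP; move: wi; rewrite negb_and -!leNgt => /orP[wi|wi]; clear -wi u3 u4;
        [right|left]; lra.
    by right; split => //; exact: hol (Qrho _ (K1 _ Kw)) nPw.
  - by clear -v1 v2 v3 v4; split; apply/andP; split; lra.
apply: nl1; exists (rho / 16), (M + 32 / rho); split; first by rewrite divr_gt0.
move=> u v /ball_csquare Qu /ball_csquare Qv; apply: claimB => //.
by apply: csquareW Qu; clear -rho0; lra.
Qed.

Lemma gateaux_bounded_hol F D c r : 0 < r -> (forall z, csquare c r z -> ccont F z) ->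
  (forall z, csquare c r z -> cgateaux F z (D z)) ->
  exists s L, 0 < s /\ bounded_hol F D c s L.
Proof.
move=> r0 cF gF; apply: (lip_at_bounded_hol r0 gF).
exact: gateaux_lip_at cF gF _ (csquare_center c r0).
Qed.

End GateauxGoursat.

(** * The Cartan basis *)

Section CartanAlgebra.
Variables (R : realType) (m n : nat) (A : falgType R[i]) (I : n.-tuple A).
Hypothesis hI : cartan_basis m I.
Implicit Types (a b h : A) (j k r s : 'I_n).

Let freeI : free I. Proof. exact: basis_free (cartan_basisP hI). Qed.

Lemma mulAC a b : a * b = b * a. Proof. exact: cartan_mulC hI a b. Qed.

Lemma coord_tnth j k : coord I j (tnth I k) = (j == k)%:R.
Proof. by rewrite (tnth_nth 0) coord_free // eq_sym. Qed.

Lemma coord_sum_basis a : a = \sum_k coord I k a *: tnth I k.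
Proof.
rewrite {1}(coord_basis (cartan_basisP hI) (memvf a)).
by apply: eq_bigr => k _; rewrite (tnth_nth 0).
Qed.

Lemma coord_inj a b : (forall k, coord I k a = coord I k b) -> a = b.
Proof.
by move=> ab; rewrite [a]coord_sum_basis [b]coord_sum_basis; apply: eq_bigr => k _; rewrite ab.
Qed.

(** The multiplication table is triangular: [I_r * I_k] is [I_k] if [r = u] and 0 otherwise, up to
    terms of index larger than [k]. Idempotents and nilpotents are treated at once, with [u = k] for
    the former. *)
Lemma idempotent_index_ex k : exists u : 'I_n, [/\ (u < m)%N,
  (forall r j, (j <= k)%N ->
     coord I j (tnth I r * tnth I k) = ((j == k) && (r == u))%:R) &
  tnth I u * tnth I k = tnth I k].
Proof.
have [km|mk] := ltnP k m.
  exists k; split => //; last by rewrite (cartan_idem hI) // eqxx.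
  move=> r j jk; have [rm|mr] := ltnP r m.
    rewrite (cartan_idem hI) //; have [->|rk] := eqVneq r k.
      by rewrite coord_tnth andbT.
    by rewrite linear0 andbF.
  have jr : j != r by rewrite -val_eqE /= neq_ltn (leq_ltn_trans jk (leq_trans km mr)).
  have rk : (r == k) = false.
    by apply/negbTE; rewrite -val_eqE /= neq_ltn (leq_trans km mr) orbT.
  have [u [[um Hu] _]] := cartan_mixed hI mr.
  rewrite mulAC Hu // rk andbF; case: eqP => _; last by rewrite linear0.
  by rewrite coord_tnth (negbTE jr).
have [u [[um Hu] _]] := cartan_mixed hI mk.
exists u; split => //; last by rewrite Hu // eqxx.
move=> r j jk; have [rm|mr] := ltnP r m.
  rewrite Hu //; case: eqP => _; first by rewrite coord_tnth andbT.
  by rewrite linear0 andbF.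
have [Y HY] := cartan_nilp hI.
have ru : (r == u) = false.
  by apply/negbTE; rewrite -val_eqE /= neq_ltn (leq_trans um mr) orbT.
rewrite HY // ru andbF linear_sum big1 // => l; rewrite gtn_max => /andP[_ kl].
rewrite linearZ /= coord_tnth; have -> : (j == l) = false; last by rewrite /= mulr0.
by apply/negbTE; rewrite -val_eqE /= neq_ltn (leq_ltn_trans jk kl).
Qed.

(* The index u_k of the Cartan basis, extended by u_k = k when k < m. *)
Definition idem_index k : 'I_n := xget k [set u : 'I_n | [/\ (u < m)%N,
  (forall r j, (j <= k)%N ->
     coord I j (tnth I r * tnth I k) = ((j == k) && (r == u))%:R) &
  tnth I u * tnth I k = tnth I k]].

Lemma idem_indexP k : [/\ (idem_index k < m)%N,
  (forall r j, (j <= k)%N ->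
     coord I j (tnth I r * tnth I k) = ((j == k) && (r == idem_index k))%:R) &
  tnth I (idem_index k) * tnth I k = tnth I k].
Proof.
have [u Hu] := idempotent_index_ex k.
by rewrite /idem_index; case: xgetP => [v _ //|/(_ u)]; case.
Qed.

Lemma coord_mul_basis h k j : (j <= k)%N ->
  coord I j (h * tnth I k) = (j == k)%:R * coord I (idem_index k) h.
Proof.
move=> jk; have [_ H _] := idem_indexP k.
rewrite {1}[h]coord_sum_basis mulr_suml linear_sum /= (bigD1 (idem_index k)) //=.
rewrite big1 ?addr0 => [|r rk]; last first.
  by rewrite -scalerAl linearZ /= H // (negbTE rk) andbF mulr0.
by rewrite -scalerAl linearZ /= H // eqxx andbT mulrC.
Qed.

(** A descending chain of ideals, from the whole algebra at [i = 0] down to zero at [i = n]. *)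
Definition order_ge (i : nat) a := forall j, (j < i)%N -> coord I j a = 0.

(** On the quotient of two consecutive ideals the algebra acts through one functional, so leading
    coordinates multiply like complex numbers. *)
Lemma coord_mul_order h a k : order_ge k a ->
  coord I k (h * a) = coord I (idem_index k) h * coord I k a.
Proof.
move=> ka; rewrite {1}[a]coord_sum_basis mulr_sumr linear_sum /= (bigD1 k) //=.
rewrite -scalerAr linearZ /= coord_mul_basis // eqxx mul1r big1 ?addr0; first by rewrite mulrC.
move=> j jk; have [jk'|kj] := ltnP j k.
  by rewrite ka // scale0r mulr0 linear0.
rewrite -scalerAr linearZ /= coord_mul_basis //.
by rewrite eq_sym (negbTE jk) mul0r mulr0.
Qed.

Lemma order_geM i h a : order_ge i a -> order_ge i (h * a).
Proof.
move=> ia j ji; rewrite coord_mul_order ?ia ?mulr0 // => l lj.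
by apply: ia; exact: ltn_trans lj ji.
Qed.

Lemma order_ge_basis k : order_ge k (tnth I k).
Proof. by move=> j jk; rewrite coord_tnth -val_eqE /= ltn_eqF. Qed.

Lemma order_ge_full a : order_ge n a -> a = 0.
Proof. by move=> na; apply: coord_inj => k; rewrite na // linear0. Qed.

Lemma coord_one (u : 'I_n) : (u < m)%N -> coord I u 1 = 1.
Proof.
move=> um; rewrite [X in coord _ _ X](cartan_unit hI) linear_sum /= (bigD1 u) //=.
rewrite coord_tnth eqxx big1 ?addr0 // => j /andP[_ ju].
by rewrite coord_tnth eq_sym (negbTE ju).
Qed.

(** The coordinate of index [i] disappears for one of two reasons: its functional is [f_u], which
    kills [b], or it is another one, and then the coordinate of [a = I_u * a] is already zero. *)
Lemma order_geS_nilpotent (u : 'I_n) i b a : (u < m)%N -> coord I u b = 0 -> tnth I u * a = a ->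
  order_ge i a -> order_ge i.+1 (b * a).
Proof.
move=> um bu ua ia j; rewrite ltnS leq_eqVlt => /orP[/eqP ji|ji]; last by have := @order_geM i b a ia j ji.
have ja : order_ge j a by rewrite ji.
rewrite coord_mul_order //; have [->|su] := eqVneq (idem_index j) u.
  by rewrite bu mul0r.
rewrite -ua coord_mul_order // coord_tnth (negbTE su) mul0r.
by rewrite mulr0.
Qed.

Lemma order_ge_nilpotentX k b i : coord I (idem_index k) b = 0 ->
  order_ge (k + i) (b ^+ i * tnth I k) /\
  tnth I (idem_index k) * (b ^+ i * tnth I k) = b ^+ i * tnth I k.
Proof.
move=> b0; have [um _ uk] := idem_indexP k.
elim: i => [|i [IH1 IH2]].
  by rewrite addn0 expr0 mul1r; split => //; exact: order_ge_basis.
rewrite exprS -mulrA; split; first by rewrite addnS; exact: (order_geS_nilpotent um b0 IH2 IH1).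
by rewrite mulrA [tnth I _ * b]mulAC -mulrA IH2.
Qed.

Lemma nilpotentX_eq0 k b : coord I (idem_index k) b = 0 -> b ^+ n * tnth I k = 0.
Proof.
move=> /(@order_ge_nilpotentX k b n)[h _]; apply: order_ge_full => j jn.
by apply: h; rewrite (leq_trans jn) // leq_addl.
Qed.

(** The sum norm of the coordinates. It is submultiplicative up to [mul_bound] and induces the
    topology of [algtop I]. *)
Definition anorm a : R := \sum_k cnorm (coord I k a).

Lemma anorm_ge0 a : 0 <= anorm a.
Proof. by apply: sumr_ge0 => k _; exact: cnorm_ge0. Qed.

Lemma anorm0 : anorm 0 = 0.
Proof. by rewrite /anorm big1 // => k _; rewrite linear0 cnorm0. Qed.

Lemma anormD a b : anorm (a + b) <= anorm a + anorm b.
Proof.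
rewrite /anorm -big_split /=; apply: ler_sum => k _.
by rewrite linearD; exact: cnormD.
Qed.

Lemma anormZ (c : R[i]) a : anorm (c *: a) = cnorm c * anorm a.
Proof.
by rewrite /anorm mulr_sumr; apply: eq_bigr => k _; rewrite linearZ /= cnormM.
Qed.

Lemma anormN a : anorm (- a) = anorm a.
Proof. by rewrite -scaleN1r anormZ cnormN cnorm1 mul1r. Qed.

Lemma cnorm_coord_le k a : cnorm (coord I k a) <= anorm a.
Proof.
rewrite /anorm (bigD1 k) //= lerDl; apply: sumr_ge0 => j _; exact: cnorm_ge0.
Qed.

Lemma anorm_sum (T : Type) (s : seq T) (P : pred T) (F : T -> A) :
  anorm (\sum_(i <- s | P i) F i) <= \sum_(i <- s | P i) anorm (F i).
Proof.
elim/big_ind2: _ => [|x1 x2 y1 y2 h1 h2|//]; first by rewrite anorm0.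
by apply: le_trans (anormD _ _) _; exact: lerD.
Qed.

Definition mul_bound : R := \sum_j \sum_k anorm (tnth I j * tnth I k).

Lemma mul_bound_ge0 : 0 <= mul_bound.
Proof. by do 2!(apply: sumr_ge0 => ? _); exact: anorm_ge0. Qed.

Lemma anormM a b : anorm (a * b) <= mul_bound * anorm a * anorm b.
Proof.
rewrite {1}[a]coord_sum_basis {1}[b]coord_sum_basis mulr_suml.
apply: le_trans (anorm_sum _ _ _) _; rewrite !mulr_suml; apply: ler_sum => j _.
rewrite mulr_sumr; apply: le_trans (anorm_sum _ _ _) _; rewrite !mulr_suml; apply: ler_sum => k _.
rewrite -scalerAl -scalerAr !anormZ mulrA -[leRHS]mulrA [leRHS]mulrC.
by rewrite ler_wpM2r ?anorm_ge0 // ler_pM ?cnorm_ge0 ?cnorm_coord_le.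
Qed.

End CartanAlgebra.

(** * Functions of three real variables with values in the algebra *)

Section FrechetDerivative.
Variables (R : realType) (m n : nat) (A : falgType R[i]) (I : n.-tuple A).
Hypothesis hI : cartan_basis m I.
Variables e2 e3 : A.
Local Notation C := R[i].
Local Notation V := 'rV[R]_3.
Local Notation an := (anorm I).
Local Notation ze := (zeta e2 e3).
Implicit Types (p q v w : V) (a b : A) (f g : V -> A) (L : V -> A) (x e d : R).

(** Commutativity of [A] is only a hypothesis, so identities are checked in coordinates, where
    [ring] applies. *)
Local Ltac abel := apply: (coord_inj hI) => k;
  rewrite ?(linearB, linearD, linearN, linear0) /=; ring.

Lemma zetaD p q : ze (p + q) = ze p + ze q.
Proof. by rewrite /zeta !mxE !rmorphD !scalerDl; abel. Qed.

Lemma zetaZ x p : ze (x *: p) = x%:C *: ze p.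
Proof. by rewrite /zeta !mxE !rmorphM !scalerDr !scalerA. Qed.

Lemma zetaN p : ze (- p) = - ze p.
Proof. by rewrite -scaleN1r zetaZ rmorphN rmorph1 scaleN1r. Qed.

Lemma normr_rV (i : 'I_3) v : `|v 0 i| <= `|v|.
Proof.
rewrite [leRHS]/Num.norm /= mx_normrE.
exact: (le_bigmax 0 (fun ij : 'I_1 * 'I_3 => `|v ij.1 ij.2|) (0, i)).
Qed.

Definition zeta_bound : R := an 1 + an e2 + an e3.

Lemma zeta_bound_ge0 : 0 <= zeta_bound.
Proof. by rewrite !addr_ge0 // anorm_ge0. Qed.

Lemma anorm_zeta v : an (ze v) <= zeta_bound * `|v|.
Proof.
rewrite /zeta; apply: le_trans (anormD _ _ _) _.
apply: le_trans (lerD (anormD _ _ _) (lexx _)) _.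
rewrite !anormZ !cnorm_real /zeta_bound !mulrDl.
by rewrite !lerD // mulrC ler_wpM2l ?anorm_ge0 ?normr_rV.
Qed.

(** Frechet differentiability, under which products and compositions can be differentiated, as the
    principal extensions require; the directional form follows by [fderiv_agateaux]. Of the
    differential only a bound is recorded, on which continuity and the product rule rest. *)
Definition fderiv f p L :=
  (exists B, forall v, an (L v) <= B * `|v|) /\
  forall e, 0 < e -> exists2 d, 0 < d &
    forall v, `|v| < d -> an (f (p + v) - f p - L v) <= e * `|v|.

Lemma fderiv_cst a p : fderiv (fun=> a) p (fun=> 0).
Proof.
split; first by exists 0 => v; rewrite anorm0 mul0r.
move=> e e0; exists 1 => // v _; rewrite subrr subr0 anorm0 mulr_ge0 // ltW //.
Qed.

Lemma fderivD f g p L L' : fderiv f p L -> fderiv g p L' ->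
  fderiv (fun q => f q + g q) p (fun v => L v + L' v).
Proof.
move=> [[B HB] df] [[B' HB'] dg]; split.
  exists (B + B') => v; apply: le_trans (anormD _ _ _) _.
  by rewrite mulrDl lerD.
move=> e e0; have e2' : 0 < e / 2 by rewrite divr_gt0.
have [d d0 Hd] := df _ e2'; have [d' d0' Hd'] := dg _ e2'.
exists (Num.min d d') => [|v]; first by rewrite lt_min d0.
rewrite lt_min => /andP[/Hd h1 /Hd' h2].
have -> : f (p + v) + g (p + v) - (f p + g p) - (L v + L' v) =
  (f (p + v) - f p - L v) + (g (p + v) - g p - L' v) by abel.
by apply: le_trans (anormD _ _ _) _; lra.
Qed.

Lemma fderiv_additive f p B : (forall p q, f (p + q) = f p + f q) ->
  (forall v, an (f v) <= B * `|v|) -> fderiv f p f.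
Proof.
move=> fD fB; split; first by exists B.
move=> e e0; exists 1 => // v _.
have -> : f (p + v) - f p - f v = 0 by rewrite fD; abel.
by rewrite anorm0 mulr_ge0 // ltW.
Qed.

Lemma fderiv_near f g p L r : 0 < r -> (forall q, `|q - p| < r -> f q = g q) ->
  fderiv f p L -> fderiv g p L.
Proof.
move=> r0 fg [bL df]; split=> // e /df[d d0 Hd].
exists (Num.min d r) => [|v]; first by rewrite lt_min d0.
rewrite lt_min => /andP[/Hd h vr]; rewrite -!fg //.
  by rewrite subrr normr0.
by rewrite addrC addKr.
Qed.

Definition fcont f p := forall e, 0 < e ->
  exists2 d, 0 < d & forall v, `|v| < d -> an (f (p + v) - f p) <= e.

Lemma fderiv_fcont f p L : fderiv f p L -> fcont f p.
Proof.
move=> [[B HB] df] e e0; have [d d0 Hd] := df 1 ltr01.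
pose K := `|B| + 1; have K0 : 0 < K by rewrite ltr_wpDl.
exists (Num.min d (e / (K + 1))) => [|v].
  by rewrite lt_min d0 divr_gt0 // ltr_pwDl.
rewrite lt_min ltr_pdivlMr; last by rewrite ltr_pwDl.
move=> /andP[/Hd h1 h2].
have h3 := anormD I (f (p + v) - f p - L v) (L v); rewrite subrK in h3.
have h4 := HB v; have h5 : B * `|v| <= `|B| * `|v| by rewrite ler_wpM2r // ler_norm.
apply: le_trans h3 _; have := normr_ge0 v; rewrite /K in h2 *; lra.
Qed.

Lemma fderivM f g p L L' : fderiv f p L -> fderiv g p L' ->
  fderiv (fun q => f q * g q) p (fun v => L v * g p + f p * L' v).
Proof.
move=> hf hg; have cg := fderiv_fcont hg.
have [[B0 HB0] df] := hf; have [[B0' HB0'] dg] := hg.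
pose M := mul_bound I; have M0 : 0 <= M := mul_bound_ge0 I.
pose B := `|B0|; pose B' := `|B0'|.
have HB v : an (L v) <= B * `|v|.
  by apply: le_trans (HB0 v) _; rewrite ler_wpM2r // ler_norm.
have HB' v : an (L' v) <= B' * `|v|.
  by apply: le_trans (HB0' v) _; rewrite ler_wpM2r // ler_norm.
have Bp : 0 <= B by exact: normr_ge0.
have Bp' : 0 <= B' by exact: normr_ge0.
have gp := anorm_ge0 I (g p); have fp := anorm_ge0 I (f p).
have anM a b c c' : an a <= c -> an b <= c' -> an (a * b) <= M * c * c'.
  move=> ac bc; apply: le_trans (anormM hI _ _) _.
  apply: ler_pM => //; rewrite ?mulr_ge0 ?anorm_ge0 //.
  by rewrite ler_wpM2l.
split.
  exists (M * B * an (g p) + M * an (f p) * B') => v.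
  apply: le_trans (anormD _ _ _) _; rewrite mulrDl; apply: lerD.
    have -> : M * B * an (g p) * `|v| = M * (B * `|v|) * an (g p) by ring.
    exact: anM.
  by rewrite -[M * _ * _ * _]mulrA; apply: anM.
move=> e e0.
pose K := M * (an (g p) + 1) + M * (an (f p) + B) + M * B * B' + 1.
have K0 : 0 < K.
  by rewrite ltr_wpDl // !addr_ge0 // !mulr_ge0 // addr_ge0.
have eK : 0 < e / K by rewrite divr_gt0.
have [d1 d10 H1] := df _ eK; have [d2 d20 H2] := dg _ eK.
have [d3 d30 H3] := cg 1 ltr01.
exists (Num.min (Num.min d1 d2) (Num.min (Num.min d3 1) (e / K))) => [|v].
  by rewrite !lt_min d10 d20 d30 ltr01.
rewrite !lt_min => /andP[/andP[/H1 h1 /H2 h2] /andP[/andP[/H3 h3 v1] vK]].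
set r := f (p + v) - f p - L v in h1.
set s := g (p + v) - g p - L' v in h2.
have -> : f (p + v) * g (p + v) - f p * g p - (L v * g p + f p * L' v) =
   r * g (p + v) + (f p + L v) * s + L v * L' v.
  by rewrite /r /s !mulrBl !mulrDl !mulrBr; abel.
have v0 := normr_ge0 v.
have g1 : an (g (p + v)) <= an (g p) + 1.
  by have := anormD I (g (p + v) - g p) (g p); rewrite subrK; lra.
have f1 : an (f p + L v) <= an (f p) + B.
  apply: le_trans (anormD _ _ _) _; rewrite lerD2l; apply: le_trans (HB v) _.
  by rewrite ler_piMr // ltW.
apply: le_trans (anormD _ _ _) _; apply: le_trans (lerD (anormD _ _ _) (lexx _)) _.
apply: le_trans (lerD (lerD (anM _ _ _ _ h1 g1) (anM _ _ _ _ f1 h2)) (anM _ _ _ _ (HB v) (HB' v))) _.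
have : M * B * B' * `|v| * `|v| <= M * B * B' * `|v| * (e / K).
  by rewrite ler_wpM2l ?mulr_ge0 // ltW.
have -> : e * `|v| = e / K * `|v| * K by field; rewrite gt_eqF.
have : 0 <= e / K * `|v| by rewrite mulr_ge0 // ltW.
rewrite /K; lra.
Qed.

Lemma fderiv_eqL f p L L' : L =1 L' -> fderiv f p L -> fderiv f p L'.
Proof. by move=> /funext ->. Qed.

Lemma fderiv_sum (N : nat) (F : nat -> V -> A) p (L : nat -> V -> A) :
  (forall j, (j < N)%N -> fderiv (F j) p (L j)) ->
  fderiv (fun q => \sum_(j < N) F j q) p (fun v => \sum_(j < N) L j v).
Proof.
elim: N => [|N IH] H.
  under eq_fun do rewrite big_ord0; under [X in fderiv _ _ X]eq_fun do rewrite big_ord0.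
  exact: fderiv_cst.
under eq_fun do rewrite big_ord_recr /=; under [X in fderiv _ _ X]eq_fun do rewrite big_ord_recr /=.
by apply: fderivD; [apply: IH => j jN; apply: H; exact: ltnW|exact: H].
Qed.

Lemma fderivX f p L (i : nat) : fderiv f p L ->
  fderiv (fun q => f q ^+ i) p (fun v => f p ^+ i.-1 * L v *+ i).
Proof.
move=> df; elim: i => [|i IH].
  by apply: fderiv_eqL (fderiv_cst 1 p) => v; rewrite mulr0n.
under eq_fun do rewrite exprS.
apply: fderiv_eqL (fderivM df IH) => v /=.
case: i {IH} => [|i]; first by rewrite !expr0 mulr0n mulr0 addr0 mulr1 mul1r.
rewrite /= mulrnAr mulrA -exprS (mulAC hI (L v)).
by rewrite [RHS]mulrS.
Qed.

Lemma fderiv_scalar (lam : V -> C) (G : C -> C) (D0 : C) p (Bl : R) :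
  (forall p q, lam (p + q) = lam p + lam q) ->
  (forall v, cnorm (lam v) <= Bl * `|v|) -> cderiv G (lam p) D0 ->
  fderiv (fun q => (G (lam q))%:A) p (fun v => (D0 * lam v)%:A).
Proof.
move=> lamD lamB dG; pose B := `|Bl| + 1; have B0 : 0 < B by rewrite ltr_wpDl.
have HB v : cnorm (lam v) <= B * `|v|.
  apply: le_trans (lamB v) _; rewrite ler_wpM2r // /B.
  by have := ler_norm Bl; lra.
have u0 := anorm_ge0 I 1; split.
  exists (cnorm D0 * B * an 1) => v; rewrite anormZ cnormM [leRHS]mulrAC.
  by rewrite ler_wpM2r // -mulrA ler_wpM2l ?cnorm_ge0.
move=> e e0; have K0 : 0 < B * (an 1 + 1) by rewrite mulr_gt0 // ltr_wpDl.
have [d d0 Hd] := dG _ (divr_gt0 e0 K0).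
exists (d / B) => [|v]; first by rewrite divr_gt0.
rewrite ltr_pdivlMr // => vd.
have ld : cnorm (lam v) < d by apply: le_lt_trans (HB v) _; rewrite mulrC.
rewrite -!scalerBl lamD anormZ.
apply: le_trans (ler_wpM2r u0 (Hd _ ld)) _.
have -> : e * `|v| = e / (B * (an 1 + 1)) * (B * `|v|) * (an 1 + 1).
  by field; rewrite !gt_eqF // ltr_wpDl.
have ee : 0 <= e / (B * (an 1 + 1)) by apply: divr_ge0; exact: ltW.
apply: ler_pM => //; first by rewrite mulr_ge0 // cnorm_ge0.
  by rewrite ler_wpM2l.
by rewrite lerDl.
Qed.

End FrechetDerivative.

(** * Principal extensions of holomorphic functions *)

Section PrincipalExtension.
Variables (R : realType) (m n : nat) (A : falgType R[i]) (I : n.-tuple A).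
Hypothesis hI : cartan_basis m I.
Variables e2 e3 : A.
Local Notation C := R[i].
Local Notation V := 'rV[R]_3.
Local Notation an := (anorm I).
Local Notation ze := (zeta e2 e3).
Implicit Types (p q v w : V) (a b : A) (f g : V -> A) (L : V -> A) (x e d : R) (k : 'I_n).

(* f_u (zeta v) for u = u_k, and the part of zeta v nilpotent on I_k A. *)
Definition lam k v : C := coord I (idem_index m I k) (ze v).

Definition nilpart k v : A := ze v - (lam k v)%:A.

Lemma lamD k p q : lam k (p + q) = lam k p + lam k q.
Proof. by rewrite /lam (zetaD hI) linearD. Qed.

Lemma lamZ k x p : lam k (x *: p) = x%:C * lam k p.
Proof. by rewrite /lam zetaZ linearZ. Qed.

Lemma lamB k p q : lam k (p - q) = lam k p - lam k q.
Proof. by rewrite lamD -scaleN1r lamZ rmorphN rmorph1 mulN1r. Qed.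

Lemma cnorm_lam k v : cnorm (lam k v) <= zeta_bound I e2 e3 * `|v|.
Proof. apply: le_trans (anorm_zeta I _ _ _); exact: cnorm_coord_le. Qed.

Lemma nilpartD k p q : nilpart k (p + q) = nilpart k p + nilpart k q.
Proof. by rewrite /nilpart lamD (zetaD hI) scalerDl opprD addrACA. Qed.

Lemma anorm_nilpart k v :
  an (nilpart k v) <= zeta_bound I e2 e3 * (1 + an 1) * `|v|.
Proof.
apply: le_trans (anormD _ _ _) _; rewrite anormN anormZ mulrAC mulrDr mulr1.
by rewrite lerD ?(anorm_zeta I) // ler_wpM2r ?anorm_ge0 ?cnorm_lam.
Qed.

Lemma coord_nilpart k v : coord I (idem_index m I k) (nilpart k v) = 0.
Proof.
have [um _ _] := idem_indexP hI k.
by rewrite linearB linearZ /= (coord_one hI) // mulr1 subrr.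
Qed.

(* Taylor's formula for G_r at zeta = f_u(zeta) + nilpart, times I_k; here G_j is
   meant to be the j-th derivative of G_0. *)
Definition principal_ext k (G : nat -> C -> C) (r : nat) p : A :=
  \sum_(j < n.+1) (j`!%:R^-1 * G (r + j)%N (lam k p))%:A * (nilpart k p ^+ j * tnth I k).

(** Let [T j] be the terms of the extension of order [r.+1]. Differentiating [G] in the [j]-th term
    gives [lam v *: T j], and differentiating the power gives [N v * T j.-1] for [j > 0]. Since
    [T n = 0] by nilpotency, both sums may run up to [n], and they add up to [ze v = lam v + N v]
    times the extension. *)
Lemma fderiv_principal_ext k G r p :
  (forall j, (j <= n)%N -> cderiv (G (r + j)%N) (lam k p) (G (r + j).+1 (lam k p))) ->
  fderiv I (principal_ext k G r) p (fun v => ze v * principal_ext k G r.+1 p).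
Proof.
move=> dG; pose N v := nilpart k v.
pose F j q : A := (j`!%:R^-1 * G (r + j)%N (lam k q))%:A * (N q ^+ j * tnth I k).
pose L j v : A := (j`!%:R^-1 * G (r + j).+1 (lam k p) * lam k v)%:A * (N p ^+ j * tnth I k) +
  (j`!%:R^-1 * G (r + j)%N (lam k p))%:A * ((N p ^+ j.-1 * N v *+ j) * tnth I k).
have dF j : (j < n.+1)%N -> fderiv I (F j) p (L j).
  rewrite ltnS => jn.
  have d1 := fderiv_scalar I (lamD k) (cnorm_lam k) (cderivZ j`!%:R^-1 (dG j jn)).
  have dN : fderiv I N p N := fderiv_additive hI p (nilpartD k) (anorm_nilpart k).
  have d2 := fderivM hI (fderivX hI j dN) (fderiv_cst I (tnth I k) p).
  apply: fderiv_eqL (fderivM hI d1 d2) => v /=.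
  by rewrite /L mulr0 addr0.
apply: fderiv_eqL (fderiv_sum hI dF) => v /=.
pose T j : A := (j`!%:R^-1 * G (r.+1 + j)%N (lam k p))%:A * (N p ^+ j * tnth I k).
have Tn : T n = 0 by rewrite /T (nilpotentX_eq0 hI) ?mulr0 // coord_nilpart.
have LE (j : nat) : L j.+1 v = lam k v *: T j.+1 + N v * T j.
  rewrite /L /T !addSn !addnS; congr (_ + _).
    by rewrite !mulr_algl scalerA; congr (_ *: _); ring.
  rewrite !mulr_algl -scalerAr /= mulrnAl -scalerMnr scalerMnl; congr (_ *: _).
    rewrite -mulr_natr mulrAC; congr (_ * _).
    by rewrite factS natrM invfM mulrAC mulVf ?mul1r // pnatr_eq0.
  by rewrite mulrA (mulAC hI (N v)).
have L0 : L 0 v = lam k v *: T 0.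
  rewrite /L /T mulr0n mul0r mulr0 addr0 addn0.
  by rewrite !mulr_algl scalerA; congr (_ *: _); rewrite addn0; ring.
have zE : ze v = (lam k v)%:A + N v by rewrite /N /nilpart addrC subrK.
rewrite zE /principal_ext -/(N p) mulrDl mulr_algl.
have -> : \sum_(j < n.+1) (j`!%:R^-1 * G (r.+1 + j)%N (lam k p))%:A * (N p ^+ j * tnth I k) =
  \sum_(j < n.+1) T j by [].
rewrite big_ord_recl /= L0.
under eq_bigr do rewrite /bump /= add1n LE.
rewrite big_split /= addrA [in RHS]scaler_sumr [in RHS]big_ord_recl /=; congr (_ + _).
by rewrite big_ord_recr /= Tn addr0 mulr_sumr.
Qed.

Lemma order_ge_principal_ext k G r p : order_ge I k (principal_ext k G r p).
Proof.
move=> j jk; rewrite linear_sum big1 // => i _.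
have [h _] := order_ge_nilpotentX hI i (coord_nilpart k p).
rewrite mulr_algl linearZ /= h ?mulr0 //.
by rewrite (leq_trans jk) // leq_addr.
Qed.

Lemma coord_principal_ext k G r p : coord I k (principal_ext k G r p) = G r (lam k p).
Proof.
rewrite linear_sum big_ord_recl /= big1 ?addr0 => [|i _].
  rewrite mulr_algl linearZ /= addn0 expr0 mul1r (coord_tnth hI) eqxx mulr1.
  by rewrite invr1 mul1r.
have [h _] := order_ge_nilpotentX hI (lift ord0 i) (coord_nilpart k p).
rewrite mulr_algl linearZ /= h ?mulr0 //.
by rewrite -[X in (X < _)%N]addn0 ltn_add2l.
Qed.

End PrincipalExtension.

(** * Factorization of scalar functions through a functional *)

Section FactorThroughFunctional.
Variable R : realType.
Local Notation C := R[i].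
Local Notation V := 'rV[R]_3.
Local Notation Re := (@complex.Re R).
Local Notation Im := (@complex.Im R).
Variables (lam : V -> C) (B : R).
Hypothesis lamD : forall p q, lam (p + q) = lam p + lam q.
Hypothesis lamZ : forall x p, lam (x *: p) = x%:C * lam p.
Hypothesis lamB : forall p, cnorm (lam p) <= B * `|p|.
Hypothesis lam_surj : forall w, exists p, lam p = w.
Implicit Types (p q v : V) (x e d r s t : R) (w h : C) (phi D : V -> C).

Definition scont phi p := forall e, 0 < e ->
  exists2 d, 0 < d & forall v, `|v| < d -> cnorm (phi (p + v) - phi p) <= e.

Definition sgateaux phi p (c : C) := forall v e, 0 < e ->
  exists2 d, 0 < d & forall x, 0 < x < d ->
    cnorm (phi (p + x *: v) - phi p - x%:C * (lam v * c)) <= e * x.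

(** The one-sided derivatives in the directions [k] and [- k] both vanish, so [phi] has two-sided
    derivative zero along the segment. *)
Lemma kernel_invariant phi D q k : lam k = 0 ->
  (forall t, 0 <= t <= 1 -> sgateaux phi (q + t *: k) (D (q + t *: k))) ->
  phi (q + k) = phi q.
Proof.
move=> k0 gphi.
have aux (T : C -> R) : (forall w, `|T w| <= cnorm w) ->
    (forall w h, T w - T h = T (w - h)) -> T (phi (q + k)) = T (phi q).
  move=> Tn TB.
  have := @derive0_eq _ (fun t => T (phi (q + t *: k))) 0 1 ltr01.
  rewrite scale1r scale0r addr0; apply => t t01; apply/is_deriveP => e e0.
  have [d1 d10 H1] := gphi t t01 k e e0.
  have [d2 d20 H2] := gphi t t01 (- k) e e0.
  exists (Num.min d1 d2) => [|x]; first by rewrite lt_min d10.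
  rewrite lt_min => /andP[x1 x2]; rewrite mul0r subr0 TB; apply: le_trans (Tn _) _.
  have [x0|x0|->] := ltrgtP x 0; last first.
  - by rewrite addr0 subrr cnorm0 normr0 mulr0.
  - have := H1 x; rewrite gtr0_norm // in x1 *; rewrite x0 x1 => /(_ isT).
    by rewrite k0 mul0r mulr0 subr0 scalerDl addrA.
  - have := H2 (- x); rewrite ltr0_norm // in x2 *; rewrite oppr_gt0 x0 x2 => /(_ isT).
    have lk : lam (- k) = 0 by rewrite -scaleN1r lamZ k0 mulr0.
    by rewrite lk mul0r mulr0 subr0 scalerN -scaleNr opprK scalerDl addrA.
apply/eqP; rewrite eq_complex; apply/andP; split; apply/eqP; apply: aux.
- exact: normr_Re.
- by move=> [? ?] [? ?].
- exact: normr_Im.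
- by move=> [? ?] [? ?].
Qed.

Lemma factor_tower (N : nat) phi D p0 r : 0 < r ->
  (forall p, `|p - p0| < r -> scont phi p) ->
  (forall p, `|p - p0| < r -> sgateaux phi p (D p)) ->
  exists (G : nat -> C -> C) (s : R), [/\ 0 < s,
    forall p, `|p - p0| < s -> phi p = G 0 (lam p) &
    forall p, `|p - p0| < s -> forall j, (j < N)%N ->
      cderiv (G j) (lam p) (G j.+1 (lam p))].
Proof.
move=> r0 cphi gphi; have [v1 l1] := lam_surj 1; have [v2 l2] := lam_surj 'i%C.
(* A real-linear section of [lam]: composed with it, [phi] becomes a function of one complex
   variable. *)
pose sg w : V := Re w *: v1 + Im w *: v2.
have lsg w : lam (sg w) = w.
  rewrite /sg lamD !lamZ l1 l2 mulr1.
  by case: w => a b /=; apply/eqP; rewrite eq_complex /=; apply/andP; split; apply/eqP; ring.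
have sgD w h : sg (w + h) = sg w + sg h.
  by rewrite /sg; case: w h => a b [a' b'] /=; rewrite !scalerDl addrACA.
have sgZ x w : sg (x%:C * w) = x *: sg w.
  by rewrite /sg; case: w => a b /=; rewrite !mul0r subr0 addr0 scalerDr !scalerA.
have sgB w h : sg (w - h) = sg w - sg h.
  by rewrite /sg; case: w h => a b [a' b'] /=; rewrite !scalerBl opprD addrACA.
pose S := `|v1| + `|v2| + 1.
have S0 : 0 < S by rewrite ltr_wpDl // addr_ge0.
have sgn w : `|sg w| <= S * cnorm w.
  apply: le_trans (ler_normD _ _) _; rewrite !normrZ.
  have := ler_wpM2r (normr_ge0 v1) (normr_Re w); have := ler_wpM2r (normr_ge0 v2) (normr_Im w).
  have := cnorm_ge0 w; rewrite /S; lra.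
pose w0 := lam p0.
pose F w := phi (p0 + sg (w - w0)); pose Dw w := D (p0 + sg (w - w0)).
pose rr := r / S / 2; have rr0 : 0 < rr by rewrite !divr_gt0.
have inball w : csquare w0 rr w -> `|p0 + sg (w - w0) - p0| < r.
  move=> Qw; rewrite addrC addKr; apply: le_lt_trans (sgn _) _.
  have : cnorm (w - w0) < r / S by apply: csquare_ball.
  by rewrite ltr_pdivlMr // mulrC.
have cF w : csquare w0 rr w -> ccont F w.
  move=> /inball /cphi cw e /cw[d d0 Hd]; exists (d / S); first by rewrite divr_gt0.
  move=> h; rewrite ltr_pdivlMr // => hd; rewrite /F.
  have -> : p0 + sg (w + h - w0) = p0 + sg (w - w0) + sg h.
    by rewrite -[RHS]addrA -sgD; congr (_ + sg _); ring.
  by apply: Hd; apply: le_lt_trans (sgn h) _; rewrite mulrC.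
have gF w : csquare w0 rr w -> cgateaux F w (Dw w).
  move=> /inball /gphi gw h e /(gw (sg h))[d d0 Hd]; exists d => // x /Hd.
  rewrite lsg /F /Dw mulrA.
  have -> // : p0 + sg (w + x%:C * h - w0) = p0 + sg (w - w0) + x *: sg h.
  by rewrite -[RHS]addrA -sgZ -sgD; congr (_ + sg _); ring.
have [s1 [L [s10 hF]]] := gateaux_bounded_hol rr0 cF gF.
have [G [s2 [s20 G0 HG]]] := holomorphic_tower N s10 hF.
pose B1 := `|B| + 1; have B10 : 0 < B1 by rewrite ltr_wpDl.
have lamB1 p : cnorm (lam p) <= B1 * `|p|.
  apply: le_trans (lamB p) _; rewrite ler_wpM2r // /B1.
  by have := ler_norm B; lra.
have lamBs p q : lam (p - q) = lam p - lam q.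
  by rewrite lamD -scaleN1r lamZ rmorphN rmorph1 mulN1r.
(* [r] keeps [p] in the ball, [r / S / B1] keeps there the point [q] of the section with the same
   [lam], and [s2 / B1] keeps [lam p] in the disc of the tower. *)
exists G, (Num.min (Num.min r (r / S / B1)) (s2 / B1)); split.
- by rewrite !lt_min r0 !divr_gt0.
- move=> p; rewrite !lt_min => /andP[/andP[pr pB] _].
  rewrite G0 /F -lamBs.
  set q := p0 + sg (lam (p - p0)); pose k := p - q.
  have pE : p = q + k by rewrite /k addrC subrK.
  have k0 : lam k = 0 by rewrite /k /q lamBs lamD lsg lamBs; ring.
  have qr : `|q - p0| < r.
    rewrite /q addrC addKr; apply: le_lt_trans (sgn _) _.
    rewrite mulrC -ltr_pdivlMr //; apply: le_lt_trans (lamB1 _) _.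
    by rewrite mulrC -ltr_pdivlMr.
  rewrite [in LHS]pE; apply: (@kernel_invariant phi D q k k0) => t /andP[t0 t1].
  apply: gphi.
  have -> : q + t *: k - p0 = (1 - t) *: (q - p0) + t *: (p - p0).
    rewrite /k; apply/matrixP => a b; rewrite !mxE; ring.
  apply: le_lt_trans (ler_normD _ _) _; rewrite !normrZ !ger0_norm ?subr_ge0 //.
  have [->|t1'] := eqVneq t 1; first by rewrite subrr mul0r add0r mul1r.
  have t1'' : 0 < 1 - t by rewrite subr_gt0 lt_neqAle t1'.
  have -> : r = (1 - t) * r + t * r by ring.
  by rewrite ltr_leD // ?ler_wpM2l ?(ltW pr) // ltr_pM2l.
- move=> p; rewrite !lt_min => /andP[_ ps] j jN; apply: HG => //.
  rewrite -/w0 /w0 -lamBs; apply: le_lt_trans (lamB1 _) _.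
  by rewrite mulrC -ltr_pdivlMr.
Qed.

End FactorThroughFunctional.

(** * Local structure of monogenic functions *)

Section LocalRegularity.
Variables (R : realType) (m n : nat) (A : falgType R[i]) (I : n.-tuple A).
Hypothesis hI : cartan_basis m I.
Variables e2 e3 : A.
Local Notation C := R[i].
Local Notation V := 'rV[R]_3.
Local Notation an := (anorm I).
Local Notation ze := (zeta e2 e3).
Implicit Types (p q v w : V) (a b : A) (f g D : V -> A) (L : V -> A) (x e d : R) (k : 'I_n).

Definition agateaux f p (c : A) := forall v e, 0 < e ->
  exists2 d, 0 < d & forall x, 0 < x < d ->
    an (f (p + x *: v) - f p - x%:C *: (ze v * c)) <= e * x.

Lemma fderiv_agateaux f p c : fderiv I f p (fun v => ze v * c) -> agateaux f p c.
Proof.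
move=> [_ df] v e e0; have v1 : 0 < `|v| + 1 by rewrite ltr_wpDl.
have [d d0 Hd] := df _ (divr_gt0 e0 v1).
exists (d / (`|v| + 1)) => [|x /andP[x0]]; first by rewrite divr_gt0.
rewrite ltr_pdivlMr // => xd.
have xv : `|x *: v| = x * `|v| by rewrite normrZ gtr0_norm.
have := Hd (x *: v); rewrite xv zetaZ -scalerAl => h.
apply: le_trans (h _) _; first by apply: le_lt_trans xd; rewrite ler_wpM2l ?(ltW x0) ?lerDl.
rewrite mulrCA mulrC ler_wpM2r ?(ltW x0) //.
by rewrite mulrAC ler_pdivrMr // ler_wpM2l ?(ltW e0) ?lerDl.
Qed.

(** The direction of [e_1 = 1], along which the derivative itself is read off. *)
Definition unit_dir : V := \row_j (j == 0)%:R.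

Lemma zeta_unit_dir : ze unit_dir = 1.
Proof. by rewrite /zeta !mxE /= scale1r !scale0r !addr0. Qed.

Lemma fcontB f g p : fcont I f p -> fcont I g p -> fcont I (fun q => f q - g q) p.
Proof.
move=> cf cg e e0; have e20 : 0 < e / 2 by rewrite divr_gt0.
have [d d0 Hd] := cf _ e20; have [d' d0' Hd'] := cg _ e20.
exists (Num.min d d') => [|v]; first by rewrite lt_min d0.
rewrite lt_min => /andP[/Hd h1 /Hd' h2].
have -> : f (p + v) - g (p + v) - (f p - g p) = (f (p + v) - f p) - (g (p + v) - g p).
  by rewrite !opprB addrACA [RHS]addrACA; congr (_ + _); rewrite addrC.
by apply: le_trans (anormD _ _ _) _; rewrite anormN; lra.
Qed.

Lemma agateauxB f g p c c' : agateaux f p c -> agateaux g p c' ->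
  agateaux (fun q => f q - g q) p (c - c').
Proof.
move=> gf gg v e e0; have e20 : 0 < e / 2 by rewrite divr_gt0.
have [d d0 Hd] := gf v _ e20; have [d' d0' Hd'] := gg v _ e20.
exists (Num.min d d') => [|x]; first by rewrite lt_min d0.
rewrite lt_min => /andP[x0 /andP[xd xd']].
have h1 := Hd x; rewrite x0 xd in h1; have {}h1 := h1 isT.
have h2 := Hd' x; rewrite x0 xd' in h2; have {}h2 := h2 isT.
set X := f (p + x *: v) - f p - _ in h1; set Y := g (p + x *: v) - g p - _ in h2.
have -> : f (p + x *: v) - g (p + x *: v) - (f p - g p) - x%:C *: (ze v * (c - c')) = X - Y.
  rewrite /X /Y mulrBr scalerBr; apply: (coord_inj hI) => j.
  by rewrite ?(linearB, linearD, linearN) /=; ring.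
by apply: le_trans (anormD _ _ _) _; rewrite anormN; lra.
Qed.

Lemma agateaux_unique f p c c' : agateaux f p c -> agateaux f p c' -> c = c'.
Proof.
move=> g1 g2; apply/eqP; rewrite -subr_eq0.
have : an (c - c') = 0.
  apply/eqP; rewrite eq_le anorm_ge0 andbT; apply/ler_addgt0Pr => e e0; rewrite add0r.
  have := agateauxB g1 g2 unit_dir e0 => -[d d0 Hd].
  have x0 : 0 < d / 2 < d by lra.
  have := Hd _ x0; rewrite !subrr sub0r anormN anormZ zeta_unit_dir mul1r cnorm_real.
  have d2 : 0 < d / 2 by rewrite divr_gt0.
  by rewrite gtr0_norm // mulrC ler_pM2r // subrr subr0.
move=> h; apply/eqP; apply: (coord_inj hI) => j; rewrite linear0; apply/eqP.
by rewrite -cnorm_eq0 eq_le cnorm_ge0 andbT -h cnorm_coord_le.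
Qed.

Hypothesis functional_surj : forall u : 'I_n, (u < m)%N ->
  forall w : C, exists p, coord I u (ze p) = w.

(** The difference quotients in the direction 1 tend to [D p] and stay in the same ideal, which is
    closed. *)
Lemma order_ge_agateaux f D p0 r (i : nat) :
  (forall p, `|p - p0| < r -> agateaux f p (D p)) ->
  (forall p, `|p - p0| < r -> order_ge I i (f p)) ->
  forall p, `|p - p0| < r -> order_ge I i (D p).
Proof.
move=> gf of_ p pr j ji; apply/eqP; rewrite -cnorm_eq0 eq_le cnorm_ge0 andbT.
apply/ler_addgt0Pr => e e0; rewrite add0r.
have [d d0 Hd] := gf p pr unit_dir e e0.
have u1 : 0 < `|unit_dir| + 1 by rewrite ltr_wpDl.
have q0 : 0 < r - `|p - p0| by rewrite subr_gt0.
pose x := Num.min d ((r - `|p - p0|) / (`|unit_dir| + 1)) / 2.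
have m0 : 0 < Num.min d ((r - `|p - p0|) / (`|unit_dir| + 1)) by rewrite lt_min d0 divr_gt0.
have [md mr] : Num.min d ((r - `|p - p0|) / (`|unit_dir| + 1)) <= d /\
    Num.min d ((r - `|p - p0|) / (`|unit_dir| + 1)) <= (r - `|p - p0|) / (`|unit_dir| + 1).
  by rewrite !ge_min !lexx orbT.
have x0 : 0 < x by rewrite divr_gt0.
have xd : x < d by rewrite /x; lra.
have pxr : `|p + x *: unit_dir - p0| < r.
  rewrite addrAC; apply: le_lt_trans (ler_normD _ _) _; rewrite normrZ gtr0_norm //.
  have : x * (`|unit_dir| + 1) < r - `|p - p0| by rewrite -ltr_pdivlMr // /x; lra.
  by rewrite mulrDr mulr1; lra.
have := Hd x; rewrite x0 xd => /(_ isT) /(le_trans (cnorm_coord_le I j _)).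
rewrite !linearB linearZ /= (of_ _ pxr j ji) (of_ _ pr j ji) zeta_unit_dir mul1r.
by rewrite subrr sub0r cnormN cnormM cnorm_real gtr0_norm // mulrC ler_pM2r.
Qed.

(* Downward induction on the order: the first nonzero coordinate of a monogenic
   function is a holomorphic function of a functional, and subtracting its
   principal extension raises the order. *)
Lemma local_second_derivative (i : nat) f D p0 r : (i <= n)%N -> 0 < r ->
  (forall p, `|p - p0| < r -> fcont I f p) ->
  (forall p, `|p - p0| < r -> agateaux f p (D p)) ->
  (forall p, `|p - p0| < r -> order_ge I (n - i) (f p)) ->
  exists (s : R) (T1 T2 : V -> A), 0 < s /\ forall p, `|p - p0| < s ->
    fderiv I f p (fun v => ze v * T1 p) /\ fderiv I T1 p (fun v => ze v * T2 p).
Proof.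
elim: i f D r => [|i IH] f D r ni r0 cf gf of_.
  (* Order at least [n] means that [f] vanishes on the ball. *)
  exists r, (fun=> 0), (fun=> 0); split => // p pr.
  have c0 : fderiv I (fun=> 0) p (fun v => ze v * 0).
    by apply: fderiv_eqL (fderiv_cst I 0 p) => v; rewrite mulr0.
  split=> //; apply: (fderiv_near (r := r - `|p - p0|) _ _ c0); first by rewrite subr_gt0.
  move=> q qp; rewrite (order_ge_full hI (a := f q)) //.
  have qr : `|q - p0| < r.
    have -> : q - p0 = (q - p) + (p - p0) by rewrite addrA subrK.
    by apply: le_lt_trans (ler_normD _ _) _; lra.
  by have := of_ q qr; rewrite subn0.
have kn : (n - i.+1 < n)%N by rewrite ltn_subrL (leq_trans _ ni).
pose k := Ordinal kn; have nik : (n - i)%N = k.+1 by rewrite /= -subSn.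
have oD := order_ge_agateaux gf of_.
have sc p : `|p - p0| < r -> scont (fun q => coord I k (f q)) p.
  move=> /cf cp e /cp[d d0 Hd]; exists d => // v /Hd.
  by apply: le_trans; rewrite -linearB; exact: cnorm_coord_le.
have sg p : `|p - p0| < r ->
    sgateaux (lam m I e2 e3 k) (fun q => coord I k (f q)) p (coord I k (D p)).
  move=> pr v e e0; have [d d0 Hd] := gf p pr v e e0; exists d => // x /Hd.
  (* [D p] has order at least [k] as well, so coordinate [k] of [ze v * D p] is [lam v] times
     coordinate [k] of [D p]. *)
  apply: le_trans; have <- := coord_mul_order hI (k := k) (ze v) (oD p pr).
  by rewrite -linearB -linearZ -linearB; exact: cnorm_coord_le.
have [um _ _] := idem_indexP hI k.
(* [n.+3] covers the orders [j + l] with [j <= 2] and [l <= n] differentiated in [dext]. *)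
have [G [s [s0 fG HG]]] := factor_tower (lamD hI e2 e3 k) (lamZ m I e2 e3 k)
  (cnorm_lam m I e2 e3 k) (functional_surj um) n.+3 r0 sc sg.
have dext j p : (j <= 2)%N -> `|p - p0| < s ->
    fderiv I (principal_ext m I e2 e3 k G j) p (fun v => ze v * principal_ext m I e2 e3 k G j.+1 p).
  move=> j2 ps; apply: (fderiv_principal_ext hI) => l ln; apply: HG => //.
  by rewrite (leq_ltn_trans (leq_add j2 ln)).
pose f' q := f q - principal_ext m I e2 e3 k G 0 q.
pose D' q := D q - principal_ext m I e2 e3 k G 1 q.
pose r' := Num.min r s.
have r'0 : 0 < r' by rewrite lt_min r0.
have rr p : `|p - p0| < r' -> `|p - p0| < r /\ `|p - p0| < s.
  by rewrite lt_min => /andP[].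
have [| | |s' [T1 [T2 [s'0 HT]]]] := IH f' D' r' (ltnW ni) r'0.
- by move=> p /rr[pr ps]; apply: fcontB; [exact: cf|apply: fderiv_fcont (dext 0%N p _ ps)].
- by move=> p /rr[pr ps]; apply: agateauxB; [exact: gf|apply: fderiv_agateaux (dext 0%N p _ ps)].
- move=> p /rr[pr ps] j; rewrite nik ltnS leq_eqVlt => /orP[/eqP jk|jk].
    have -> : j = k by apply: val_inj.
    by rewrite /f' linearB /= (coord_principal_ext hI) -fG // subrr.
  by rewrite /f' linearB /= (of_ p pr j jk) (order_ge_principal_ext hI) // subrr.
exists (Num.min s s'), (fun q => T1 q + principal_ext m I e2 e3 k G 1 q),
  (fun q => T2 q + principal_ext m I e2 e3 k G 2 q); split; first by rewrite lt_min s0.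
move=> p; rewrite lt_min => /andP[ps /HT[h1 h2]]; split.
- have -> : f = (fun q => f' q + principal_ext m I e2 e3 k G 0 q).
    by apply/funext => q; rewrite /f' subrK.
  by apply: fderiv_eqL (fderivD hI h1 (dext 0%N p _ ps)) => // v; rewrite mulrDr.
- by apply: fderiv_eqL (fderivD hI h2 (dext 1%N p _ ps)) => // v; rewrite mulrDr.
Qed.

End LocalRegularity.

(** * The topology of the algebra *)

Section Topology.
Variables (R : realType) (m n : nat) (A : falgType R[i]) (I : n.-tuple A).
Hypothesis hI : cartan_basis m I.
Variables e2 e3 : A.
Local Notation C := R[i].
Local Notation V := 'rV[R]_3.
Local Notation Re := (@complex.Re R).
Local Notation Im := (@complex.Im R).
Local Notation an := (anorm I).
Local Notation ze := (zeta e2 e3).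
Implicit Types (p q v : V) (a b : A) (Phi Psi : A -> A) (x e d : R) (k : 'I_n).

Lemma ball_complex (z w : C) e : ball z e%:C w = (cnorm (z - w) < e) :> Prop.
Proof. by rewrite -ball_normE /= cnorm_normr ltcR. Qed.

Lemma ball_rowP (z w : 'rV[C]_n) e : 0 < e ->
  ball z e%:C w <-> forall k, cnorm (z 0 k - w 0 k) < e.
Proof.
move=> e0; split=> [[_ H] k|H].
  by have := H 0 k; rewrite ball_complex.
split; first by rewrite ltcR.
by move=> i k; rewrite ball_complex ord1.
Qed.

Lemma nbhs_row_coordP a (B : set 'rV[C]_n) : nbhs (coordinates I a) B <->
  exists2 e, 0 < e & forall w : 'rV[C]_n, (forall k, cnorm (w 0 k - coord I k a) < e) -> B w.
Proof.
split=> [/nbhs_ballP[e /= e0 He]|[e e0 He]].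
- have eR : e = (Re e)%:C.
    by move: e0; rewrite ltcE /= => /andP[/eqP e0 _]; case: (e) e0 => r i /= ->.
  have e1 : 0 < Re e by move: e0; rewrite ltcE => /andP[].
  exists (Re e) => // w Hw; apply: He; rewrite eR; apply/ball_rowP => // k.
  by rewrite mxE cnormBC.
- apply/nbhs_ballP; exists e%:C; first by rewrite /= ltcR.
  move=> w /(ball_rowP _ _ e0) Hw; apply: He => k.
  by have := Hw k; rewrite mxE cnormBC.
Qed.

Lemma nbhs_algtopP a (P : set A) : nbhs (a : algtop I) P <->
  exists2 e, 0 < e & forall b, an (b - a) < e -> P b.
Proof.
split.
- move=> [_ [[B Bo <-] Ba BP]].
  have /nbhs_row_coordP[e e0 He] : nbhs (coordinates I a) B by apply: open_nbhs_nbhs.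
  exists e => // b ab; apply: BP; apply: He => k; rewrite mxE -linearB.
  by apply: le_lt_trans ab; exact: cnorm_coord_le.
- move=> [e e0 He].
  (* With [n.+1] in place of [n], the sum of [n] terms stays strictly below [e], also for
     [n = 0]. *)
  have e'0 : 0 < e / n.+1%:R by rewrite divr_gt0.
  have : nbhs (coordinates I a)
      [set w : 'rV[C]_n | forall k, cnorm (w 0 k - coord I k a) < e / n.+1%:R].
    by apply/nbhs_row_coordP; exists (e / n.+1%:R).
  move=> /(@initial_continuous _ _ (coordinates I) (a : algtop I)).
  apply: (@filterS _ (nbhs (a : algtop I))) => b /= Hb; apply: He.
  apply: (@le_lt_trans _ _ (\sum_(k < n) e / n.+1%:R)).
    apply: ler_sum => k _; have := Hb k.
    by rewrite mxE linearB => /ltW.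
  rewrite sumr_const card_ord -[_ *+ n]mulr_natr -mulrA gtr_pMr // mulrC ltr_pdivrMr //.
  by rewrite mul1r ltr_nat.
Qed.

Lemma cvg_algtopP (T : Type) (F : set_system T) (FF : Filter F) (g : T -> A) a :
  (g @ F --> (a : algtop I)) <-> forall e, 0 < e -> \forall t \near F, an (g t - a) < e.
Proof.
split=> [cg e e0|H P /nbhs_algtopP[e e0 He]].
  by apply: (cg [set b | an (b - a) < e]); apply/nbhs_algtopP; exists e.
by apply: filterS (H e e0) => t; exact: He.
Qed.

Lemma at_rightP (P : set R) : (\forall x \near 0^'+, P x) <->
  exists2 d, 0 < d & forall x, 0 < x < d -> P x.
Proof.
split.
- rewrite near_withinE => /nbhs_ballP[d /= d0 Hd]; exists d => // x /andP[x0 xd].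
  by apply: Hd => //; rewrite /ball /= sub0r normrN gtr0_norm.
- move=> [d d0 Hd]; rewrite near_withinE; apply/nbhs_ballP; exists d => //= x.
  rewrite /ball /= sub0r normrN => xd x0; apply: Hd; rewrite x0 /=.
  by rewrite gtr0_norm in xd.
Qed.

Lemma is_gateauxP Phi p a :
  is_gateaux I e2 e3 Phi (ze p) a <-> agateaux I e2 e3 (Phi \o ze) p a.
Proof.
have key v x : 0 < x ->
    an ((x^-1)%:C *: (Phi (ze p + x%:C *: ze v) - Phi (ze p)) - ze v * a) * x =
    an ((Phi \o ze) (p + x *: v) - (Phi \o ze) p - x%:C *: (ze v * a)).
  move=> x0; have xx : x%:C * (x^-1)%:C = 1 :> C.
    by rewrite -rmorphM mulfV ?gt_eqF // rmorph1.
  have xn : cnorm x%:C = x by rewrite cnorm_real gtr0_norm.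
  rewrite mulrC -[X in X * _]xn -anormZ scalerBr scalerA xx scale1r /=.
  by rewrite (zetaD hI) zetaZ.
split.
- move=> H v e e0; have /cvg_algtopP/(_ e e0)/at_rightP[d d0 Hd] := H (ze v) (ex_intro2 _ _ v Logic.I erefl).
  exists d => // x /andP[x0 xd]; rewrite -key // ler_pM2r // ltW //.
  by apply: Hd; rewrite x0.
- move=> H _ [v _ <-]; apply/cvg_algtopP => e e0; apply/at_rightP.
  have [d d0 Hd] := H v (e / 2) (divr_gt0 e0 (ltr0Sn _ _)).
  exists d => // x /andP[x0 xd]; rewrite -(@ltr_pM2r _ x) // key //.
  by apply: le_lt_trans (Hd x _) _; [rewrite x0|rewrite ltr_pM2r //; lra].
Qed.

Hypothesis indep : real_independent e2 e3.

(** In the [n + n] real coordinates of [A], independence says that the matrix of [zeta] is row free;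
    its pseudo-inverse recovers [v] from [ze v], and the entries of this inverse give the constant.
    The bound makes the inverse of [zeta] continuous. *)
Lemma zeta_lower_bound : exists2 c : R, 0 < c & forall v, `|v| <= c * an (ze v).
Proof.
pose T (j : 'I_(n + n)) a : R :=
  match fintype.split j with inl k => Re (coord I k a) | inr k => Im (coord I k a) end.
pose E (i : 'I_3) : A := if i == 0 then 1 else if i == 1 then e2 else e3.
pose M : 'M[R]_(3, n + n) := \matrix_(i, j) T j (E i).
have TE v j : (v *m M) 0 j = T j (ze v).
  rewrite mxE !big_ord_recl big_ord0 !mxE.
  have -> : lift ord0 ord0 = 1 :> 'I_3 by apply: val_inj.
  have -> : lift ord0 (lift ord0 ord0) = 2 :> 'I_3 by apply: val_inj.
  rewrite /E /= /zeta /T; case: (fintype.split j) => k; rewrite !linearD !linearZ /=;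
    case: (coord I k 1) (coord I k e2) (coord I k e3) => [? ?] [? ?] [? ?] /=; ring.
have Tn j a : `|T j a| <= an a.
  rewrite /T; case: (fintype.split j) => k; apply: le_trans (cnorm_coord_le I k a).
    exact: normr_Re.
  exact: normr_Im.
have fM : row_free M.
  apply: inj_row_free => v vM; apply: indep; apply: (coord_inj hI) => k.
  rewrite linear0; apply/eqP; rewrite eq_complex /=.
  have h j : T j (ze v) = 0 by rewrite -TE vM mxE.
  have := h (lshift n k); have := h (rshift n k).
  rewrite /T (unsplitK (inl k)) (unsplitK (inr k)) => -> ->; by rewrite !eqxx.
pose P := pinvmx M; pose c := \sum_i \sum_j `|P j i|.
have c0 : 0 <= c by do 2!(apply: sumr_ge0 => ? _).
exists (c + 1) => [|v]; first by rewrite ltr_wpDl.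
apply: (@le_trans _ _ (c * an (ze v))); last first.
  by rewrite ler_wpM2r ?anorm_ge0 // lerDl.
have vE : v = v *m M *m P by rewrite mulmxKp.
rewrite [leLHS]/Num.norm /= mx_normrE; apply: bigmax_le => [|[i0 i] _].
  by rewrite mulr_ge0 // anorm_ge0.
rewrite /= (ord1 i0) [in leLHS]vE mxE; apply: le_trans (ler_norm_sum _ _ _) _.
apply: (@le_trans _ _ (\sum_j `|P j i| * an (ze v))).
  by apply: ler_sum => j _; rewrite normrM mulrC ler_wpM2l // TE.
rewrite -mulr_suml ler_wpM2r ?anorm_ge0 // /c (bigD1 i) //= lerDl.
by do 2!(apply: sumr_ge0 => ? _).
Qed.

(** Openness of [Omega] keeps [p + v] in the domain for the forward direction; the converse passes
    from closeness in [A] to closeness of triples by [zeta_lower_bound]. *)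
Lemma within_continuousP (Omega : set V) Phi : open Omega ->
  {within ([set ze p | p in Omega] : set (algtop I)), continuous (Phi : algtop I -> algtop I)} <->
  forall p, Omega p -> fcont I (Phi \o ze) p.
Proof.
move=> oO; split.
- move=> /subspace_continuousP H p Op e e0.
  have /cvg_algtopP/(_ e e0) := H (ze p) (ex_intro2 _ _ p Op erefl).
  rewrite near_withinE => /nbhs_algtopP[d d0 Hd].
  have /nbhs_ballP[r /= r0 Hr] : nbhs p Omega by exact: open_nbhs_nbhs.
  pose Z := zeta_bound I e2 e3; have Z0 : 0 <= Z := zeta_bound_ge0 I e2 e3.
  exists (Num.min r (d / (Z + 1))) => [|v].
    by rewrite lt_min r0 divr_gt0 // ltr_wpDl.
  rewrite lt_min ltr_pdivlMr; last by rewrite ltr_wpDl.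
  move=> /andP[vr vd]; apply: ltW; apply: Hd.
    rewrite (zetaD hI) addrC addKr; apply: le_lt_trans (anorm_zeta _ _ _ _) _.
    by have := normr_ge0 v; rewrite -/Z; lra.
  exists (p + v) => //; apply: Hr.
  by rewrite -ball_normE /= opprD addrA subrr sub0r normrN.
- move=> H; apply/subspace_continuousP => _ [p Op <-]; apply/cvg_algtopP => e e0.
  have [d d0 Hd] := H p Op (e / 2) (divr_gt0 e0 (ltr0Sn _ _)).
  have [c c0 Hc] := zeta_lower_bound.
  rewrite near_withinE; apply/nbhs_algtopP; exists (d / c); first by rewrite divr_gt0.
  move=> b; rewrite ltr_pdivlMr // => + [q Oq qb]; rewrite -{}qb /= => qd.
  have := Hd (q - p); rewrite [p + _]addrC subrK /= => h.
  apply: le_lt_trans (h _) _; last lra.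
  apply: le_lt_trans (Hc _) _.
  by rewrite (zetaD hI) zetaN mulrC.
Qed.

End Topology.

(** The derivative is chosen pointwise on [W], and is 0 elsewhere. Near each point it coincides, by
    uniqueness of Gateaux derivatives, with the locally constructed [T1], whose Frechet derivative
    yields both continuity and the next Gateaux derivative. *)
Lemma monogenic_derivative (R : realType) (m n : nat) (A : falgType R[i])
    (I : n.-tuple A) (hI : cartan_basis m I) (e2 e3 : A)
    (he : real_independent e2 e3)
    (hf : forall u : 'I_n, (u < m)%N ->
       [set functional I u z | z in E3 e2 e3] = [set: R[i]])
    (Omega : set 'rV[R]_3) (oO : open Omega) (Phi : A -> A) :
  let W := [set zeta e2 e3 p | p in Omega] in
  monogenic I e2 e3 W Phi ->
  exists2 Psi : A -> A, (forall z, W z -> is_gateaux I e2 e3 Phi z (Psi z)) &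
    monogenic I e2 e3 W Psi.
Proof.
move=> W [cPhi gPhi].
have /choice[Psi HPsi] : forall z, exists D, W z -> is_gateaux I e2 e3 Phi z D.
  by move=> z; have [/gPhi[D HD]|nW] := pselect (W z); [exists D|exists 0].
exists Psi => //.
have surj (u : 'I_n) : (u < m)%N -> forall w, exists p, coord I u (zeta e2 e3 p) = w.
  move=> um w; have : [set: R[i]] w by [].
  by rewrite -(hf u um) => -[_ [p _ <-] <-]; exists p.
pose f := Phi \o zeta e2 e3; pose D := Psi \o zeta e2 e3.
have cf : forall p, Omega p -> fcont I f p.
  by apply/(within_continuousP hI he Phi oO).
have gf p : Omega p -> agateaux I e2 e3 f p (D p).
  by move=> Op; apply/(is_gateauxP hI); apply: HPsi; exists p.
have main p : Omega p -> exists T2, fderiv I D p (fun v => zeta e2 e3 v * T2).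
  move=> Op; have /nbhs_ballP[r /= r0 Hr] : nbhs p Omega by exact: open_nbhs_nbhs.
  have inO q : `|q - p| < r -> Omega q.
    by move=> qr; apply: Hr; rewrite -ball_normE /= distrC.
  have [|||s [T1 [T2 [s0 HT]]]] :=
    @local_second_derivative _ _ _ _ _ hI e2 e3 surj n f D p r (leqnn n) r0.
  - by move=> q /inO; exact: cf.
  - by move=> q /inO; exact: gf.
  - by move=> q _ j; rewrite subnn.
  exists (T2 p); have [_ h2] : fderiv I f p (fun v => zeta e2 e3 v * T1 p) /\
     fderiv I T1 p (fun v => zeta e2 e3 v * T2 p) by apply: HT; rewrite subrr normr0.
  apply: (fderiv_near (r := Num.min r s) _ _ h2); first by rewrite lt_min r0.
  move=> q; rewrite lt_min => /andP[/inO Oq /HT[h1 _]].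
  exact: (agateaux_unique hI (fderiv_agateaux h1) (gf q Oq)).
split.
- apply/(within_continuousP hI he Psi oO) => p /main[T2 h]; exact: fderiv_fcont h.
- move=> _ [p Op <-]; have [T2 h] := main p Op; exists T2.
  by apply/(is_gateauxP hI); exact: fderiv_agateaux.
Qed.

Theorem theorem3 (R : realType) (m n : nat) (hm : (0 < m)%N) (hmn : (m <= n)%N)
    (A : falgType R[i]) (I : n.-tuple A) (hI : cartan_basis m I)
    (e2 e3 : A) (he : real_independent e2 e3)
    (hf : forall u : 'I_n, (u < m)%N ->
       [set functional I u z | z in E3 e2 e3] = [set: R[i]])
    (Omega : set 'rV[R]_3) (hOmega : domain Omega)
    (Phi : A -> A)
    (hPhi : monogenic I e2 e3 [set zeta e2 e3 p | p in Omega] Phi)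
    (r : nat) (hr : (0 < r)%N) :
  exists2 Psi : A -> A,
    is_gateaux_iter I e2 e3 [set zeta e2 e3 p | p in Omega] r Phi Psi &
    monogenic I e2 e3 [set zeta e2 e3 p | p in Omega] Psi.
Proof.
have [oO _ _] := hOmega.
(* The induction starts at order 0, where [Phi] itself serves. *)
elim: r {hr} => [|r IH]; first by exists Phi.
have [Xi hXi mXi] := IH.
have [Psi gPsi mPsi] := monogenic_derivative hI he hf oO mXi.
by exists Psi => //; exists Xi.
Qed.
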